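(* Let $k(t)$ be any positive function with $k(t)\to\infty$ and $k(t)=o(t)$ as $t\to\infty$. Let $(\xi_k)_{k\in\mathbb{N}}$ be i.i.d. copies of a positive random variable $\xi$ with $\mu:=\mathbb{E}\xi<\infty$ and $\sigma^2:={\rm Var}\,\xi\in(0,\infty)$ (the distribution of $\xi$ is otherwise arbitrary), and let $S_j=\xi_1+\dots+\xi_j$. Then, as $t\to\infty$, $$\left(\frac{[k(t)]^{1/2}([k(t)u]-1)!}{\sqrt{\sigma^2\mu^{-2[k(t)u]-1}t^{2[k(t)u]-1}}}\bigg(\sum_{j\geq 1}\frac{(t-S_j)^{[k(t)u]-1}\mathbf{1}_{\{S_j\leq t\}}}{([k(t)u]-1)!\,\mu^{[k(t)u]-1}}-\frac{t^{[k(t)u]}}{([k(t)u])!\,\mu^{[k(t)u]}}\bigg)\right)_{u>0}$$ converges weakly to $(T(u))_{u>0}$ in the $J_1$-topology on $D(0,\infty)$, where $T(u):=\int_{[0,\infty)}e^{-uy}{\rm d}B(y)=u\int_0^\infty e^{-uy}B(y)\,{\rm d}y$ and $(B(v))_{v\ge0}$ is a standard Brownian motion. In particular, the finite-dimensional distributions converge.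
   Context: $[x]$ is the integer part of $x$. $D(0,\infty)$ is the Skorokhod space of right-continuous functions on $(0,\infty)$ with finite left limits at positive points, equipped with the $J_1$-topology. On any compact subset of $(0,\infty)$ the displayed expression is well defined for all sufficiently large $t$. *)

(* Defs.v *)
From HB Require Import structures.
From mathcomp Require Import all_boot all_order all_algebra.
From mathcomp Require Import all_classical all_reals all_analysis.
From mathcomp Require Import normal_distribution.
Set Implicit Arguments. Unset Strict Implicit. Unset Printing Implicit Defensive.
Import Order.TTheory GRing.Theory Num.Theory.
Import numFieldNormedType.Exports.
Local Open Scope classical_set_scope.
Local Open Scope ring_scope.

Definition indep_upto {d} {T : measurableType d} {R : realType}
  (P : probability T R) (n : nat) (X : nat -> T -> R) : Prop :=
  forall (J : seq nat) (A : nat -> set R),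
    uniq J -> all (fun i => (i < n)%N) J -> (forall i, measurable (A i)) ->
    fine (P (\bigcap_(i in [set` J]) (X i @^-1` A i)))
      = \prod_(i <- J) fine (P (X i @^-1` A i)).

Definition iid {d} {T : measurableType d} {R : realType}
  (P : probability T R) (X : nat -> T -> R) : Prop :=
  (forall i, measurable_fun setT (X i)) /\
  (forall n, indep_upto P n X) /\
  (forall i (A : set R), measurable A -> P (X i @^-1` A) = P (X 0%N @^-1` A)).

(* Standard Brownian motion (B v)_{v >= 0} on the probability space P
   (values of B at negative times are irrelevant). *)
Definition standard_BM {d} {T : measurableType d} {R : realType}
  (P : probability T R) (B : R -> T -> R) : Prop :=
  (forall v, measurable_fun setT (B v)) /\
  (forall w, B 0 w = 0) /\
  (forall w, {within [set v : R | 0 <= v], continuous (fun v => B v w)}) /\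
  (forall ts : seq R, (0 <= head 0 ts) -> sorted <%R ts ->
     indep_upto P (size ts).-1
       (fun i w => B (nth 0 ts i.+1) w - B (nth 0 ts i) w)) /\
  (forall s t : R, 0 <= s -> s < t -> forall A : set R, measurable A ->
     P ((fun w => B t w - B s w) @^-1` A) = normal_prob 0 (Num.sqrt (t - s)) A).

Definition cadlag_pos {R : realType} (x : R -> R) : Prop :=
  forall s : R, 0 < s -> (x @ s^'+ --> x s) /\ cvg (x @ s^'-).

Definition J1_conv_on {R : realType} (a b : R) (x : nat -> R -> R) (y : R -> R)
  : Prop :=
  exists lam : nat -> R -> R,
    (forall n, {in `[a, b]%classic &, forall s r, s < r -> lam n s < lam n r}) /\
    (forall n, {within `[a, b]%classic, continuous (lam n)}) /\
    (forall n, lam n @` `[a, b]%classic = `[a, b]%classic) /\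
    (forall e : R, 0 < e -> \forall n \near \oo,
        forall s, a <= s <= b -> `|lam n s - s| <= e) /\
    (forall e : R, 0 < e -> \forall n \near \oo,
        forall s, a <= s <= b -> `|x n (lam n s) - y s| <= e).

Definition J1_conv {R : realType} (x : nat -> R -> R) (y : R -> R) : Prop :=
  forall a b : R, 0 < a -> a < b ->
    {for a, continuous y} -> {for b, continuous y} -> J1_conv_on a b x y.

Definition weak_conv_J1 {R : realType} {d d'} {T : measurableType d}
  {T' : measurableType d'} (P : probability T R) (Q : probability T' R)
  (X : R -> T -> R -> R) (Y : T' -> R -> R) : Prop :=
  forall F : (R -> R) -> R,
    (exists M : R, forall x, `|F x| <= M) ->
    (forall (xs : nat -> R -> R) (x : R -> R),
        (forall n, cadlag_pos (xs n)) -> cadlag_pos x -> J1_conv xs x ->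
        F (xs n) @[n --> \oo] --> F x) ->
    (forall t, measurable_fun setT (fun w => F (X t w))) ->
    measurable_fun setT (fun w => F (Y w)) ->
    (\int[P]_w (F (X t w))%:E)%E @[t --> +oo] --> (\int[Q]_w (F (Y w))%:E)%E.

(* S_{j+1} = xi_0 + ... + xi_j  (the paper's xi_1, xi_2, ... are xi 0, xi 1, ...) *)
Definition Spart {T : Type} {R : realType} (xi : nat -> T -> R) (j : nat) (w : T) : R :=
  \sum_(i < j.+1) xi i w.

Definition renewal_sum {T : Type} {R : realType} (xi : nat -> T -> R) (t : R)
  (m : nat) (w : T) : R :=
  fine (\sum_(0 <= j <oo)
          (if Spart xi j w <= t then (t - Spart xi j w) ^+ m.-1 else 0)%R%:E)%E.

(* The normalized process of the theorem, u > 0; m = [k(t) u].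
   Set to 0 where it is not defined (u <= 0 or [k(t)u] = 0). *)
Definition Xproc {T : Type} {R : realType} (k : R -> R) (xi : nat -> T -> R)
  (mu sigma2 : R) (t : R) (w : T) (u : R) : R :=
  let m := Num.truncn (k t * u) in
  if (0 < u) && (0 < m)%N then
    Num.sqrt ((Num.truncn (k t))%:R) * (m.-1)`!%:R
      / Num.sqrt (sigma2 * mu ^- (2 * m).+1 * t ^+ (2 * m).-1)
    * (renewal_sum xi t m w / ((m.-1)`!%:R * mu ^+ m.-1)
       - t ^+ m / (m`!%:R * mu ^+ m))
  else 0.

Definition Tproc {T : Type} {R : realType} (B : R -> T -> R) (w : T) (u : R) : R :=
  if 0 < u then
    u * fine (\int[lebesgue_measure]_(y in [set y : R | (0 <= y)%R])
                 (expR (- (u * y)) * B y w)%R%:E)%E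
  else 0.

(* Main.v *)
(* With m = [k(t)u], f(s) = (1 - s/t)_+ ^ (m - 1) and a normalisation a_t free of
   u, the process at u is a_t times the difference of sum_j f(S_j) and
   mu^-1 * integral_0^t f.  Taylor's formula for f at j * mu, with a remainder
   controlled by Var S_j = j * sigma^2, reduces it to a weighted sum of the
   deviations S_j - j * mu, the weights being close to the increments of
   exp(-u * kappa * j) in j, where kappa = k(t) * mu / t tends to 0.  Freezing the
   deviations on blocks of about s^2 / kappa indices and cutting the sum off after N
   blocks leaves a Lipschitz function of N independent block sums; the error is
   uniform for u in [a, b] and small in L^1.  The same reduction, with increments of
   B over time kappa in place of the centred steps, applies to T.  Lindeberg's
   replacement argument compares the two laws of the block sums.

   For a J1-continuous bounded F let F_l(x) be the supremum of F(z) - l * r over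
   cadlag z and r >= 0 with |x - z| <= r on [1/l, l].  F_l is Lipschitz and F <= F_l,
   so the limsup of E F(X_t) is at most that of E F_l at the discretised T.  When the
   discretisation errors are summable, the discretised paths converge to T almost
   surely and locally uniformly, hence the limsup of F_l along them is at most F(T).
   Apply this to F and to -F. *)

Require Import Defs.
From HB Require Import structures.
From mathcomp Require Import all_boot all_order all_algebra.
From mathcomp Require Import all_classical all_reals all_analysis.
From mathcomp Require Import measurable_realfun normal_distribution exponential_distribution.
From mathcomp Require Import ring lra.
Import Order.TTheory GRing.Theory Num.Theory.
Import numFieldNormedType.Exports.
Local Open Scope classical_set_scope.
Local Open Scope ring_scope.

Set Implicit Arguments.
Unset Strict Implicit.
Unset Printing Implicit Defensive.

(** The path space carries neither a sigma-algebra nor a metric here: a test functional [F] is only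
    sequentially continuous, and measurable along the two processes. In place of a portmanteau
    theorem or a tightness criterion stand the one-sided Lipschitz majorants, which on discretised
    paths are Lipschitz functions of [N] reals and hence measurable. Uniformity in [u] comes from
    dominating the kernels for all [u] in [[a, b]] by one exponentially decaying weight, so a single
    random variable bounds the error. Blocks are formed because smoothing a Lipschitz function of
    one real variable costs a fixed amount at each use. Smoothing at every step would pay this about
    [1 / kap] times; smoothing once per block pays it [N] times, and inside a block averaging
    preserves the smoothness, so each of the about [N * s ^+ 2 / kap] steps costs only [o(kap)].
    With two moments given, the Taylor remainder must be [a ^+ 2 * min(1, |a|)] rather than a cube.
    The walk and the Brownian motion live on different probability spaces and are compared through
    expectations only. *)

(** * Joint measurability of Caratheodory functions *)

Section caratheodory_function.
Context d (T : measurableType d) (R : realType).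
Implicit Types (g : T -> R -> R) (V : T -> R).

Lemma floor_mesh_cvg (y : R) :
  ((Num.floor (n.+1%:R * y))%:~R / n.+1%:R) @[n --> \oo] --> y.
Proof.
apply/cvgrPdist_le => e e0; near=> n.
have n0 : 0 < n.+1%:R :> R by rewrite ltr0n.
have h1 := floor_le_tmp (n.+1%:R * y); have h2 := floorD1_gt (n.+1%:R * y).
have -> : y - (Num.floor (n.+1%:R * y))%:~R / n.+1%:R
  = (n.+1%:R * y - (Num.floor (n.+1%:R * y))%:~R) / n.+1%:R.
  by field; rewrite gt_eqF.
rewrite ger0_norm; last by rewrite divr_ge0// ?subr_ge0// ltW.
rewrite ler_pdivrMr//.
have : 1 <= e * n.+1%:R.
  rewrite -ler_pdivrMl// mulr1.
  near: n; exists (Num.truncn e^-1) => // n /= hn.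
  have := truncnS_gt e^-1; move=> /ltW/le_trans; apply.
  by rewrite ler_nat ltnS.
move: h2; rewrite intrD; lra.
Unshelve. all: by end_near. Qed.

(** Rounding [y] down to the mesh [1 / n.+1] leaves countably many functions of [w] alone, glued
    over measurable pieces; continuity in [y] gives the pointwise limit. *)
Lemma measurable_fun_caratheodory g :
  (forall y, measurable_fun setT (g^~ y)) -> (forall w, continuous (g w)) ->
  measurable_fun setT (fun p : T * R => g p.1 p.2).
Proof.
move=> mg cg.
pose D n (y : R) : R := (Num.floor (n.+1%:R * y))%:~R / n.+1%:R.
apply: (@measurable_fun_cvg _ _ _ _ (fun n p => g p.1 (D n p.2))) => //; last first.
  move=> p _.
  exact: (cvg_comp _ _ (@floor_mesh_cvg p.2) (cg p.1 p.2)).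
move=> n _ A mA; rewrite setTI.
have -> : (fun p : T * R => g p.1 (D n p.2)) @^-1` A =
  \bigcup_(i : int) (((g^~ (i%:~R / n.+1%:R)) @^-1` A) `*`
       ((fun y => (Num.floor (n.+1%:R * y))%:~R : R) @^-1` [set i%:~R : R])).
  apply/seteqP; split => [[w y] /= h|[w y] /= [i _ [/= h1 h2]]].
    by exists (Num.floor (n.+1%:R * y)).
  by rewrite /D h2.
apply: countable_bigcupT_measurable => [|i]; first exact: countableP;  apply: measurableX.
  by rewrite -[X in measurable X]setTI; exact: mg.
rewrite -[X in measurable X]setTI.
have : measurable_fun setT (fun y : R => ((Num.floor (n.+1%:R * y))%:~R : R)).
  apply: nondecreasing_measurable => // x y xy.
  by rewrite ler_int le_floor// ler_pM2l// ltr0n.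
by move=> /(_ measurableT); apply.
Qed.

Lemma measurable_caratheodory_comp g V :
  (forall y, measurable_fun setT (g^~ y)) -> (forall w, continuous (g w)) ->
  measurable_fun setT V -> measurable_fun setT (fun w => g w (V w)).
Proof.
move=> mg cg mV.
have := measurable_fun_caratheodory mg cg.
move=> /(@measurableT_comp _ _ _ _ _ _ _ _ (fun w => (w, V w))); apply.
exact: measurable_fun_pair.
Qed.

End caratheodory_function.

Lemma iota_rcons n : iota 0 n.+1 = rcons (iota 0 n) n.
Proof. by rewrite -addn1 iotaD cats1. Qed.

(** * Independence of the next variable from the past *)

Section independence.
Context d (T : measurableType d) (R : realType) (P : probability T R).
Variable X : nat -> T -> R.

Definition cylinders n : set (set T) :=
  [set C | exists2 A : nat -> set R, (forall i, measurable (A i)) &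
     C = \bigcap_(i in [set` iota 0 n]) (X i @^-1` A i)].

(** A copy of [T] carrying the sigma-algebra generated by the first [n] variables, so that
    measurability with respect to the past is ordinary measurability on another type. *)
Definition past n := g_sigma_algebraType (cylinders n).

Hypothesis iidX : iid P X.

Let mX i : measurable_fun setT (X i). Proof. by case: iidX. Qed.

Lemma measurable_preimage_iid i A : measurable A -> measurable (X i @^-1` A).
Proof. by move=> mA; rewrite -[Y in measurable Y]setTI; exact: mX. Qed.

Lemma cylinders_measurable n : cylinders n `<=` measurable.
Proof.
move=> _ [A mA ->]; apply: fin_bigcap_measurable => // i _.
exact: measurable_preimage_iid.
Qed.

Lemma indep_iota n (A : nat -> set R) : (forall i, measurable (A i)) ->
  P (\bigcap_(i in [set` iota 0 n]) (X i @^-1` A i)) =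
  (\prod_(i <- iota 0 n) fine (P (X i @^-1` A i)))%:E.
Proof.
move=> mA; case: iidX => _ [iX _].
rewrite -(iX n (iota 0 n)) ?iota_uniq//.
  by rewrite fineK// fin_num_measure//; apply: cylinders_measurable; exists A.
by apply/allP => i; rewrite mem_iota.
Qed.

Lemma indep_cylinder n C B : cylinders n C -> measurable B ->
  P (C `&` X n @^-1` B) = (P C * P (X n @^-1` B))%E.
Proof.
move=> [A mA CE] mB.
pose A' i := if i == n then B else A i.
have mA' i : measurable (A' i) by rewrite /A'; case: ifP.
have A'E i : i \in iota 0 n -> A' i = A i.
  by rewrite mem_iota /A' => /andP[_]; case: eqVneq => // ->; rewrite ltnn.
have CE' : C = \bigcap_(i in [set` iota 0 n]) (X i @^-1` A' i).
  by rewrite CE; apply: eq_bigcapr => i /= /A'E ->.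
have -> : C `&` X n @^-1` B = \bigcap_(i in [set` iota 0 n.+1]) (X i @^-1` A' i).
  rewrite CE' iota_rcons; apply/seteqP; split => [w [h1 h2] i /=|w h].
    by rewrite mem_rcons inE => /orP[/eqP ->|hi]; [rewrite /A' eqxx|exact: h1].
  split; first by move=> i /= hi; apply: h; rewrite /= mem_rcons inE hi orbT.
  by have := h n; rewrite /A' eqxx; apply; rewrite /= mem_rcons inE eqxx.
rewrite indep_iota// iota_rcons big_rcons/= CE' indep_iota//.
rewrite /A' eqxx EFinM fineK//; apply: fin_num_measure.
exact: measurable_preimage_iid.
Qed.

Lemma past_measurable n : <<s cylinders n >> `<=` (@measurable d T).
Proof. exact: (smallest_sub (@sigma_algebra_measurable _ T) (@cylinders_measurable n)). Qed.

Lemma cylindersT n : cylinders n setT.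
Proof.
exists (fun=> setT) => //; apply/esym; rewrite -subTset => w _ i _ //.
Qed.

(** Both sides are finite measures in [C] and agree on the cylinders, which are stable under
    intersection and contain the whole space; uniqueness of measures extends the equality to the
    generated sigma-algebra. *)
Lemma indep_past n C B : <<s cylinders n >> C -> measurable B ->
  P (C `&` X n @^-1` B) = (P C * P (X n @^-1` B))%E.
Proof.
move=> sC mB; set D := X n @^-1` B.
have mD : measurable D by exact: measurable_preimage_iid.
pose r : {nonneg R} := NngNum (fine_ge0 (measure_ge0 P D)).
pose m1 : {measure set T -> \bar R} := mrestr P mD.
pose m2 : {measure set T -> \bar R} := mscale r P.
have PD : (r%:num)%:E = P D by rewrite /= fineK// fin_num_measure.
have m2E E : m2 E = (P E * P D)%E by rewrite muleC -PD.
suff : m1 C = m2 C by rewrite m2E.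
apply: (@g_sigma_algebra_measure_unique d R T (cylinders n) _ (fun=> setT)) => //.
- exact: cylinders_measurable.
- by move=> ?; exact: cylindersT.
- by rewrite bigcup_const.
- move=> _ _ [A mA ->] [A' mA' ->]; exists (fun i => A i `&` A' i).
    by move=> i; exact: measurableI.
  apply/seteqP; split => [w [h1 h2] i hi|w h]; first by split; [exact: h1|exact: h2].
  by split => i hi; have [] := h i hi.
- by move=> E cE; rewrite m2E; exact: indep_cylinder.
- move=> k; apply: (@le_lt_trans _ _ 1%E); last by rewrite ltry.
  by rewrite /m1/= /mrestr/= setTI; exact: probability_le1.
Qed.

Lemma measurable_past n (f : T -> R) :
  measurable_fun setT (f : past n -> R) -> measurable_fun setT f.
Proof.
by move=> mf _ A mA; apply: (@past_measurable n); exact: mf.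
Qed.

Lemma past_coordinate n i : (i < n)%N -> measurable_fun setT (X i : past n -> R).
Proof.
move=> ltin _ A mA; rewrite setTI; apply: sub_sigma_algebra.
exists (fun j => if j == i then A else setT); first by move=> j; case: ifP.
apply/seteqP; split => [w wA j _ /=|w /(_ i)/=]; first by case: ifP => // /eqP ->.
by rewrite eqxx; apply; rewrite /= mem_iota.
Qed.

Lemma past_id_measurable n : measurable_fun setT (id : T -> past n).
Proof. by move=> _ A /(@past_measurable n); rewrite setTI. Qed.

(* The law of [w |-> (w, X n w)] on the product of the past sigma-algebra with
   [R] is a product measure; Fubini then decouples the two occurrences of [w]. *)
Lemma decouple n (phi : T -> R -> R) :
  (forall y, measurable_fun setT (phi^~ y : past n -> R)) ->
  (forall w, continuous (phi w)) -> (forall w y, 0 <= phi w y) ->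
  (\int[P]_w (phi w (X n w))%:E =
   \int[P]_w \int[P]_w' (phi w (X n w'))%:E)%E.
Proof.
move=> mphi cphi phi0.
pose idn : T -> past n := id.
have midn : measurable_fun setT idn := @past_id_measurable n.
pose mid : {mfun T >-> past n} := mfun_Sub (mem_set midn).
pose mXn : {mfun T >-> R} := mfun_Sub (mem_set (mX n)).
pose P1 := distribution P mid.
pose P2 := distribution P mXn.
have mpair : measurable_fun setT (fun w => (idn w, X n w) : (past n * R)%type).
  exact: measurable_fun_pair.
pose mp : {mfun T >-> (past n * R)%type} := mfun_Sub (mem_set mpair).
pose P12 := distribution P mp.
pose f (p : (past n * R)%type) := (phi p.1 p.2)%:E.
have mf : measurable_fun setT f.
  apply/measurable_EFinP; exact: (@measurable_fun_caratheodory _ (past n) R phi).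
have f0 p : (0 <= f p)%E by rewrite lee_fin.
transitivity (\int[P12]_p f p)%E.
  by rewrite ge0_integral_distribution.
transitivity (\int[(P1 \x P2)%E]_p f p)%E.
  apply: eq_measure_integral => A mA _; apply/esym.
  apply: (@product_measure_unique _ _ _ _ _ P1 P2 P12) => // C B mC mB.
  rewrite /P12 /P1 /P2 /distribution /pushforward/=.
  exact: indep_past.
rewrite fubini_tonelli1//.
rewrite /fubini_F ge0_integral_distribution//.
- apply: eq_integral => w _ /=.
  rewrite ge0_integral_distribution//.
  by apply/measurable_EFinP; exact: (continuous_measurable_fun (cphi _)).
- exact: measurable_fun_fubini_tonelli_F.
- by move=> w; exact: integral_ge0.
Qed.

Lemma identically_distributed n (f : R -> \bar R) :
  measurable_fun setT f -> (forall y, (0 <= f y)%E) ->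
  (\int[P]_w f (X n w) = \int[P]_w f (X 0%N w))%E.
Proof.
move=> mf f0.
pose Y i : {mfun T >-> R} := mfun_Sub (mem_set (mX i)).
rewrite -(ge0_integral_distribution (Y n))// -(ge0_integral_distribution (Y 0%N))//.
apply: eq_measure_integral => A mA _.
by case: iidX => _ [_]; apply.
Qed.

End independence.

(** * Integrability and expectations of real functions *)

Section expectation_toolkit.
Context d (T : measurableType d) (R : realType).
Variable m : {measure set T -> \bar R}.
Implicit Types f g : T -> R.

Definition intble f := m.-integrable setT (EFin \o f).

Lemma intbleD f g : intble f -> intble g -> intble (fun x => f x + g x).
Proof. by move=> If Ig; exact: (integrableD measurableT If Ig). Qed.

Lemma intbleB f g : intble f -> intble g -> intble (fun x => f x - g x).
Proof. by move=> If Ig; exact: (integrableB measurableT If Ig). Qed.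

Lemma intbleZ (c : R) f : intble f -> intble (fun x => c * f x).
Proof. by move=> If; exact: (integrableZl measurableT c If). Qed.

Lemma intble_measurable f : intble f -> measurable_fun setT f.
Proof. by move=> /integrableP[/measurable_EFinP]. Qed.

Lemma intble_le f g : measurable_fun setT f -> (forall x, `|f x| <= g x) ->
  intble g -> intble f.
Proof.
move=> mf fg; apply: le_integrable => //; first exact/measurable_EFinP.
by move=> x _ /=; rewrite lee_fin (le_trans (fg x))// ler_norm.
Qed.

Lemma intble_norm f : intble f -> intble (fun x => `|f x|).
Proof. exact: integrable_norm. Qed.

Lemma intble_ge0 f : measurable_fun setT f -> (forall x, 0 <= f x) ->
  (\int[m]_x (f x)%:E < +oo)%E -> intble f.
Proof.
move=> mf f0 foo; apply/integrableP; split; first exact/measurable_EFinP.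
by under eq_integral do rewrite /= ger0_norm//.
Qed.

Lemma intbleE f : intble f -> (\int[m]_x (f x)%:E = (\int[m]_x f x)%R%:E)%E.
Proof.
by move=> If; rewrite /Rintegral fineK//; exact: (integrable_fin_num measurableT If).
Qed.

Lemma intble_le_expectation f g : intble f -> intble g -> (forall x, f x <= g x) ->
  \int[m]_x f x <= \int[m]_x g x.
Proof. by move=> If Ig fg; exact: le_Rintegral. Qed.

Lemma norm_expectation_le f g : intble f -> intble g -> (forall x, `|f x| <= g x) ->
  `|\int[m]_x f x| <= \int[m]_x g x.
Proof.
move=> If Ig fg; apply: (le_trans (le_normr_Rintegral measurableT If)).
by apply: intble_le_expectation => //; exact: intble_norm.
Qed.

End expectation_toolkit.

Section probability_toolkit.
Context d (T : measurableType d) (R : realType) (P : probability T R).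
Implicit Types f g : T -> R.

Lemma intble_cst (c : R) : intble P (fun=> c).
Proof. exact: finite_measure_integrable_cst. Qed.

Lemma intble_bounded (M : R) f : measurable_fun setT f -> (forall x, `|f x| <= M) ->
  intble P f.
Proof. by move=> mf fM; apply: (intble_le mf fM); exact: intble_cst. Qed.

Lemma expectation_cst (c : R) : \int[P]_x c = c.
Proof. 
rewrite Rintegral_cst//.
have -> : (P : {measure set T -> \bar R}) setT = 1%E by exact: probability_setT.
by rewrite mulr1.
Qed.

End probability_toolkit.

(** * Elementary bounds for the exponential *)

Section exponential_inequalities.
Context {R : realType}.
Implicit Types x y : R.

Lemma exp_norm_le y : expR `|y| <= expR y + expR (- y).
Proof.
have [y0|y0] := leP 0 y.
  by rewrite ger0_norm// lerDl expR_ge0.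
by rewrite ltr0_norm// lerDr expR_ge0.
Qed.

Lemma expRB1_le y : expR y - 1 <= y * expR y.
Proof.
have := expR_ge1Dx (- y); rewrite expRN => h.
have e0 := expR_gt0 y.
have : (1 - y) * expR y <= 1.
  by rewrite -ler_pdivlMr// mul1r.
lra.
Qed.

(** With [a = expR (x / 2)] the second difference is [(a - a^-1) ^+ 2], and for [x >= 0] the tangent
    bounds squeeze [a - a^-1] between [x / a] and [x * a]. *)
Lemma second_difference_exp x :
  `|expR x + expR (- x) - 2 - x ^+ 2| <= `|x| ^+ 3 * expR `|x|.
Proof.
wlog x0 : x / 0 <= x => [H|].
  have [/H//|x0] := leP 0 x.
  have := H (- x); rewrite oppr_ge0 (ltW x0) => /(_ erefl).
  by rewrite opprK normrN sqrrN (addrC (expR (- x))).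
rewrite !(ger0_norm x0).
set a := expR (x / 2).
have a0 : 0 < a by exact: expR_gt0.
have aE : expR x = a ^+ 2 by rewrite -expRM_natl; congr expR; field.
have aNE : expR (- x) = a ^- 2 by rewrite expRN aE.
have -> : expR x + expR (- x) - 2 = (a - a^-1) ^+ 2.
  by rewrite aE aNE; field; rewrite gt_eqF.
have lo : x <= (a - a^-1) * a.
  have -> : (a - a^-1) * a = a ^+ 2 - 1 by field; rewrite gt_eqF.
  by rewrite -aE lerBrDl; exact: expR_ge1Dx.
have hi : a - a^-1 <= x * a.
  have := expRB1_le x; rewrite aE => h.
  rewrite -(ler_pM2l a0); have -> : a * (a - a^-1) = a ^+ 2 - 1 by field; rewrite gt_eqF.
  by apply: (le_trans h); rewrite expr2; apply/eqP/eqP; lra.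
have lo2 : x ^+ 2 <= (a - a^-1) ^+ 2 * expR x.
  by rewrite aE -exprMn ler_sqr ?nnegrE// (le_trans x0).
have hi2 : (a - a^-1) ^+ 2 <= x ^+ 2 * expR x.
  have l0 : 0 <= a - a^-1 by rewrite -(pmulr_lge0 _ a0) (le_trans x0).
  by rewrite aE -exprMn ler_sqr ?nnegrE// mulr_ge0// ltW.
have E1 := expRB1_le x.
have E0 := expR_gt0 x.
have x2 : 0 <= x ^+ 2 := sqr_ge0 x.
have k : x ^+ 2 * (expR x - 1) <= x ^+ 3 * expR x.
  by rewrite (_ : x ^+ 3 * _ = x ^+ 2 * (x * expR x)); [rewrite ler_wpM2l|ring].
rewrite ler_norml; apply/andP; split; last by lra.
have q0 : 0 <= (a - a^-1) ^+ 2 := sqr_ge0 _.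
have q1 : (a - a^-1) ^+ 2 * (expR x - 1) <= x ^+ 3 * expR x * expR x.
  apply: (@le_trans _ _ (x ^+ 2 * expR x * (expR x - 1))).
    by rewrite ler_wpM2r// subr_ge0 -expR0 ler_expR.
  by have := ler_wpM2r (ltW E0) k; lra.
suff : x ^+ 2 - (a - a^-1) ^+ 2 <= x ^+ 3 * expR x by lra.
rewrite -(ler_pM2r E0).
have : x ^+ 2 * expR x - x ^+ 2 <= x ^+ 3 * expR x by lra.
have : 0 <= x ^+ 3 * expR x * (expR x - 1).
  by rewrite !mulr_ge0 ?exprn_ge0 ?expR_ge0// subr_ge0 -expR0 ler_expR.
lra.
Qed.

Lemma pow_le_fact_exp n y : 0 <= y -> y ^+ n.+1 <= (n.+1)`!%:R * expR y.
Proof.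
move=> y0; have := expR_ge1Dxn n y0.
have f0 : 0 < (n.+1)`!%:R :> R by rewrite ltr0n fact_gt0.
move=> h; rewrite -ler_pdivrMl// mulrC; lra.
Qed.

End exponential_inequalities.

(** * Gaussian moments from the moment generating function *)

Section gaussian_moments.
Context {R : realType} (s : R) (s0 : 0 < s).
Local Notation mu := (@lebesgue_measure R).
Local Notation N := (normal_prob (0 : R) s).

(** The change of variables holds for the Radon-Nikodym derivative, which equals [normal_pdf] almost
    everywhere because both have the same integral over every measurable set. *)
Lemma integral_normal_prob (f : R -> \bar R) : measurable_fun setT f ->
  (forall x, 0 <= f x)%E ->
  (\int[N]_x f x = \int[mu]_x (f x * (normal_pdf 0 s x)%:E))%E.
Proof.
move=> mf f0.
have dom := normal_prob_dominates (0 : R) s.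
rewrite -(Radon_Nikodym_SigmaFinite.change_of_variables dom)//.
apply: ae_eq_integral => //.
- apply: emeasurable_funM => //; apply: (measurable_int mu).
  exact: Radon_Nikodym_SigmaFinite.f_integrable.
- apply: emeasurable_funM => //=; apply/measurable_EFinP.
  exact: measurable_normal_pdf.
- apply: ae_eqe_mul2l => /=.
  apply: integral_ae_eq => //=.
  + exact: Radon_Nikodym_SigmaFinite.f_integrable.
  + by apply/measurable_EFinP; exact: measurable_normal_pdf.
  + by move=> E _ mE; rewrite -Radon_Nikodym_SigmaFinite.f_integral.
Qed.

(** Completing the square: tilting the density centred at [0] gives a constant times the density
    centred at [l * s ^+ 2]. *)
Lemma normal_mgf (l : R) :
  (\int[N]_x (expR (l * x))%:E = (expR (l ^+ 2 * s ^+ 2 / 2))%:E)%E.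
Proof.
have mf : measurable_fun setT (fun x : R => (expR (l * x))%:E).
  by apply/measurable_EFinP; apply: measurableT_comp => //; exact: mulrl_measurable.
rewrite (integral_normal_prob mf); last by move=> x; rewrite lee_fin expR_ge0.
under eq_integral => x _.
  have -> : ((expR (l * x))%:E * (normal_pdf 0 s x)%:E =
     (expR (l ^+ 2 * s ^+ 2 / 2))%:E * (normal_pdf (l * s ^+ 2) s x)%:E)%E.
    rewrite /normal_pdf gt_eqF// /normal_fun -!EFinM; congr EFin.
    rewrite mulrCA [RHS]mulrCA -!expRD; congr (_ * expR _).
    by field; rewrite gt_eqF.
  over.
rewrite ge0_integralZl ?integral_normal_pdf ?mule1//.
- by apply/measurable_EFinP; exact: measurable_normal_pdf.
- by move=> x _; rewrite lee_fin normal_pdf_ge0.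
Qed.

End gaussian_moments.

Section gaussian_variable.
Context d (T : measurableType d) {R : realType} (P : probability T R).
Variables (s : R) (Z : T -> R).
Hypotheses (s0 : 0 < s) (mZ : measurable_fun setT Z).
Hypothesis lawZ : forall A : set R, measurable A ->
  P (Z @^-1` A) = normal_prob 0 s A.

Lemma gauss_mgf (l : R) :
  (\int[P]_w (expR (l * Z w))%:E = (expR (l ^+ 2 * s ^+ 2 / 2))%:E)%E.
Proof.
have mZ' : measurable_fun setT (Z : T -> measurableTypeR R) by exact: mZ.
pose mZf : {mfun T >-> measurableTypeR R} :=
  @mfun_Sub _ _ T (measurableTypeR R) (Z : T -> measurableTypeR R) (mem_set mZ').
have mf : measurable_fun setT (fun x : R => (expR (l * x))%:E).
  by apply/measurable_EFinP; apply: measurableT_comp => //; exact: mulrl_measurable.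
rewrite -(normal_mgf s0) -(ge0_integral_distribution mZf mf).
  by apply: eq_measure_integral => A mA _; exact: lawZ.
by move=> x; rewrite lee_fin expR_ge0.
Qed.

Let mexp l : measurable_fun setT (fun w => expR (l * Z w)).
Proof.
apply: measurableT_comp => //; apply: measurable_funM => //.
Qed.

Lemma gauss_exp_intble l : intble P (fun w => expR (l * Z w)).
Proof.
apply: intble_ge0; [exact: mexp|by move=> w; exact: expR_ge0|].
by rewrite gauss_mgf ltry.
Qed.

Lemma gauss_exp_expectation l :
  \int[P]_w (expR (l * Z w)) = expR (l ^+ 2 * s ^+ 2 / 2).
Proof. by rewrite /Rintegral gauss_mgf. Qed.

Let D l : intble P (fun w => expR (l * Z w) + expR (- l * Z w)).
Proof. by apply: intbleD; exact: gauss_exp_intble. Qed.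

Let ED l : \int[P]_w (expR (l * Z w) + expR (- l * Z w)) =
  2 * expR (l ^+ 2 * s ^+ 2 / 2).
Proof.
rewrite RintegralD//; try exact: gauss_exp_intble.
by rewrite !gauss_exp_expectation sqrrN; ring.
Qed.

Lemma gauss_pow_intble n : intble P (fun w => Z w ^+ n.+1).
Proof.
apply: (@intble_le _ _ _ _ _ (fun w => (n.+1)`!%:R * (expR (1 * Z w) + expR (- 1 * Z w)))).
- exact: measurable_funX.
- move=> w; rewrite normrX (le_trans (pow_le_fact_exp n (normr_ge0 _)))//.
  by rewrite ler_wpM2l// mul1r mulN1r exp_norm_le.
- exact: intbleZ.
Qed.

Lemma gauss_intble : intble P Z.
Proof. by apply: (@intble_le _ _ _ _ _ (fun w => `|Z w ^+ 1|)) => //; exact/intble_norm/gauss_pow_intble. Qed.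

Let vanish (x C : R) : (forall l, 0 < l -> l <= 1 -> x <= C * l) -> x <= 0.
Proof.
move=> H; have [//|x0] := leP x 0.
pose l := x / (`|C| * 2 + x).
have p : 0 < `|C| * 2 + x by have := normr_ge0 C; lra.
have l0 : 0 < l by rewrite divr_gt0.
have l1 : l <= 1 by rewrite ler_pdivrMr// mul1r; have := normr_ge0 C; lra.
have h : x <= `|C| * l by rewrite (le_trans (H _ l0 l1))// ler_pM2r// ler_norm.
have e : l * (`|C| * 2 + x) = x by rewrite divfK// gt_eqF.
have := normr_ge0 C; nra.
Qed.

(** Taking expectations in [1 + k * Z <= expR (k * Z)] for [k = l] and [k = - l] shows that the mean
    is of order [l] for every [l] in []0, 1]]. *)
Lemma gauss_mean : \int[P]_w Z w = 0.
Proof.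
have H l : 0 < l -> l <= 1 -> `|\int[P]_w Z w| <= s ^+ 2 / 2 * expR (s ^+ 2 / 2) * l.
  move=> l0 l1.
  have hl : (expR (l ^+ 2 * s ^+ 2 / 2) - 1) <= l ^+ 2 * s ^+ 2 / 2 * expR (s ^+ 2 / 2).
    apply: (le_trans (expRB1_le _)); rewrite ler_wpM2l//.
      by rewrite divr_ge0// mulr_ge0// sqr_ge0.
    rewrite ler_expR ler_pM2r// ler_piMl// ?sqr_ge0// expr_le1// ltW//.
  have Hs k : k ^+ 2 = l ^+ 2 -> 1 + k * \int[P]_w Z w <= expR (l ^+ 2 * s ^+ 2 / 2).
    move=> kl; rewrite -kl -gauss_exp_expectation -RintegralZl//; last exact: gauss_intble.
    rewrite -[X in X + _](expectation_cst P) -RintegralD//; first last.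
    - exact: intbleZ gauss_intble.
    - exact: intble_cst.
    apply: intble_le_expectation.
    - by apply: intbleD; [exact: intble_cst|exact: intbleZ gauss_intble].
    - exact: gauss_exp_intble.
    - by move=> w; exact: expR_ge1Dx.
  have h1 := Hs l erefl; have h2 := Hs (- l) (sqrrN l).
  rewrite -(ler_pM2l l0) -[X in X * `|_|](gtr0_norm l0) -normrM ler_norml.
  set m := \int[P]_w Z w in h1 h2 *.
  have -> : l * (s ^+ 2 / 2 * expR (s ^+ 2 / 2) * l) = l ^+ 2 * s ^+ 2 / 2 * expR (s ^+ 2 / 2) by ring.
  by apply/andP; split; lra.
by apply/eqP; rewrite -normr_le0; exact: vanish H.
Qed.

(** The second difference of the exponential at [l * Z] has expectation [l ^+ 2] times the second
    moment up to order [l ^+ 3]; the generating function gives [l ^+ 2 * s ^+ 2] for it up to the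
    same order. Divide by [l ^+ 2] and let [l] tend to [0]. *)
Lemma gauss_variance : \int[P]_w (Z w ^+ 2) = s ^+ 2.
Proof.
set V := \int[P]_w _.
have I2 := gauss_pow_intble 1.
(* The first term is the cubic remainder, with [6 = 3!] from [|Z| ^+ 3 <= 6 * expR |Z|] and [2] from
   the two signs; the second bounds the error in [2 * expR h - 2]. *)
pose C := 12 * expR (2 ^+ 2 * s ^+ 2 / 2) + s ^+ 2 * (s ^+ 2 / 2 * expR (s ^+ 2 / 2)).
have H l : 0 < l -> l <= 1 -> `|s ^+ 2 - V| <= C * l.
  move=> l0 l1; pose h := l ^+ 2 * s ^+ 2 / 2.
  have l2 : 0 < l ^+ 2 by rewrite exprn_gt0.
  have s2 : 0 < s ^+ 2 by rewrite exprn_gt0.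
  have l21 : l ^+ 2 <= l by rewrite expr2 ler_piMl// ltW.
  have h0 : 0 <= h by rewrite divr_ge0// mulr_ge0// ltW.
  have hs : h <= s ^+ 2 / 2 by rewrite ler_pM2r// ler_piMl ?(ltW s2)//; exact: (le_trans l21).
  have eh : expR h <= expR (s ^+ 2 / 2) by rewrite ler_expR.
  have : `|2 * expR h - 2 - l ^+ 2 * V| <= 12 * l ^+ 3 * expR (2 ^+ 2 * s ^+ 2 / 2).
    have -> : 2 * expR h - 2 - l ^+ 2 * V =
        \int[P]_w (expR (l * Z w) + expR (- l * Z w) - 2 - l ^+ 2 * Z w ^+ 2).
      rewrite RintegralB//; last 2 first.
      - by apply: intbleB => //; exact: intble_cst.
      - exact: intbleZ.
      rewrite RintegralB//; last 2 first.
      - exact: D.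
      - exact: intble_cst.
      by rewrite ED expectation_cst RintegralZl.
    have -> : 12 * l ^+ 3 * expR (2 ^+ 2 * s ^+ 2 / 2) =
        \int[P]_w (6 * l ^+ 3 * (expR (2 * Z w) + expR (- 2 * Z w))).
      by rewrite RintegralZl ?ED//; [ring|exact: D].
    apply: norm_expectation_le.
    - apply: intbleB; last exact: intbleZ.
      by apply: intbleB; [exact: D|exact: intble_cst].
    - by apply: intbleZ; exact: D.
    move=> w; have SD := second_difference_exp (l * Z w).
    rewrite !mulNr -exprMn; apply: (le_trans SD).
    rewrite normrM (gtr0_norm l0) exprMn.
    rewrite -(mulrA (l ^+ 3)) (_ : 6 * l ^+ 3 * _ = l ^+ 3 * (6 * (expR (2 * Z w) + expR (- (2 * Z w))))); last by ring.
    rewrite ler_wpM2l ?exprn_ge0 ?(ltW l0)//.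
    have := pow_le_fact_exp 2 (normr_ge0 (Z w)).
    rewrite (_ : 3`!%:R = 6 :> R)// => k3.
    have e1 : expR (l * `|Z w|) <= expR `|Z w| by rewrite ler_expR ler_piMl.
    apply: (@le_trans _ _ (6 * expR `|Z w| * expR `|Z w|)).
      by apply: ler_pM => //; rewrite ?exprn_ge0 ?expR_ge0.
    have zz : `|Z w| + `|Z w| = `|2 * Z w| by rewrite normrM (@ger0_norm _ 2)//; ring.
    rewrite -mulrA ler_wpM2l// -expRD zz.
    exact: exp_norm_le.
  have E1 : 1 + h <= expR h := expR_ge1Dx h.
  have E2 : expR h - 1 <= h * expR h := expRB1_le h.
  set e := expR (2 ^+ 2 * s ^+ 2 / 2); rewrite ler_norml => /andP[H1 H2].
  have ES0 := expR_gt0 (s ^+ 2 / 2).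
  have hE : 2 * h = l ^+ 2 * s ^+ 2 by rewrite /h; field.
  have q1 : l ^+ 2 * (s ^+ 2 - V) <= 12 * l ^+ 3 * e by lra.
  have q3 : h * expR h <= h + h * h * expR (s ^+ 2 / 2).
    have : h * (expR h - 1) <= h * (h * expR (s ^+ 2 / 2)).
      rewrite ler_wpM2l// (le_trans E2)// ler_wpM2l//.
    lra.
  have q2 : - (l ^+ 2 * (s ^+ 2 - V)) <= 12 * l ^+ 3 * e + 2 * (h * h * expR (s ^+ 2 / 2)).
    by lra.
  have q4 : 2 * (h * h * expR (s ^+ 2 / 2)) <= l ^+ 3 * (s ^+ 2 * (s ^+ 2 / 2 * expR (s ^+ 2 / 2))).
    have -> : 2 * (h * h * expR (s ^+ 2 / 2)) =
      l ^+ 2 * l ^+ 2 * (s ^+ 2 * (s ^+ 2 / 2 * expR (s ^+ 2 / 2))) by rewrite /h; field.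
    rewrite ler_wpM2r//.
      by rewrite !mulr_ge0// ?divr_ge0// ltW.
    by rewrite (exprSr l 2) ler_wpM2l// ltW.
  have c0 : 0 <= l ^+ 3 * (s ^+ 2 * (s ^+ 2 / 2 * expR (s ^+ 2 / 2))).
    by rewrite !mulr_ge0// ?divr_ge0 ?exprn_ge0 ltW.
  rewrite -(ler_pM2l l2) -[X in X * `|_|](gtr0_norm l2) -normrM ler_norml /C -/e.
  have -> : l ^+ 2 * ((12 * e + s ^+ 2 * (s ^+ 2 / 2 * expR (s ^+ 2 / 2))) * l)
    = 12 * l ^+ 3 * e + l ^+ 3 * (s ^+ 2 * (s ^+ 2 / 2 * expR (s ^+ 2 / 2))) by ring.
  by apply/andP; split; lra.
apply/eqP; rewrite eq_sym -subr_eq0 -normr_le0.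
exact: vanish H.
Qed.

(** From [y ^+ 4 <= 24 * expR |y|] at [y = Z / s] one gets [48 * expR (1 / 2) * s ^+ 4], and
    [expR (1 / 2) <= 2] leaves room below [120]. *)
Lemma gauss_fourth_moment : \int[P]_w (Z w ^+ 4) <= 120 * s ^+ 4.
Proof.
have I4 := gauss_pow_intble 3.
have -> : 120 * s ^+ 4 = \int[P]_w (120 * s ^+ 4) by rewrite expectation_cst.
apply: (@le_trans _ _ (\int[P]_w (24 * s ^+ 4 * (expR (s^-1 * Z w) + expR (- s^-1 * Z w))))).
  apply: intble_le_expectation => //; first by apply: intbleZ; exact: D.
  move=> w; have := pow_le_fact_exp 3 (normr_ge0 (s^-1 * Z w)).
  rewrite (_ : 4`!%:R = 24 :> R)// => h.
  have s4 : 0 < s ^+ 4 by rewrite exprn_gt0.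
  have -> : Z w ^+ 4 = s ^+ 4 * `|s^-1 * Z w| ^+ 4.
    rewrite -normrX exprMn ger0_norm; first by field; rewrite gt_eqF.
    by rewrite mulr_ge0// ?exprn_even_ge0.
  rewrite (mulrC 24) -(mulrA (s ^+ 4)) ler_pM2l// (le_trans h)// ler_wpM2l//.
  by rewrite (le_trans (exp_norm_le _))// mulNr.
rewrite RintegralZl//; last exact: D.
rewrite ED expectation_cst exprVn mulVf ?gt_eqF ?exprn_gt0//.
have s4 : 0 < s ^+ 4 by rewrite exprn_gt0.
have : expR (1 / 2) <= 2 :> R.
  have h : 1 - 1 / 2 <= expR (- (1 / 2)) :> R by rewrite (le_trans _ (expR_ge1Dx _)).
  have e0 := expR_gt0 (1 / 2 : R).
  have := ler_wpM2l (ltW e0) h.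
  by rewrite expRN divff ?gt_eqF//; lra.
have e0 := expR_gt0 (1 / 2 : R).
nra.
Qed.

End gaussian_variable.

(** * Mean value theorem and primitives on the line *)

Section primitive.
Context {R : realType}.
Local Notation mu := (@lebesgue_measure R).
Implicit Types (f h : R -> R) (a b x : R).

Lemma mean_value f (f' : R -> R) : (forall x, is_derive x 1 f (f' x)) ->
  forall a b, exists2 c, `|c - a| <= `|b - a| & f b - f a = f' c * (b - a).
Proof.
move=> df; have cf : continuous f.
  move=> x; apply: differentiable_continuous; apply/derivable1_diffP.
  by have [] := df x.
have H a b : a <= b -> exists2 c, c \in `[a, b] & f b - f a = f' c * (b - a).
  move=> ab; apply: MVT_segment => //.
  by apply: continuous_subspaceT.
move=> a b; have [ab|/ltW ba] := leP a b.
  have [c] := H _ _ ab; rewrite in_itv/= => /andP[ac cb] E; exists c => //.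
  by rewrite !ger0_norm ?subr_ge0// lerB.
have [c] := H _ _ ba; rewrite in_itv/= => /andP[ac cb] E; exists c.
  by rewrite !ler0_norm ?subr_le0// lerN2 lerB.
by rewrite -opprB E -mulrN opprB.
Qed.

(** The integral has to start to the left of [x], so its starting point [- N x] moves with [x];
    normalising at [0] makes the choices agree, and near each point the function is one fixed
    [H n]. *)
Lemma continuous_primitive h : continuous h ->
  {H : R -> R | forall x, is_derive x 1 H (h x)}.
Proof.
move=> ch.
pose I a b := (\int[mu]_(t in `[a, b]) h t)%R.
have ih a b : mu.-integrable `[a, b] (EFin \o h).
  apply: continuous_compact_integrable; first exact: segment_compact.
  exact: continuous_subspaceT.
pose H (n : nat) x := I (- n%:R) x - I (- n%:R) 0.
have dH n x : - n%:R < x -> is_derive x 1 (H n) (h x).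
  move=> nx; have xx : x < x + 1 by rewrite ltrDl.
  have [d1 d2] := @continuous_FTC1_closed _ h (- n%:R) x (x + 1) xx (ih _ _) nx (ch x).
  have dI : is_derive x 1 (I (- n%:R)) (h x).
    by apply: (DeriveDef d1); rewrite -derive1E; exact: d2.
  rewrite -[h x]subr0.
  exact: (is_deriveB dI (is_derive_cst (I (- n%:R) 0) x 1)).
have HE n m x : (n <= m)%N -> (0 < n)%N -> - n%:R <= x -> H m x = H n x.
  move=> nm n0 nx.
  have add y : - n%:R <= y -> I (- m%:R) y - I (- m%:R) (- n%:R) = I (- n%:R) y.
    move=> ny.
    rewrite /I Rintegral_itvB//.
    - by rewrite -Rintegral_itv_obnd_cbnd//; apply: integrableS (ih (- n%:R) y) => //; exact: subset_itv_oc_cc.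
    - by rewrite bnd_simp lerN2 ler_nat.
  by rewrite /H -(add x)// -(add 0) ?oppr_le0//; ring.
pose N x := (Num.truncn `|x|).+2.
exists (fun x => H (N x) x) => x.
have Nx : - (N x)%:R < x.
  rewrite ltrNl; apply: (le_lt_trans (ler_norm _)); rewrite normrN /N.
  by apply: (lt_trans (truncnS_gt _)); rewrite ltr_nat.
apply: (near_eq_is_derive _ (dH _ _ Nx)).
near=> y.
have yx : `|y - x| < 1.
  rewrite distrC; near: y; exists 1 => //= y.
have tx : `|x| < (Num.truncn `|x|).+1%:R := truncnS_gt _.
have ty : (Num.truncn `|y|)%:R <= `|y| by rewrite truncn_le.
have ty' : `|y| < (Num.truncn `|y|).+1%:R := truncnS_gt _.
have yy : `|y| <= `|y - x| + `|x| by rewrite -[X in `|X| <= _](subrK x) ler_normD.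
have Ny : (N y <= (N x).+2)%N.
  rewrite /N !ltnS -ltnS -(ltr_nat R).
  by move: tx; rewrite -!natr1; lra.
have yN : - (N y)%:R <= y.
  by rewrite lerNl (le_trans (ler_norm _))// normrN /N; move: ty'; rewrite -!natr1; lra.
have yNx : - (N x)%:R <= y.
  rewrite lerNl (le_trans (ler_norm _))// normrN /N; move: tx; rewrite -!natr1; lra.
by rewrite -(HE (N y) (N x).+2)// -(HE (N x) (N x).+2)//; exact: leq_trans (leqnSn _) (leqnSn _).
Unshelve. all: by end_near. Qed.
End primitive.

(** * Smoothing of Lipschitz functions *)

Section smoothing.
Context {R : realType}.
Implicit Types (f g h : R -> R) (x y s : R).

Definition bounded_lipschitz (K : R) f :=
  (forall x, `|f x| <= K) /\ (forall x y, `|f x - f y| <= K * `|x - y|).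

Lemma bounded_lipschitz_continuous K f : bounded_lipschitz K f -> continuous f.
Proof.
move=> [_ lf] x.
have K1 : 0 < `|K| + 1 by rewrite ltr_wpDl.
apply/cvgrPdist_lt => e e0; near=> y.
apply: (le_lt_trans (lf _ _)).
apply: (@le_lt_trans _ _ ((`|K| + 1) * `|x - y|)).
  by rewrite ler_wpM2r// (le_trans (ler_norm _))// lerDl.
rewrite mulrC -ltr_pdivlMr//; near: y.
by exists (e / (`|K| + 1)) => //=; rewrite divr_gt0.
Unshelve. all: by end_near. Qed.

Lemma bounded_lipschitz_measurable K f : bounded_lipschitz K f -> measurable_fun setT f.
Proof. by move=> /bounded_lipschitz_continuous; exact: continuous_measurable_fun. Qed.

(** The size of a second-order Taylor remainder when the second derivative is bounded and Lipschitz: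
    cubic near [0] and quadratic far away, hence integrable under a finite second moment. *)
Definition taylor_rest (a : R) := a ^+ 2 * Num.min 1 `|a|.

Lemma taylor_rest_ge0 a : 0 <= taylor_rest a.
Proof. by rewrite mulr_ge0 ?sqr_ge0// le_min ler01 normr_ge0. Qed.

Lemma measurable_taylor_rest : measurable_fun setT taylor_rest.
Proof.
apply: measurable_funM; first exact: exprn_measurable.
by apply: measurable_minr => //; exact: normr_measurable.
Qed.

Lemma taylor_rest_le_sqr a : taylor_rest a <= a ^+ 2.
Proof. by rewrite ler_piMr ?sqr_ge0// ge_min lexx. Qed.

Lemma le_taylor_rest_cube a : taylor_rest a <= a ^+ 2 * `|a|.
Proof. by rewrite ler_wpM2l ?sqr_ge0// ge_min lexx orbT. Qed.

(** [p] and [q] play the first derivative and half the second one. The expansion is recorded instead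
    of differentiability since it survives averaging without differentiating under an integral. *)
Definition second_order (K C : R) g p q :=
  [/\ bounded_lipschitz K g, bounded_lipschitz K p, bounded_lipschitz K q &
    forall x a, `|g (x + a) - g x - p x * a - q x * a ^+ 2| <= C * taylor_rest a].

Let is_derive_shift f (f' : R -> R) (c : R) : (forall x, is_derive x 1 f (f' x)) ->
  forall x, is_derive x 1 (fun y => f (y + c)) (f' (x + c)).
Proof.
move=> df x.
have d1 : is_derive x 1 (fun y : R => y + c) 1.
  rewrite -[X in is_derive _ _ _ X]addr0.
  exact: (is_deriveD (@is_derive_id R R x 1) (@is_derive_cst R R R c x 1)).
rewrite -[f' _]mulr1.
exact: (@is_derive1_comp R f (fun y => y + c) x (f' (x + c)) 1 (df _) d1).
Qed.

(* Two moving averages of width [e] turn a Lipschitz function into a function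
   whose second derivative is bounded and Lipschitz; they are written as a
   second difference of a twofold primitive. *)
Lemma lipschitz_smoothing (M L e : R) h : 0 < e -> e <= 1 -> 0 <= L ->
  (forall x, `|h x| <= M) -> (forall x y, `|h x - h y| <= L * `|x - y|) ->
  exists K, exists g, exists p, exists q,
    second_order K (4 * L / e ^+ 2) g p q /\ (forall x, `|g x - h x| <= 2 * L * e).
Proof.
move=> e0 e1 L0 hM hL.
have ch : continuous h.
  apply: (@bounded_lipschitz_continuous (Num.max M L)); split => [x|x y].
    by rewrite le_max hM.
  by rewrite (le_trans (hL x y))// ler_wpM2r// le_max lexx orbT.
have [H dH] := continuous_primitive ch.
have cH : continuous H.
  by move=> x; apply: differentiable_continuous; apply/derivable1_diffP; have [] := dH x.
have [F dF] := continuous_primitive cH.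
pose D f x := f (x + e) - f x.
have dD f f' : (forall x, is_derive x 1 f (f' x)) ->
    forall x, is_derive x 1 (D f) (D f' x).
  move=> df x; have := is_deriveB (is_derive_shift e df x) (df x); exact.
pose g x := e ^- 2 * D (D F) x.
pose p x := e ^- 2 * D (D H) x.
pose q x := e ^- 2 * D (D h) x.
have en0 : e != 0 by rewrite gt_eqF.
have ei0 : 0 < e ^- 2 by rewrite invr_gt0 exprn_gt0.
have dZ f f' : (forall x, is_derive x 1 f (f' x)) ->
   forall x, is_derive x 1 (fun x => e ^- 2 * f x) (e ^- 2 * f' x).
  move=> df x; exact: (is_deriveZ (e ^- 2) (df x)).
have dg x : is_derive x 1 g (p x) by apply: (dZ _ _ (dD _ _ (dD _ _ dF))).
have dp x : is_derive x 1 p (q x) by apply: (dZ _ _ (dD _ _ (dD _ _ dH))).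
have mv f f' x : (forall x, is_derive x 1 f (f' x)) ->
    exists2 c, `|c - x| <= e & D f x = e * f' c.
  move=> df; have [c c1 c2] := mean_value df x (x + e).
  move: c1 c2; rewrite addrAC subrr add0r (gtr0_norm e0) => c1 c2.
  by exists c => //; rewrite /D c2 mulrC.
(* Two mean values turn the second difference of [F] into a value of [h] at distance at most
   [2 * e]; this gives both the bound on [g] and its closeness to [h]. *)
have gE x : exists2 c, `|c - x| <= 2 * e & g x = h c.
  have [c c1 E1] := mv _ _ x (dD _ _ dF).
  have [c' c1' E1'] := mv _ _ c dH.
  exists c'; last by rewrite /g E1 E1'; field.
  have := ler_normD (c' - c) (c - x).
  by rewrite addrA subrK; lra.
have Dh x : `|D h x| <= L * e.
  by rewrite (le_trans (hL _ _))// addrAC subrr add0r gtr0_norm.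
have pb x : `|p x| <= L.
  have [c c1 E1] := mv _ _ x (dD _ _ dH).
  rewrite /p E1 normrM (gtr0_norm ei0) normrM (gtr0_norm e0).
  apply: (@le_trans _ _ (e ^- 2 * (e * (L * e)))).
    by rewrite !ler_pM2l.
  by rewrite le_eqVlt; apply/orP; left; apply/eqP; field.
have qb x : `|q x| <= 2 * L / e ^+ 2.
  rewrite /q normrM (gtr0_norm ei0) mulrC ler_pM2r//.
  have hD := ler_normB (D h (x + e)) (D h x).
  apply: (le_trans hD); have := Dh x; have := Dh (x + e).
  have : L * e <= L by rewrite ler_piMr.
  lra.
have ql x y : `|q x - q y| <= 4 * L / e ^+ 2 * `|x - y|.
  rewrite /q -mulrBr normrM (gtr0_norm ei0).
  rewrite (_ : 4 * L / e ^+ 2 * `|x - y| = e ^- 2 * (4 * (L * `|x - y|))); last by ring.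
  rewrite ler_pM2l// /D.
  have t1 := hL (x + e + e) (y + e + e).
  have t2 := hL (x + e) (y + e).
  have t3 := hL x y.
  move: t1 t2 t3.
  rewrite (_ : x + e + e - (y + e + e) = x - y); last by ring.
  rewrite (_ : x + e - (y + e) = x - y); last by ring.
  rewrite !ler_norml => /andP[a1 a2] /andP[b1 b2] /andP[c1 c2].
  by apply/andP; split; lra.
pose K := M + L + 4 * L / e ^+ 2.
have M0 : 0 <= M := le_trans (normr_ge0 _) (hM 0).
have q0 : 0 <= L / e ^+ 2 by rewrite mulr_ge0// ltW.
have lipc f f' (k : R) : (forall x, is_derive x 1 f (f' x)) -> (forall x, `|f' x| <= k) ->
    forall x y, `|f x - f y| <= k * `|x - y|.
  move=> df fk x y; have [c _ ->] := mean_value df y x.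
  by rewrite normrM ler_wpM2r.
exists K, g, p, (fun x => q x / 2); split; last first.
  move=> x; have [c c1 ->] := gE x.
  by rewrite (le_trans (hL _ _))// -mulrA mulrCA ler_wpM2l.
have KE : forall u v : R, 0 <= v -> u <= K -> u * v <= K * v by move=> u v v0 uK; rewrite ler_wpM2r.
split.
- split => [x|x y].
    by have [c _ ->] := gE x; rewrite (le_trans (hM c))// /K; lra.
  by rewrite (le_trans (lipc _ _ _ dg pb x y))// KE// /K; lra.
- split => [x|x y].
    by rewrite (le_trans (pb x))// /K; lra.
  by rewrite (le_trans (lipc _ _ _ dp qb x y))// KE// /K; lra.
- split => [x|x y].
    by rewrite normrM (@gtr0_norm _ (2^-1))//; have := qb x; have := normr_ge0 (q x); rewrite /K; lra.
  rewrite -mulrBl normrM (@gtr0_norm _ (2^-1))//.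
  have := ql x y; have := normr_ge0 (q x - q y).
  have : 4 * L / e ^+ 2 * `|x - y| <= K * `|x - y| by rewrite KE// /K; lra.
  lra.
move=> x a.
(* [ph] is the Taylor remainder and [ph1] its derivative, both zero at [0]; two mean values reduce
   them to an increment of [q], controlled by its size and by its Lipschitz constant. *)
pose ph1 s := p (x + s) - p x - q x * s.
pose ph s := g (x + s) - g x - p x * s - q x / 2 * s ^+ 2.
have bnd s : `|s| <= `|a| -> `|q (x + s) - q x| <= 4 * L / e ^+ 2 * Num.min 1 `|a|.
  move=> sa; rewrite minr_pMr; last by rewrite mulr_ge0// ?invr_ge0 ?exprn_ge0 ?mulr_ge0// ltW.
  rewrite le_min; apply/andP; split.
    have := ler_normB (q (x + s)) (q x); have := qb x; have := qb (x + s); lra.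
  rewrite (le_trans (ql _ _))// addrAC subrr add0r ler_wpM2l//.
  by rewrite mulr_ge0// ?invr_ge0 ?exprn_ge0 ?mulr_ge0// ltW.
have dlin (k s : R) : is_derive s 1 (fun t : R => k * t) k.
  by rewrite -[X in is_derive _ _ _ X]mulr1; exact: (is_deriveZ k (@is_derive_id R R s 1)).
have shiftl f f' : (forall x, is_derive x 1 f (f' x)) ->
    forall s, is_derive s 1 (fun t => f (x + t)) (f' (x + s)).
  move=> df s; rewrite addrC.
  have -> : (fun t => f (x + t)) = (fun t => f (t + x)) by apply/funext => t; rewrite addrC.
  exact: is_derive_shift.
have dph1 s : is_derive s 1 ph1 (q (x + s) - q x).
  have A := is_deriveB (shiftl _ _ dp s) (@is_derive_cst R R R (p x) s 1).
  rewrite -[q (x + s)]subr0; exact: (is_deriveB A (dlin (q x) s)).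
have dsq (s : R) : is_derive s 1 (fun t : R => t ^+ 2) (2 * s).
  have A := is_deriveX 2 (@is_derive_id R R s 1).
  by move: A; rewrite /GRing.scale/= expr1 mulr1.
have dph s : is_derive s 1 ph (ph1 s).
  have A := is_deriveB (shiftl _ _ dg s) (@is_derive_cst R R R (g x) s 1).
  have A2 := is_deriveB A (dlin (p x) s).
  have := is_deriveB A2 (is_deriveZ (q x / 2) (dsq s)).
  rewrite subr0 /GRing.scale/= (_ : q x / 2 * (2 * s) = q x * s); last by field.
  exact.
have B1 s : `|s| <= `|a| -> `|ph1 s| <= 4 * L / e ^+ 2 * Num.min 1 `|a| * `|a|.
  move=> sa; have [c] := mean_value dph1 0 s; rewrite !subr0 => cs.
  rewrite {2}/ph1 addr0 mulr0 !subrr subr0 => ->.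
  rewrite normrM ler_pM// bnd//; exact: (le_trans cs).
have [c] := mean_value dph 0 a; rewrite !subr0 => ca.
rewrite {2}/ph addr0 mulr0 expr0n/= mulr0 !subrr !subr0 /ph => ->.
rewrite normrM /taylor_rest -(real_normK (num_real a)).
by rewrite (_ : _ * (_ * _) = 4 * L / e ^+ 2 * Num.min 1 `|a| * `|a| * `|a|); [rewrite ler_wpM2r// B1|ring].
Qed.

End smoothing.

(** * Averaging over one random step *)

Section averaging.
Context d (T : measurableType d) (R : realType) (P : probability T R).
Variable X : T -> R.
Hypothesis mX : measurable_fun setT X.
Implicit Types (f g p q : R -> R) (x y : R).

Definition average f x := \int[P]_w f (x + X w).

Lemma average_intble K f x : bounded_lipschitz K f -> intble P (fun w => f (x + X w)).
Proof.
move=> bf; apply: (@intble_bounded _ _ _ P K); last by move=> w; apply: bf.1.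
apply: measurableT_comp; first exact: bounded_lipschitz_measurable bf.
exact: measurable_funD.
Qed.

Lemma average_close K K' f g c x : bounded_lipschitz K f -> bounded_lipschitz K' g ->
  (forall x, `|f x - g x| <= c) -> `|average f x - average g x| <= c.
Proof.
move=> bf bg fg; rewrite /average -RintegralB//; last 2 first.
- exact: average_intble bf.
- exact: average_intble bg.
rewrite -[leRHS](expectation_cst P); apply: norm_expectation_le => //.
- by apply: intbleB; [exact: average_intble bf|exact: average_intble bg].
- exact: intble_cst.
Qed.

Lemma average_bounded_lipschitz K f : bounded_lipschitz K f ->
  bounded_lipschitz K (average f).
Proof.
move=> bf; split => [x|x y].
  rewrite -[leRHS](expectation_cst P); apply: norm_expectation_le.
  - exact: average_intble bf.
  - exact: intble_cst.
  - by move=> w; exact: bf.1.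
rewrite /average -RintegralB//; last 2 first.
- exact: average_intble bf.
- exact: average_intble bf.
rewrite -[leRHS](expectation_cst P); apply: norm_expectation_le.
- by apply: intbleB; exact: average_intble bf.
- exact: intble_cst.
- move=> w; rewrite (le_trans (bf.2 _ _))//.
  by rewrite (_ : x + X w - (y + X w) = x - y)//; ring.
Qed.

Lemma average_iter_bounded_lipschitz K f n : bounded_lipschitz K f ->
  bounded_lipschitz K (iter n average f).
Proof. by move=> bf; elim: n => // n IH; exact: average_bounded_lipschitz. Qed.

Lemma average_iter_close K K' f g c n : bounded_lipschitz K f -> bounded_lipschitz K' g ->
  (forall x, `|f x - g x| <= c) ->
  forall x, `|iter n average f x - iter n average g x| <= c.
Proof.
move=> bf bg fg; elim: n => // n IH x; rewrite !iterS.
by apply: average_close => //;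
  [exact: average_iter_bounded_lipschitz bf|exact: average_iter_bounded_lipschitz bg].
Qed.

Lemma average_second_order K C g p q : second_order K C g p q ->
  second_order K C (average g) (average p) (average q).
Proof.
move=> [bg bp bq T2]; split; try exact: average_bounded_lipschitz.
move=> x a.
have Ig y := average_intble y bg; have Ip := average_intble x bp.
have Iq := average_intble x bq.
have -> : average g (x + a) - average g x - average p x * a - average q x * a ^+ 2 =
  \int[P]_w (g (x + a + X w) - g (x + X w) - a * p (x + X w) - a ^+ 2 * q (x + X w)).
  rewrite RintegralB//; last 2 first.
  - by apply: intbleB; [apply: intbleB => //|exact: intbleZ].
  - exact: intbleZ.
  rewrite RintegralB//; last 2 first.
  - exact: intbleB.
  - exact: intbleZ.
  rewrite RintegralB//; try exact: Ig.
  have -> : \int[P]_w (a * p (x + X w)) = a * average p x by exact: RintegralZl.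
  have -> : \int[P]_w (a ^+ 2 * q (x + X w)) = a ^+ 2 * average q x by exact: RintegralZl.
  by rewrite /average; ring.
rewrite -[leRHS](expectation_cst P); apply: norm_expectation_le.
- apply: intbleB; last exact: intbleZ.
  by apply: intbleB; [exact: intbleB|exact: intbleZ].
- exact: intble_cst.
- move=> w; have := T2 (x + X w) a.
  rewrite (addrAC x) ![a * _]mulrC; rewrite [a ^+ 2 * _]mulrC; exact.
Qed.

(** Centring kills the linear term and the quadratic one becomes [v], so two laws sharing [v] differ
    only through their remainders. *)
Lemma average_expansion K C g p q v x : second_order K C g p q ->
  intble P X -> intble P (fun w => X w ^+ 2) ->
  \int[P]_w X w = 0 -> \int[P]_w (X w ^+ 2) = v -> 0 <= C ->
  `|average g x - g x - q x * v| <= C * \int[P]_w taylor_rest (X w).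
Proof.
move=> [bg bp bq T2] I1 I2 E1 E2 C0.
have Ig := average_intble x bg.
have Ir : intble P (fun w => taylor_rest (X w)).
  apply: (intble_le _ _ I2) => [|w].
    by apply: measurableT_comp => //; exact: measurable_taylor_rest.
  by rewrite ger0_norm ?taylor_rest_ge0// taylor_rest_le_sqr.
have -> : average g x - g x - q x * v =
  \int[P]_w (g (x + X w) - g x - p x * X w - q x * X w ^+ 2).
  rewrite RintegralB//; last 2 first.
  - apply: intbleB; last exact: intbleZ.
    by apply: intbleB => //; exact: intble_cst.
  - exact: intbleZ.
  rewrite RintegralB//; last 2 first.
  - by apply: intbleB => //; exact: intble_cst.
  - exact: intbleZ.
  rewrite RintegralB//; last exact: intble_cst.
  by rewrite !RintegralZl// E1 E2 expectation_cst mulr0 subr0.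
rewrite -RintegralZl//; apply: norm_expectation_le.
- apply: intbleB; last exact: intbleZ.
  apply: intbleB; last exact: intbleZ.
  by apply: intbleB => //; exact: intble_cst.
- exact: intbleZ.
- by move=> w; exact: T2.
Qed.

End averaging.

(** * Lindeberg replacement inside one block *)

Section lindeberg.
Context d (T : measurableType d) d' (T' : measurableType d') (R : realType).
Variables (P : probability T R) (Q : probability T' R).
Variables (X : T -> R) (Y : T' -> R) (v : R).
Hypotheses (mX : measurable_fun setT X) (mY : measurable_fun setT Y).
Hypotheses (X1 : intble P X) (X2 : intble P (fun w => X w ^+ 2)).
Hypotheses (Y1 : intble Q Y) (Y2 : intble Q (fun w => Y w ^+ 2)).
Hypotheses (EX : \int[P]_w X w = 0) (EX2 : \int[P]_w (X w ^+ 2) = v).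
Hypotheses (EY : \int[Q]_w Y w = 0) (EY2 : \int[Q]_w (Y w ^+ 2) = v).

Definition lindeberg_gap := \int[P]_w taylor_rest (X w) + \int[Q]_w taylor_rest (Y w).

(** Steps are swapped one at a time: those already swapped are absorbed into the test function,
    which keeps its second-order constant, and the remaining averages do not increase a supremum
    distance. *)
Lemma lindeberg_second_order K C n g p q : 0 <= C -> second_order K C g p q ->
  forall x, `|iter n (average P X) g x - iter n (average Q Y) g x|
    <= n%:R * (C * lindeberg_gap).
Proof.
move=> C0; elim: n g p q => [|n IH] g p q s2 x; first by rewrite /= subrr normr0 mul0r.
rewrite !iterSr.
have [bg _ _ _] := s2.
have s2Y := average_second_order Q mY s2.
have H1 := IH _ _ _ s2Y x.
have H2 : `|iter n (average P X) (average P X g) x - iter n (average P X) (average Q Y g) x|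
    <= C * lindeberg_gap.
  apply: (@average_iter_close _ _ _ _ _ mX K K).
  - exact: average_bounded_lipschitz.
  - exact: average_bounded_lipschitz.
  move=> y.
  have A := average_expansion mX y s2 X1 X2 EX EX2 C0.
  have B := average_expansion mY y s2 Y1 Y2 EY EY2 C0.
  move: A B; rewrite /lindeberg_gap mulrDr !ler_norml => /andP[a1 a2] /andP[b1 b2].
  by apply/andP; split; lra.
move: H1 H2; rewrite -natr1 mulrDl mul1r !ler_norml => /andP[a1 a2] /andP[b1 b2].
by apply/andP; split; lra.
Qed.

(** Replacing [h] by a smoothing at distance [2 * L * e] on both sides costs [4 * L * e]; the price
    is the factor [e ^- 2] in the second-order constant. *)
Lemma lindeberg_lipschitz (M L e : R) n (h : R -> R) : 0 < e -> e <= 1 -> 0 <= L ->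
  (forall x, `|h x| <= M) -> (forall x y, `|h x - h y| <= L * `|x - y|) ->
  forall x, `|iter n (average P X) h x - iter n (average Q Y) h x|
    <= 4 * L * e + n%:R * (4 * L / e ^+ 2 * lindeberg_gap).
Proof.
move=> e0 e1 L0 hM hL x.
have bh : bounded_lipschitz (Num.max M L) h.
  split => [z|z y]; first by rewrite le_max hM.
  by rewrite (le_trans (hL z y))// ler_wpM2r// le_max lexx orbT.
have [K [g [p [q [s2 gh]]]]] := lipschitz_smoothing e0 e1 L0 hM hL.
have [bg _ _ _] := s2.
have A := average_iter_close P mX n bg bh gh x.
have B := average_iter_close Q mY n bg bh gh x.
have C := lindeberg_second_order n _ s2 x.
have C0 : 0 <= 4 * L / e ^+ 2 by rewrite mulr_ge0 ?mulr_ge0// invr_ge0 exprn_ge0// ltW.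
move: A B {C}(C C0); rewrite !ler_norml => /andP[a1 a2] /andP[b1 b2] /andP[c1 c2].
by apply/andP; split; lra.
Qed.

End lindeberg.

(** * Lipschitz functions of finitely many coordinates *)

Section coordinate_functions.
Context {R : realType}.
Implicit Types (Phi : (nat -> R) -> R) (x y : nat -> R).

(** The arguments are infinite sequences, but the sum over [i < N] forces dependence on the first
    [N] terms alone. *)
Definition lipschitz_in (N : nat) (K : R) Phi :=
  [/\ 0 <= K, forall x, `|Phi x| <= K &
   forall x y, `|Phi x - Phi y| <= K * \sum_(i < N) `|x i - y i|].

Definition shift_at (i : nat) (a : R) x : nat -> R :=
  fun j => if j == i then x j + a else x j.

Lemma shift_atD i a b x : shift_at i a (shift_at i b x) = shift_at i (b + a) x.
Proof. by apply/funext => j; rewrite /shift_at; case: eqP => // _; rewrite addrA. Qed.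

Lemma shift_at0 i x : shift_at i 0 x = x.
Proof. by apply/funext => j; rewrite /shift_at addr0 if_same. Qed.

Lemma lipschitz_in_coord N K Phi i x a b : lipschitz_in N K Phi ->
  `|Phi (shift_at i a x) - Phi (shift_at i b x)| <= K * `|a - b|.
Proof.
move=> [K0 _ lP]; apply: (le_trans (lP _ _)); rewrite ler_wpM2l//.
have E (j : 'I_N) : `|shift_at i a x j - shift_at i b x j| =
    if (j : nat) == i then `|a - b| else 0.
  rewrite /shift_at; case: eqP => _; last by rewrite subrr normr0.
  by rewrite (_ : x j + a - (x j + b) = a - b)//; ring.
under eq_bigr => j _ do rewrite E.
rewrite -big_mkcond/=.
have [iN|Ni] := ltnP i N.
  by rewrite (big_pred1 (Ordinal iN))// => j; rewrite -val_eqE.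
rewrite big_pred0// => j; apply/negbTE; rewrite neq_ltn.
by rewrite (leq_trans (ltn_ord j) Ni).
Qed.

Lemma lipschitz_in_section N K Phi i x : lipschitz_in N K Phi ->
  bounded_lipschitz K (fun a => Phi (shift_at i a x)).
Proof.
move=> lP; split => [a|a b]; first by case: lP.
exact: lipschitz_in_coord lP.
Qed.

(** The coordinates are made random one at a time; each stage is a Caratheodory function, continuous
    in the new coordinate and measurable in [w] by induction. *)
Lemma measurable_lipschitz_in N K Phi d (T : measurableType d) (V : nat -> T -> R) :
  lipschitz_in N K Phi -> (forall j, measurable_fun setT (V j)) ->
  measurable_fun setT (fun w => Phi (V ^~ w)).
Proof.
move=> lP mV.
have H n z : measurable_fun setT
    (fun w => Phi (fun j => if (j < n)%N then V j w else z j)).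
  elim: n z => [|n IH] z; first exact: (@measurable_cst _ _ _ _ setT (Phi z)).
  pose g w a := Phi (fun j => if (j < n)%N then V j w else if j == n then a else z j).
  have -> : (fun w => Phi (fun j => if (j < n.+1)%N then V j w else z j)) =
      (fun w => g w (V n w)).
    apply/funext => w; rewrite /g; congr Phi; apply/funext => j.
    by rewrite ltnS leq_eqVlt; case: eqVneq => [->|_] /=; rewrite ?ltnn.
  apply: measurable_caratheodory_comp => // [a|w].
    exact: (IH (fun j => if j == n then a else z j)).
  pose z' j := if (j < n)%N then V j w else if j == n then 0 else z j.
  have -> : g w = fun a => Phi (shift_at n a z').
    apply/funext => a; rewrite /g; congr Phi; apply/funext => j.
    by rewrite /shift_at /z'; case: eqVneq => [->|_] //; rewrite ltnn add0r.
  exact: (bounded_lipschitz_continuous (lipschitz_in_section n z' lP)).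
have -> : (fun w => Phi (V ^~ w)) =
    (fun w => Phi (fun j => if (j < N)%N then V j w else 0)); last exact: H.
apply/funext => w; apply/eqP; rewrite -subr_eq0 -normr_le0.
have [_ _ /(_ _ _)/le_trans] := lP; apply.
by rewrite big1 ?mulr0// => i _; rewrite ltn_ord subrr normr0.
Qed.

End coordinate_functions.

(** * Expectations of functions of block sums *)

Section blocks.
Context d (T : measurableType d) (R : realType) (P : probability T R).
Variable X : nat -> T -> R.
Hypothesis iidX : iid P X.
Variables (N L : nat) (K : R).
Implicit Types (Phi : (nat -> R) -> R).

Let mX i : measurable_fun setT (X i). Proof. by case: iidX. Qed.

Definition block_sums n j w : R := \sum_(r < n | (r %/ L)%N == j) X r w.

Lemma block_sumsS n w : block_sums n.+1 ^~ w =
  shift_at (n %/ L) (X n w) (block_sums n ^~ w).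
Proof.
apply/funext => j; rewrite /block_sums /shift_at.
rewrite big_mkcond big_ord_recr/= -big_mkcond/= eq_sym.
by case: eqP => // _; rewrite addr0.
Qed.

Lemma block_sums0 w : block_sums 0 ^~ w = fun=> 0.
Proof. by apply/funext => j; rewrite /block_sums big_ord0. Qed.

Lemma past_block_sums n j : measurable_fun setT (block_sums n j : past X n -> R).
Proof.
rewrite /block_sums; under eq_fun do rewrite big_mkcond/=.
apply: (@measurable_sum _ (past X n) R setT _ _
  (fun (r : 'I_n) w => if (r %/ L)%N == j then X r w else 0)) => r.
case: ((r %/ L)%N == j); last exact: measurable_cst.
exact: past_coordinate.
Qed.

Lemma measurable_block_sums n j : measurable_fun setT (block_sums n j).
Proof. exact: (measurable_past iidX (@past_block_sums n j)). Qed.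

Definition average_at i Phi x := \int[P]_w Phi (shift_at i (X 0%N w) x).

(** On the line through [x] in direction [i] the operator is the one-dimensional [average], which
    brings the one-block comparison to functions of all blocks. *)
Lemma average_at_iter i Phi n x a : iter n (average_at i) Phi (shift_at i a x) =
  iter n (average P (X 0%N)) (fun a => Phi (shift_at i a x)) a.
Proof.
elim: n a => // n IH a; rewrite !iterS /average_at /average.
by apply: eq_Rintegral => w _; rewrite shift_atD IH.
Qed.

Lemma average_at_lipschitz i Phi : lipschitz_in N K Phi ->
  lipschitz_in N K (average_at i Phi).
Proof.
move=> lP; have [K0 bP dP] := lP.
have I x : intble P (fun w => Phi (shift_at i (X 0%N w) x)).
  have := average_intble P (mX 0%N) 0 (lipschitz_in_section i x lP).
  by under eq_fun do rewrite add0r.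
split => // [x|x y].
  rewrite -[leRHS](expectation_cst P); apply: norm_expectation_le => //.
  exact: intble_cst.
rewrite /average_at -RintegralB//; try exact: I.
rewrite -[leRHS](expectation_cst P); apply: norm_expectation_le.
- by apply: intbleB; exact: I.
- exact: intble_cst.
move=> w; rewrite (le_trans (dP _ _))// ler_wpM2l// ler_sum// => j _.
rewrite /shift_at; case: ifP => // _.
by rewrite (_ : x j + _ - _ = x j - y j)//; ring.
Qed.

Lemma average_at_iter_lipschitz i n Phi : lipschitz_in N K Phi ->
  lipschitz_in N K (iter n (average_at i) Phi).
Proof. by move=> lP; elim: n => // n IH; exact: average_at_lipschitz. Qed.

Lemma block_expectation_intble n Phi : lipschitz_in N K Phi ->
  intble P (fun w => Phi (block_sums n ^~ w)).
Proof.
move=> lP; apply: (@intble_bounded _ _ _ P K); last by case: lP.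
exact: (measurable_lipschitz_in lP (measurable_block_sums n)).
Qed.

(** Step [n] is independent of the past and falls into block [n %/ L]; integrating it out replaces
    [Phi] by its average in that coordinate. *)
Lemma block_expectationS n Phi : lipschitz_in N K Phi ->
  \int[P]_w Phi (block_sums n.+1 ^~ w) =
  \int[P]_w average_at (n %/ L) Phi (block_sums n ^~ w).
Proof.
move=> lP; have [K0 bP dP] := lP.
(* Adding [K] makes the integrand nonnegative, as [decouple] requires. *)
pose phi w a := Phi (shift_at (n %/ L) a (block_sums n ^~ w)) + K.
have cphi w : continuous (phi w).
  have c := bounded_lipschitz_continuous (lipschitz_in_section (n %/ L) (block_sums n ^~ w) lP).
  by move=> a; apply: cvgD; [exact: c|exact: cvg_cst].
have phi0 w a : 0 <= phi w a.
  by have := bP (shift_at (n %/ L) a (block_sums n ^~ w)); rewrite ler_norml /phi; lra.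
have mphi a : measurable_fun setT (phi^~ a : past X n -> R).
  apply: measurable_funD; last exact: measurable_cst.
  apply: (@measurable_lipschitz_in _ N K Phi _ (past X n)
    (fun j w => shift_at (n %/ L) a (block_sums n ^~ w) j) lP) => j.
  rewrite /shift_at; case: (j == (n %/ L)%N); last exact: past_block_sums.
  by apply: measurable_funD; [exact: past_block_sums|exact: measurable_cst].
have E := decouple iidX mphi cphi phi0.
have I1 := block_expectation_intble n.+1 lP.
have I2 := block_expectation_intble n (average_at_lipschitz (n %/ L) lP).
have L1 : (\int[P]_w (phi w (X n w))%:E = (\int[P]_w Phi (block_sums n.+1 ^~ w) + K)%:E)%E.
  rewrite -[X in (_ + X)%:E](expectation_cst P) -RintegralD//; last exact: intble_cst.
  rewrite -intbleE; last by apply: intbleD => //; exact: intble_cst.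
  by apply: eq_integral => w _; rewrite /phi block_sumsS.
have L2 : (\int[P]_w \int[P]_w' (phi w (X n w'))%:E =
    (\int[P]_w average_at (n %/ L) Phi (block_sums n ^~ w) + K)%:E)%E.
  rewrite -[X in (_ + X)%:E](expectation_cst P) -RintegralD//; last exact: intble_cst.
  rewrite -intbleE; last by apply: intbleD => //; exact: intble_cst.
  apply: eq_integral => w _.
  rewrite (@identically_distributed _ _ _ P X iidX n (fun y => (phi w y)%:E)); last 2 first.
  - by apply/measurable_EFinP; exact: continuous_measurable_fun (cphi w).
  - by move=> y; rewrite lee_fin.
  rewrite /average_at -[X in (_ + X)%:E](expectation_cst P).
  have Iw : intble P (fun w' => Phi (shift_at (n %/ L) (X 0%N w') (block_sums n ^~ w))).
    have := average_intble P (mX 0%N) 0 (lipschitz_in_section (n %/ L) (block_sums n ^~ w) lP).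
    by under eq_fun do rewrite add0r.
  rewrite -RintegralD//; last exact: intble_cst.
  by rewrite -intbleE//; apply: intbleD => //; exact: intble_cst.
by move: E; rewrite L1 L2 => -[] /addIr.
Qed.

Hypothesis L0 : (0 < L)%N.

Lemma block_expectation_full n Phi : lipschitz_in N K Phi ->
  \int[P]_w Phi (block_sums (n.+1 * L) ^~ w) =
  \int[P]_w iter L (average_at n) Phi (block_sums (n * L) ^~ w).
Proof.
suff H l : (l <= L)%N -> forall Phi, lipschitz_in N K Phi ->
    \int[P]_w Phi (block_sums (n * L + l) ^~ w) =
    \int[P]_w iter l (average_at n) Phi (block_sums (n * L) ^~ w).
  by move=> lP; rewrite mulSnr H.
elim: l => [|l IH] lL F lF; first by rewrite addn0.
rewrite addnS (block_expectationS _ lF) (divnMDl _ _ L0) (divn_small lL) addn0.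
rewrite IH ?(ltnW lL)//; last exact: average_at_lipschitz.
by rewrite -iterSr.
Qed.

End blocks.

(** * Replacement of the blocks, the last one first *)

Section block_comparison.
Context d (T : measurableType d) d' (T' : measurableType d') (R : realType).
Variables (P : probability T R) (Q : probability T' R).
Variables (X : nat -> T -> R) (Y : nat -> T' -> R).
Hypotheses (iidX : iid P X) (iidY : iid Q Y).
Variables (N L : nat) (K e : R).
Hypothesis L0 : (0 < L)%N.
Hypothesis close : forall h : R -> R, (forall x, `|h x| <= K) ->
  (forall x y, `|h x - h y| <= K * `|x - y|) -> forall x,
  `|iter L (average P (X 0%N)) h x - iter L (average Q (Y 0%N)) h x| <= e.

(** Integrating out the last block turns [Phi] into an iterated average of the same Lipschitz class.
    Changing the law of that block costs [e] by [close], applied along a coordinate line; the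
    earlier blocks follow by induction. *)
Lemma block_comparison n Phi : lipschitz_in N K Phi ->
  `|\int[P]_w Phi (block_sums X L (n * L) ^~ w) -
    \int[Q]_w Phi (block_sums Y L (n * L) ^~ w)| <= n%:R * e.
Proof.
elim: n Phi => [|n IH] Phi lP.
  rewrite mul0n mul0r.
  under eq_Rintegral do rewrite block_sums0.
  under [X in _ - X]eq_Rintegral do rewrite block_sums0.
  by rewrite !expectation_cst subrr normr0.
rewrite (block_expectation_full iidX L0 n lP) (block_expectation_full iidY L0 n lP).
have lX := average_at_iter_lipschitz iidX n L lP.
have lY := average_at_iter_lipschitz iidY n L lP.
have H1 := IH _ lY.
have H2 : `|\int[P]_w iter L (average_at P X n) Phi (block_sums X L (n * L) ^~ w) -
    \int[P]_w iter L (average_at Q Y n) Phi (block_sums X L (n * L) ^~ w)| <= e.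
  have I1 := block_expectation_intble iidX L (n * L) lX.
  have I2 := block_expectation_intble iidX L (n * L) lY.
  rewrite -RintegralB// -[leRHS](expectation_cst P); apply: norm_expectation_le.
  - exact: intbleB.
  - exact: intble_cst.
  move=> w; set x := block_sums _ _ _ ^~ w.
  rewrite -(shift_at0 n x) !average_at_iter; apply: close => [y|y z].
    by case: lP.
  exact: lipschitz_in_coord lP.
rewrite -natr1 mulrDl mul1r.
move: H1 H2; rewrite !ler_norml => /andP[a1 a2] /andP[b1 b2].
by apply/andP; split; lra.
Qed.

End block_comparison.

(** * Taylor and Riemann-sum bounds for truncated powers *)

Section power_inequalities.
Context {R : realType}.
Implicit Types (x y X Y : R).

Local Notation pos x := (Num.max x 0).

Lemma pos_ge0 x : 0 <= pos x. Proof. by rewrite le_max lexx orbT. Qed.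

(** The remainder at exponent [p.+3] is [x] times the one at [p.+2] plus
    [p.+2%:R * y ^+ p.+1 * (x - y) ^+ 2], so both bounds pass through the induction. *)
Lemma power_taylor p x y : 0 <= x -> 0 <= y ->
  0 <= x ^+ p.+2 - y ^+ p.+2 - p.+2%:R * y ^+ p.+1 * (x - y)
    <= p.+2%:R ^+ 2 * Num.max x y ^+ p * (x - y) ^+ 2.
Proof.
move=> x0 y0; set M := Num.max x y.
have xM : x <= M by rewrite le_max lexx.
have yM : y <= M by rewrite le_max lexx orbT.
have M0 : 0 <= M := le_trans x0 xM.
elim: p => [|p /andP[IH1 IH2]].
  have -> : x ^+ 2 - y ^+ 2 - 2 * y ^+ 1 * (x - y) = (x - y) ^+ 2 by ring.
  rewrite sqr_ge0/= expr0 mulr1 ler_peMl ?sqr_ge0//; lra.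
set T := _ - _ - _ in IH1 IH2.
have -> : x ^+ p.+3 - y ^+ p.+3 - p.+3%:R * y ^+ p.+2 * (x - y) =
   x * T + p.+2%:R * y ^+ p.+1 * (x - y) ^+ 2.
  by rewrite /T -[p.+3%:R]natr1 !exprS; ring.
have d0 := sqr_ge0 (x - y).
have n0 : (0 : R) <= p.+2%:R by [].
apply/andP; split; first by rewrite addr_ge0// mulr_ge0// mulr_ge0 ?exprn_ge0.
have h1 : x * T <= M * (p.+2%:R ^+ 2 * M ^+ p * (x - y) ^+ 2) by rewrite ler_pM.
have h2 : p.+2%:R * y ^+ p.+1 * (x - y) ^+ 2 <= p.+2%:R * M ^+ p.+1 * (x - y) ^+ 2.
  by rewrite ler_wpM2r// ler_wpM2l// lerXn2r.
have h3 : 0 <= M ^+ p.+1 * (x - y) ^+ 2 by rewrite mulr_ge0// exprn_ge0.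
rewrite -[p.+3%:R]natr1.
have -> : (p.+2%:R + 1) ^+ 2 * M ^+ p.+1 * (x - y) ^+ 2 =
  M * (p.+2%:R ^+ 2 * M ^+ p * (x - y) ^+ 2) + p.+2%:R * M ^+ p.+1 * (x - y) ^+ 2
  + (p.+2%:R + 1) * (M ^+ p.+1 * (x - y) ^+ 2) by rewrite (exprS M p); ring.
have h4 : 0 <= (p.+2%:R + 1) * (M ^+ p.+1 * (x - y) ^+ 2) by rewrite mulr_ge0// addr_ge0.
by lra.
Qed.

(** The first-order term keeps the untruncated [X - Y], so for the walk it is exactly linear in the
    deviation. *)
Lemma pos_power_taylor p X Y :
  0 <= pos X ^+ p.+2 - pos Y ^+ p.+2 - p.+2%:R * pos Y ^+ p.+1 * (X - Y)
    <= p.+2%:R ^+ 2 * Num.max (pos X) (pos Y) ^+ p * (X - Y) ^+ 2.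
Proof.
have n1 : (1 : R) <= p.+2%:R by rewrite ler1n.
have n21 : (1 : R) <= p.+2%:R ^+ 2 by rewrite exprn_ege1.
have [Y0|Y0] := leP Y 0.
  rewrite !expr0n/= mulr0 mul0r !subr0.
  rewrite (_ : Num.max (pos X) 0 = pos X); last by apply/max_idPl; exact: pos_ge0.
  have [X0|X0] := leP X 0.
    by rewrite !expr0n/= lexx/= mulr_ge0 ?sqr_ge0// mulr_ge0 ?ler0n ?exprn_ge0.
  rewrite exprn_ge0 ?(ltW X0)//=.
  have h : X ^+ 2 <= (X - Y) ^+ 2 by rewrite ler_sqr ?nnegrE//; lra.
  have Xp : 0 <= X ^+ p by rewrite exprn_ge0// ltW.
  rewrite (_ : X ^+ p.+2 = X ^+ p * X ^+ 2); last by rewrite -exprD addn2.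
  apply: (@le_trans _ _ (X ^+ p * (X - Y) ^+ 2)); first by rewrite ler_wpM2l.
  by rewrite -mulrA ler_peMl// mulr_ge0// sqr_ge0.
have [X0|X0] := leP X 0; last by apply: power_taylor; apply: ltW.
rewrite (_ : Num.max 0 Y = Y); last by apply/max_idPr/ltW.
rewrite expr0n/= sub0r.
have Yp : 0 <= Y ^+ p by rewrite exprn_ge0// ltW.
have -> : - Y ^+ p.+2 - p.+2%:R * Y ^+ p.+1 * (X - Y) =
  Y ^+ p * (p.+2%:R * (Y * (Y - X)) - Y ^+ 2) by rewrite !exprS; ring.
rewrite (mulrC (_ ^+ 2)) -mulrA.
have YX : 0 <= Y * (Y - X) - Y ^+ 2.
  by rewrite expr2 -mulrBr mulr_ge0 ?(ltW Y0)//; lra.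
have Y2 := sqr_ge0 Y.
apply/andP; split.
  rewrite mulr_ge0//.
  have : Y * (Y - X) <= p.+2%:R * (Y * (Y - X)) by rewrite ler_peMl//; lra.
  lra.
rewrite ler_wpM2l//.
have h : Y * (Y - X) <= (X - Y) ^+ 2.
  rewrite (_ : (X - Y) ^+ 2 = (Y - X) * (Y - X)); last by ring.
  by rewrite ler_wpM2r//; lra.
have h2 : p.+2%:R * (Y * (Y - X)) <= p.+2%:R * (X - Y) ^+ 2 by rewrite ler_wpM2l//; lra.
have h3 : p.+2%:R * (X - Y) ^+ 2 <= p.+2%:R ^+ 2 * (X - Y) ^+ 2.
  by rewrite ler_wpM2r ?sqr_ge0// expr2 ler_peMl//; lra.
lra.
Qed.

Lemma power_increment n x y : 0 <= y -> y <= x ->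
  n.+1%:R * y ^+ n * (x - y) <= x ^+ n.+1 - y ^+ n.+1 <= n.+1%:R * x ^+ n * (x - y).
Proof.
move=> y0 yx; have x0 := le_trans y0 yx.
elim: n => [|n /andP[IH1 IH2]]; first by rewrite !expr0 !expr1 !mul1r lexx.
have yxn : y ^+ n <= x ^+ n by rewrite lerXn2r.
have yn0 : 0 <= y ^+ n by rewrite exprn_ge0.
have E : x ^+ n.+2 - y ^+ n.+2 = x * (x ^+ n.+1 - y ^+ n.+1) + y ^+ n.+1 * (x - y).
  by rewrite !exprS; ring.
have E' : x ^+ n.+2 - y ^+ n.+2 = y * (x ^+ n.+1 - y ^+ n.+1) + x ^+ n.+1 * (x - y).
  by rewrite !exprS; ring.
apply/andP; split.
  rewrite E'; have := ler_wpM2l y0 IH1.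
  have : y ^+ n.+1 * (x - y) <= x ^+ n.+1 * (x - y).
    by rewrite ler_wpM2r ?subr_ge0// lerXn2r.
  rewrite -[n.+2%:R]natr1 (exprS y n); lra.
rewrite E; have := ler_wpM2l x0 IH2.
have : y ^+ n.+1 * (x - y) <= x ^+ n.+1 * (x - y).
  by rewrite ler_wpM2r ?subr_ge0// lerXn2r.
rewrite -[n.+2%:R]natr1 (exprS x n); lra.
Qed.

(* [(n.+2 * h)^-1] is the integral of the nonincreasing function
   [(1 - s)_+ ^ n.+1] divided by the mesh [h]. *)
Lemma pos_power_riemann (h : R) n J : 0 < h -> 1 <= J.+1%:R * h ->
  (n.+2%:R * h)^-1 - 1 <= \sum_(j < J) pos (1 - j.+1%:R * h) ^+ n.+1
    <= (n.+2%:R * h)^-1.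
Proof.
move=> h0 Jh /=.
pose x j := pos (1 - j%:R * h).
have x0 j : 0 <= x j := pos_ge0 _.
have x1 j : x j <= 1.
  rewrite ge_max ler01 andbT lerBlDl lerDr mulr_ge0//; exact: ltW.
have xS j : x j.+1 <= x j.
  rewrite /x ge_max x0 andbT le_max; apply/orP; left.
  by rewrite -natr1; lra.
have xd j : x j - x j.+1 <= h.
  rewrite lerBlDl {1}/x ge_max; apply/andP; split; last by rewrite addr_ge0 ?x0// ltW.
  by rewrite -lerBlDr /x le_max; apply/orP; left; rewrite -natr1; lra.
have nh0 : 0 < n.+2%:R * h by rewrite mulr_gt0// ltr0n.
have up j : n.+2%:R * h * x j.+1 ^+ n.+1 <= x j ^+ n.+2 - x j.+1 ^+ n.+2.
  have /andP[+ _] := power_increment n.+1 (x0 j.+1) (xS j).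
  have [xj0|xj0] := leP (1 - j.+1%:R * h) 0.
    have -> : x j.+1 = 0 by apply/max_idPr.
    by move=> _; rewrite !expr0n/= mulr0 subr0 exprn_ge0.
  have -> : x j - x j.+1 = h.
    rewrite /x (max_idPl (ltW xj0)).
    have /max_idPl -> : 0 <= 1 - j%:R * h by move: xj0; rewrite -natr1; lra.
    by rewrite -natr1; ring.
  by rewrite mulrAC.
have dn j : x j ^+ n.+2 - x j.+1 ^+ n.+2 <= n.+2%:R * h * x j ^+ n.+1.
  have /andP[_ +] := power_increment n.+1 (x0 j.+1) (xS j).
  move=> /le_trans; apply; rewrite mulrAC ler_wpM2r ?exprn_ge0//.
  by rewrite ler_wpM2l.
have tel j : \sum_(i < j) (x i ^+ n.+2 - x i.+1 ^+ n.+2) = 1 - x j ^+ n.+2.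
  elim: j => [|j IH]; last by rewrite big_ord_recr/= IH; ring.
  by rewrite big_ord0 /x mul0r subr0 (max_idPl ler01) expr1n subrr.
have xJ : x J.+1 = 0 by apply/max_idPr; rewrite subr_le0.
set s := \sum_(j < J) _.
have s1 : n.+2%:R * h * s <= 1.
  rewrite mulr_sumr.
  apply: (@le_trans _ _ (\sum_(i < J) (x i ^+ n.+2 - x i.+1 ^+ n.+2))).
    by apply: ler_sum => j _; exact: up.
  by rewrite tel gerBl exprn_ge0.
(* The missing term [j = 0] equals [1], and with it the sum is an upper Riemann sum; this is the
   [- 1] of the lower bound. *)
have s2 : 1 <= n.+2%:R * h * (1 + s).
  have -> : 1 + s = \sum_(j < J.+1) x j ^+ n.+1.
    by rewrite big_ord_recl /x mul0r subr0 (max_idPl ler01) expr1n.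
  rewrite mulr_sumr.
  apply: (@le_trans _ _ (\sum_(i < J.+1) (x i ^+ n.+2 - x i.+1 ^+ n.+2))); last first.
    by apply: ler_sum => j _; exact: dn.
  by rewrite tel xJ expr0n subr0.
apply/andP; split.
  by rewrite lerBlDl -[leLHS]mul1r ler_pdivrMr// mulrC.
by rewrite -[leRHS]mul1r ler_pdivlMr// mulrC.
Qed.

End power_inequalities.

(** * The power kernel against the exponential kernel *)

Section kernel_inequalities.
Context {R : realType}.
Implicit Types (x y u : R).

Local Notation pos x := (Num.max x 0).

Lemma pos_le_exp x : pos (1 - x) <= expR (- x).
Proof. by rewrite ge_max expR_ge0 andbT expR_ge1Dx. Qed.

Lemma pos_power_le_exp x n : pos (1 - x) ^+ n <= expR (- (n%:R * x)).
Proof.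
by rewrite -mulrN expRM_natl lerXn2r ?nnegrE ?pos_ge0 ?expR_ge0// pos_le_exp.
Qed.

Lemma exp_quadratic x : 0 <= x -> expR (- x) - 1 + x <= x ^+ 2.
Proof.
move=> x0; have p : 0 < 1 + x by lra.
have h : expR (- x) <= (1 + x)^-1.
  by rewrite expRN lef_pV2 ?posrE ?expR_gt0// expR_ge1Dx.
have h2 : (1 + x)^-1 <= 1 - x + x ^+ 2.
  rewrite -[leLHS]mul1r ler_pdivrMr//.
  have : 0 <= x ^+ 3 by rewrite exprn_ge0.
  lra.
lra.
Qed.

Lemma pos_exp_close x : 0 <= x -> expR (- x) - pos (1 - x) <= x ^+ 2.
Proof.
move=> x0; have h := exp_quadratic x0.
have h2 : 1 - x <= pos (1 - x) by rewrite le_max lexx.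
lra.
Qed.

Lemma pos_power_exp_close x n : 0 <= x ->
  `|pos (1 - x) ^+ n.+1 - expR (- (n.+1%:R * x))| <=
    n.+1%:R * x ^+ 2 * expR (- (n%:R * x)).
Proof.
move=> x0; rewrite distrC ger0_norm ?subr_ge0 ?pos_power_le_exp//.
rewrite -!mulrN !expRM_natl.
have /andP[_ h] := power_increment n (pos_ge0 (1 - x)) (pos_le_exp x).
rewrite (le_trans h)// mulrAC ler_wpM2r ?exprn_ge0 ?expR_ge0//.
by rewrite ler_wpM2l// pos_exp_close.
Qed.

(** Three errors: [r * n.+2%:R / k] against [u] and the power against [expR (- (u * y))], both of
    order [k^-1], and the increment over [kap] against its linear part, of relative order [kap].
    Since [n >= k * u - 4], the condition [8 <= a * k] keeps [n / k] above [a / 2], the decay rate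
    common to all terms. *)
Lemma kernel_close (k kap a b u y r : R) (n : nat) :
  0 < a -> a <= u -> u <= b -> 8 <= a * k -> 1 <= k -> 0 <= kap -> 0 <= y ->
  k * u - 2 <= n.+2%:R -> n.+2%:R <= k * u -> 0 <= r -> r <= 1 -> 1 - k^-1 <= r ->
  `|r * kap * (n.+2%:R / k) * pos (1 - y / k) ^+ n.+1
     - (expR (- (u * y)) - expR (- (u * (y + kap))))|
  <= kap * (k^-1 + kap) * (3 * (1 + b) ^+ 2) * (1 + y) ^+ 2 * expR (- (a / 2 * y)).
Proof.
move=> a0 au ub ak k1 kap0 y0 n1 n2 r0 r1 r2.
have k0 : 0 < k by lra.
have u0 : 0 < u by lra.
have ki0 : 0 < k^-1 by rewrite invr_gt0.
have auk : a * k <= k * u by rewrite mulrC ler_wpM2l// ltW.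
set E := expR (- (a / 2 * y)).
have E0 : 0 < E := expR_gt0 _.
have E_ge s : a / 2 <= s -> expR (- (s * y)) <= E.
  by move=> sa; rewrite ler_expR lerN2 ler_wpM2r.
have kk : k * k^-1 = 1 by rewrite divff// gt_eqF.
have nS : n.+2%:R = n.+1%:R + 1 :> R by rewrite natr1.
have nS' : n.+1%:R = n%:R + 1 :> R by rewrite natr1.
set p := pos (1 - y / k) ^+ n.+1.
set q := expR (- (n.+1%:R / k * y)).
have Nk_ge : a / 2 <= n.+1%:R / k by rewrite ler_pdivlMr//; lra.
have Nk_ge' : a / 2 <= n%:R / k by rewrite ler_pdivlMr//; lra.
have Nk_le : n.+1%:R / k <= u by rewrite ler_pdivrMr//; lra.
have yk0 : 0 <= y / k by rewrite divr_ge0// ltW.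
have A : `|p - q| <= b * y ^+ 2 * k^-1 * E.
  have := pos_power_exp_close n yk0.
  rewrite (_ : n.+1%:R * (y / k) = n.+1%:R / k * y); last by ring.
  rewrite (_ : n%:R * (y / k) = n%:R / k * y); last by ring.
  move=> /le_trans; apply; apply: ler_pM; rewrite ?expR_ge0 ?E_ge//.
    by rewrite mulr_ge0// sqr_ge0.
  rewrite (_ : _ * _ ^+ 2 = n.+1%:R / k * (y ^+ 2 * k^-1)); last by rewrite exprMn exprVn expr2; field; rewrite gt_eqF.
  by rewrite -(mulrA b) ler_wpM2r ?(le_trans Nk_le)// mulr_ge0 ?sqr_ge0// ltW.
have B : `|q - expR (- (u * y))| <= 3 * y * k^-1 * E.
  have d0 : 0 <= u - n.+1%:R / k by lra.
  have -> : expR (- (u * y)) = q * expR (- ((u - n.+1%:R / k) * y)).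
    by rewrite -expRD; congr expR; ring.
  rewrite -{1}[q]mulr1 -mulrBr normrM (gtr0_norm (expR_gt0 _)) mulrC.
  apply: ler_pM => //; rewrite ?expR_ge0//; last exact: E_ge.
  have h := expR_ge1Dx (- ((u - n.+1%:R / k) * y)).
  rewrite ger0_norm; last first.
    by rewrite subr_ge0 expR_le1 oppr_le0 mulr_ge0.
  have : (u - n.+1%:R / k) * y <= 3 * k^-1 * y.
    rewrite ler_wpM2r//.
    have : u * k * k^-1 = u by rewrite -mulrA kk mulr1.
    have : (u * k - n.+1%:R) * k^-1 <= 3 * k^-1 by rewrite ler_pM2r//; lra.
    lra.
  lra.
have q0 : 0 <= p by rewrite exprn_ge0// pos_ge0.
have pE : p <= E.
  rewrite /p (le_trans (pos_power_le_exp _ _))//.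
  by rewrite (_ : n.+1%:R * (y / k) = n.+1%:R / k * y); [exact: E_ge|ring].
have D : `|r * (n.+2%:R / k) - u| <= (b + 2) * k^-1.
  have t1 : u * k * k^-1 = u by rewrite -mulrA kk mulr1.
  have t2 : (k * u - 2) * k^-1 <= n.+2%:R * k^-1 by rewrite ler_pM2r.
  have t3 : n.+2%:R * k^-1 <= k * u * k^-1 by rewrite ler_pM2r.
  have t4 : 0 <= n.+2%:R * k^-1 by rewrite mulr_ge0// ltW.
  have t5 : (1 - r) * (n.+2%:R * k^-1) <= k^-1 * b by apply: ler_pM => //; lra.
  have t6 : 0 <= (1 - r) * (n.+2%:R * k^-1) by rewrite mulr_ge0//; lra.
  by rewrite ler_norml; apply/andP; split; lra.
have F : `|expR (- (u * y)) - expR (- (u * (y + kap))) - kap * u * expR (- (u * y))|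
    <= b ^+ 2 * kap ^+ 2 * E.
  have -> : expR (- (u * (y + kap))) = expR (- (u * y)) * expR (- (u * kap)).
    by rewrite -expRD; congr expR; ring.
  have uk0 : 0 <= u * kap by rewrite mulr_ge0// ltW.
  have h1 := exp_quadratic uk0; have h2 := expR_ge1Dx (- (u * kap)).
  set e1 := expR (- (u * y)); set e2 := expR (- (u * kap)) in h1 h2 *.
  rewrite (_ : _ - _ - _ = - (e1 * (e2 - 1 + u * kap))); last by ring.
  rewrite normrN normrM (gtr0_norm (expR_gt0 _)) mulrC.
  apply: ler_pM; rewrite ?expR_ge0//; last by apply: E_ge; lra.
  rewrite ger0_norm; last lra.
  rewrite (le_trans h1)// exprMn ler_wpM2r ?sqr_ge0// lerXn2r ?nnegrE//; lra.
have e0 : 0 < expR (- (u * y)) := expR_gt0 _.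
rewrite (_ : _ - _ = kap * ((r * (n.+2%:R / k) - u) * p + u * (p - q) + u * (q - expR (- (u * y))))
  - (expR (- (u * y)) - expR (- (u * (y + kap))) - kap * u * expR (- (u * y)))); last by ring.
apply: (le_trans (ler_normB _ _)).
rewrite normrM (ger0_norm kap0).
have G1 : `|(r * (n.+2%:R / k) - u) * p| <= (b + 2) * k^-1 * E.
  by rewrite normrM (ger0_norm q0); apply: ler_pM.
have b0 : 0 <= b by lra.
have G2 : `|u * (p - q)| <= b * (b * y ^+ 2 * k^-1 * E).
  by rewrite normrM (gtr0_norm u0); apply: ler_pM => //; lra.
have G3 : `|u * (q - expR (- (u * y)))| <= b * (3 * y * k^-1 * E).
  by rewrite normrM (gtr0_norm u0); apply: ler_pM => //; lra.
have G : `|(r * (n.+2%:R / k) - u) * p + u * (p - q) + u * (q - expR (- (u * y)))| <=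
    k^-1 * E * ((b + 2) + b ^+ 2 * y ^+ 2 + 3 * b * y).
  rewrite (le_trans (ler_normD _ _))// (le_trans (lerD (ler_normD _ _) (lexx _)))//; lra.
have {}G := ler_wpM2l kap0 G.
apply: (le_trans (lerD G F)).
have kE : 0 <= kap * E by rewrite mulr_ge0// ltW.
have y2 := sqr_ge0 y; have b2 := sqr_ge0 b.
have by0 : 0 <= b * y by rewrite mulr_ge0.
have b2y : 0 <= b ^+ 2 * y by rewrite mulr_ge0.
have b2y2 : 0 <= b ^+ 2 * y ^+ 2 by rewrite mulr_ge0.
have by2 : 0 <= b * y ^+ 2 by rewrite mulr_ge0.
have Z : (b + 2) + b ^+ 2 * y ^+ 2 + 3 * b * y <= 3 * (1 + b) ^+ 2 * (1 + y) ^+ 2 by lra.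
have Z2 : b ^+ 2 <= 3 * (1 + b) ^+ 2 * (1 + y) ^+ 2 by lra.
have W1 := ler_wpM2l (mulr_ge0 kE (ltW ki0)) Z.
have W2 := ler_wpM2l (mulr_ge0 kE kap0) Z2.
move: W1 W2; rewrite -(mulrA _ (3 * _)); set zz := 3 * (1 + b) ^+ 2 * (1 + y) ^+ 2.
set z1 := b + 2 + _ + _; lra.
Qed.

End kernel_inequalities.

(** * Linearisation of the normalised sum along a fixed path *)

Section path_bound.
Context {R : realType}.
Variables (k t mu sigma a b r : R) (N L : nat).
Hypotheses (k1 : 1 <= k) (t0 : 0 < t) (mu0 : 0 < mu) (sigma0 : 0 < sigma).
Hypotheses (a0 : 0 < a) (ab : a <= b) (ak : 8 <= a * k).
Hypotheses (r0 : 0 <= r) (r1 : r <= 1) (rk : 1 - k^-1 <= r).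

Local Notation pos x := (Num.max x 0).

(* With [r = sqrt ([k] / k)], [amplitude] is the normalisation of the theorem
   expressed through [mesh]: it equals [mu ^ (3/2) / sigma * sqrt ([k] / t)]. *)
Definition mesh := k * mu / t.
Definition amplitude := r * Num.sqrt mesh * mu / sigma.
(** Dominates the kernels for all [u] in [[a, b]] up to constants. The rate [a / 4] is what remains
    when an exponent at least [a * k / 2] meets a path that is only known to exceed half its
    mean. *)
Definition weight (j : nat) := mesh * expR (- (a / 4 * (mesh * j%:R))).
Definition kernel_const := (k^-1 + mesh) * (3 * (1 + b) ^+ 2 * (1 + 8 / a) ^+ 2).
Definition tail_weight (j : nat) :=
  (if (j < N * L)%N then 1 else expR (- (a / 2 * (mesh * (N * L)%:R)))) * weight j.

Let k0 : 0 < k. Proof. exact: lt_le_trans ltr01 k1. Qed.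
Let b0 : 0 < b. Proof. exact: lt_le_trans a0 ab. Qed.

Lemma mesh_gt0 : 0 < mesh. Proof. by rewrite divr_gt0// mulr_gt0. Qed.

Lemma amplitude_ge0 : 0 <= amplitude.
Proof.
by rewrite /amplitude mulr_ge0 ?invr_ge0 ?(ltW sigma0)// mulr_ge0 ?(ltW mu0)// mulr_ge0 ?sqrtr_ge0.
Qed.

Lemma weight_gt0 j : 0 < weight j.
Proof. by rewrite mulr_gt0 ?mesh_gt0 ?expR_gt0. Qed.

Section fixed_path.
Variable S : nat -> R.

(** The minus sign appears because [1 - S j / t] decreases in [S j]. The scaling gives each step
    variance [mesh], which makes this the counterpart of [B] at time [mesh * j]. *)
Definition deviation j := - (Num.sqrt mesh * (S j - j%:R * mu) / sigma).
Definition block_deviation j :=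
  if (j < N * L)%N then deviation ((j %/ L) * L) else 0.
(* When [S j] is below half its mean the Taylor remainder is only bounded by 1. *)
Definition late j : R := (S j < j%:R * mu / 2)%R%:R.
Definition path_error j :=
  amplitude * (b ^+ 2 * (sigma ^+ 2 / mu ^+ 2) * weight j * deviation j ^+ 2 + late j)
  + kernel_const * weight j * `|deviation j|
  + b * tail_weight j * `|deviation j - block_deviation j|.

Hypotheses (S0 : forall j, 0 <= S j) (S00 : S 0%N = 0).
Variables (u : R) (n : nat).
Hypotheses (au : a <= u) (ub : u <= b).
Hypotheses (n1 : k * u - 2 <= n.+2%:R) (n2 : n.+2%:R <= k * u).

Definition step_kernel j := expR (- (u * (mesh * j%:R))) - expR (- (u * (mesh * j.+1%:R))).

Let auk : a * k <= k * u. Proof. by rewrite mulrC ler_wpM2l// ltW. Qed.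
Let ubk : k * u <= k * b. Proof. by rewrite ler_wpM2l// ltW. Qed.

Let linear_kernel j := r * mesh * (n.+2%:R / k) * pos (1 - mesh * j%:R / k) ^+ n.+1.

Let rest j := pos (1 - S j / t) ^+ n.+2 - pos (1 - mesh * j%:R / k) ^+ n.+2
  - n.+2%:R * pos (1 - mesh * j%:R / k) ^+ n.+1 * ((1 - S j / t) - (1 - mesh * j%:R / k)).

Let sq_mesh : Num.sqrt mesh ^+ 2 = mesh.
Proof. by rewrite sqr_sqrtr// ltW// mesh_gt0. Qed.

Let meshk j : mesh * j%:R / k = j%:R * mu / t.
Proof. by rewrite /mesh; field; rewrite ?gt_eqF. Qed.

Let expansion j : amplitude * pos (1 - S j / t) ^+ n.+2 =
  amplitude * pos (1 - mesh * j%:R / k) ^+ n.+2 + linear_kernel j * deviation j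
  + amplitude * rest j.
Proof.
rewrite /rest; set px := pos _ ^+ _; set py := pos _ ^+ n.+2.
rewrite /linear_kernel; set q := pos _ ^+ n.+1.
suff -> : r * mesh * (n.+2%:R / k) * q * deviation j =
  amplitude * (n.+2%:R * q * (1 - S j / t - (1 - mesh * j%:R / k))) by ring.
rewrite meshk /deviation /amplitude.
have -> : r * mesh * (n.+2%:R / k) = r * (n.+2%:R * (mu / t)).
  by rewrite /mesh; field; rewrite ?gt_eqF.
by field; rewrite ?gt_eqF.
Qed.

(** The Taylor remainder carries the larger of the two bases to the power [n]. If [S j] is at least
    half its mean this decays like [weight]; otherwise the subtracted terms are nonnegative and the
    remainder is at most [1]. *)
Let rest_bound j : `|rest j| <=
  b ^+ 2 * (sigma ^+ 2 / mu ^+ 2) * weight j * deviation j ^+ 2 + late j.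
Proof.
have /andP[h1 h2] := pos_power_taylor n (1 - S j / t) (1 - mesh * j%:R / k).
rewrite -/(rest j) in h1 h2; rewrite (ger0_norm h1).
have jm0 : 0 <= j%:R * mu / t by rewrite divr_ge0 ?(ltW t0)// mulr_ge0 ?(ltW mu0).
have [late_j|early] := ltP (S j) (j%:R * mu / 2).
  have -> : late j = 1 by rewrite /late late_j.
  have B : 0 <= b ^+ 2 * (sigma ^+ 2 / mu ^+ 2) * weight j * deviation j ^+ 2.
    rewrite mulr_ge0 ?sqr_ge0// mulr_ge0 ?(ltW (weight_gt0 _))// mulr_ge0 ?sqr_ge0//.
    by rewrite divr_ge0 ?sqr_ge0.
  suff : rest j <= 1 by lra.
  rewrite /rest.
  have p1 : pos (1 - S j / t) ^+ n.+2 <= 1.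
    rewrite exprn_ile1 ?pos_ge0// ge_max ler01 andbT lerBlDr lerDl.
    by rewrite divr_ge0 ?S0// ltW.
  have p2 : 0 <= pos (1 - mesh * j%:R / k) ^+ n.+2 by rewrite exprn_ge0 ?pos_ge0.
  have p3 : 0 <= n.+2%:R * pos (1 - mesh * j%:R / k) ^+ n.+1 * ((1 - S j / t) - (1 - mesh * j%:R / k)).
    rewrite mulr_ge0 ?mulr_ge0 ?exprn_ge0 ?pos_ge0//.
    rewrite meshk (_ : _ - _ = (j%:R * mu - S j) / t); last by ring.
    rewrite divr_ge0 ?(ltW t0)//.
    have : 0 <= j%:R * mu by rewrite mulr_ge0 ?(ltW mu0).
    lra.
  lra.
have l0 : late j = 0 by rewrite /late ltNge early.
rewrite l0 addr0 (le_trans h2)//.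
have nb : n.+2%:R <= k * b := le_trans n2 ubk.
have na : a * k / 2 <= n%:R.
  have : n.+2%:R = n%:R + 2 :> R by rewrite -natrD addn2.
  move: n1 auk ak; lra.
set M := Num.max _ _ ^+ n.
have Mb : M <= expR (- (a / 4 * (mesh * j%:R))).
  have H s : j%:R * mu / t / 2 <= s -> pos (1 - s) ^+ n <= expR (- (a / 4 * (mesh * j%:R))).
    move=> sj; rewrite (le_trans (pos_power_le_exp _ _))// ler_expR lerN2.
    apply: (@le_trans _ _ (a * k / 2 * (j%:R * mu / t / 2))).
      by rewrite le_eqVlt; apply/orP; left; apply/eqP; rewrite /mesh; field; rewrite gt_eqF.
    by apply: ler_pM => //; rewrite divr_ge0// mulr_ge0 ?(ltW a0) ?(ltW k0).
  rewrite /M; case: (leP (pos (1 - S j / t)) (pos (1 - mesh * j%:R / k))) => _; apply: H.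
    by rewrite meshk; lra.
  rewrite mulrAC ler_pM2r ?invr_gt0//.
have M0 : 0 <= M by rewrite exprn_ge0// le_max pos_ge0.
have n22 : n.+2%:R ^+ 2 <= (k * b) ^+ 2 by rewrite lerXn2r ?nnegrE ?mulr_ge0 ?(ltW k0) ?(ltW b0).
rewrite meshk (_ : (1 - S j / t - (1 - j%:R * mu / t)) = - ((S j - j%:R * mu) / t)); last by ring.
have -> : b ^+ 2 * (sigma ^+ 2 / mu ^+ 2) * weight j * deviation j ^+ 2 =
   (k * b) ^+ 2 * expR (- (a / 4 * (mesh * j%:R))) * ((S j - j%:R * mu) / t) ^+ 2.
  rewrite /weight /deviation sqrrN !exprMn sq_mesh /mesh exprVn.
  set ee := expR _; rewrite !exprVn; field.
  by rewrite ?gt_eqF.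
rewrite sqrrN ler_wpM2r ?sqr_ge0//.
by apply: ler_pM => //; rewrite sqr_ge0.
Qed.

(** Half of the rate [a / 2] in [kernel_close] pays for the factor [(1 + y) ^+ 2], because [(1 + y)
    * expR (- (a / 8 * y)) <= 1 + 8 / a]. *)
Let kernel_bound j : `|linear_kernel j - step_kernel j| <= kernel_const * weight j.
Proof.
have y0 : 0 <= mesh * j%:R by rewrite mulr_ge0// ltW// mesh_gt0.
have := kernel_close a0 au ub ak k1 (ltW mesh_gt0) y0 n1 n2 r0 r1 rk.
rewrite -/(linear_kernel j) (_ : mesh * j%:R + mesh = mesh * j.+1%:R); last by rewrite -natr1; ring.
move=> /le_trans; apply; set y := mesh * j%:R.
have e0 := expR_gt0 (- (a / 4 * y)).
have key : (1 + y) ^+ 2 * expR (- (a / 2 * y)) <= (1 + 8 / a) ^+ 2 * expR (- (a / 4 * y)).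
  have -> : expR (- (a / 2 * y)) = expR (- (a / 8 * y)) ^+ 2 * expR (- (a / 4 * y)).
    by rewrite -expRM_natl -expRD; congr expR; field.
  rewrite mulrA ler_pM2r// -exprMn.
  have q0 : 0 < 1 + 8 / a by rewrite addr_gt0// divr_gt0.
  rewrite lerXn2r ?nnegrE ?(ltW q0)// ?mulr_ge0 ?expR_ge0 ?addr_ge0//.
  rewrite expRN ler_pdivrMr ?expR_gt0//.
  have h := expR_ge1Dx (a / 8 * y).
  have := ler_wpM2l (ltW q0) h.
  have -> : (1 + 8 / a) * (1 + a / 8 * y) = 1 + 8 / a + a / 8 * y + y by field; rewrite gt_eqF.
  have : 0 <= 8 / a by rewrite divr_ge0// ltW.
  have : 0 <= a / 8 * y by rewrite mulr_ge0// divr_ge0// ltW.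
  lra.
rewrite /kernel_const /weight.
have ki0 : 0 < k^-1 by rewrite invr_gt0.
have m0 := mesh_gt0.
have C0 : 0 <= mesh * (k^-1 + mesh) * (3 * (1 + b) ^+ 2).
  have s0 : 0 <= k^-1 + mesh by rewrite addr_ge0 ?(ltW m0) ?(ltW ki0).
  apply: mulr_ge0; apply: mulr_ge0 => //; [exact: ltW m0|exact: sqr_ge0].
have := ler_wpM2l C0 key; set E1 := expR _; set E2 := expR _; lra.
Qed.

(** The increment is at most [b * mesh * expR (- (a * y))]. Beyond the cut-off, half of this decay
    becomes the constant factor of [tail_weight] and a quarter is kept in [weight]. *)
Let step_kernel_bound j : 0 <= step_kernel j <= b * tail_weight j.
Proof.
have m0 := mesh_gt0.
have y0 : 0 <= mesh * j%:R by rewrite mulr_ge0// ltW.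
rewrite /step_kernel (_ : mesh * j.+1%:R = mesh * j%:R + mesh); last by rewrite -natr1; ring.
rewrite mulrDr opprD expRD; set y := mesh * j%:R.
have e0 : 0 < expR (- (u * y)) := expR_gt0 _.
have um : 0 < u * mesh by rewrite mulr_gt0// (lt_le_trans a0).
have h1 := expR_ge1Dx (- (u * mesh)).
have h2 : expR (- (u * mesh)) <= 1 by rewrite expR_le1 oppr_le0 ltW.
rewrite (_ : _ - _ * _ = expR (- (u * y)) * (1 - expR (- (u * mesh)))); last by ring.
apply/andP; split; first by rewrite mulr_ge0 ?(ltW e0)//; lra.
apply: (@le_trans _ _ (expR (- (a * y)) * (b * mesh))).
  apply: ler_pM; rewrite ?expR_ge0//; first lra.
    by rewrite ler_expR lerN2 ler_wpM2r.
  have : u * mesh <= b * mesh by rewrite ler_wpM2r// ltW.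
  lra.
rewrite /tail_weight /weight -/y.
have -> : b * ((if (j < N * L)%N then 1 else expR (- (a / 2 * (mesh * (N * L)%:R)))) *
   (mesh * expR (- (a / 4 * y)))) = ((if (j < N * L)%N then 1 else expR (- (a / 2 * (mesh * (N * L)%:R))))
   * expR (- (a / 4 * y))) * (b * mesh) by ring.
rewrite ler_wpM2r//; first by rewrite mulr_ge0 ?(ltW b0) ?(ltW m0).
have ay : 0 <= a * y by rewrite mulr_ge0// ltW.
case: ltnP => NL; first by rewrite mul1r ler_expR; lra.
rewrite -expRD ler_expR.
have : a / 2 * (mesh * (N * L)%:R) <= a / 2 * y.
  by rewrite ler_pM2l ?divr_gt0// ler_pM2l// ler_nat.
lra.
Qed.

(** The zeroth-order terms form a Riemann sum that misses its integral by at most [1], whence the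
    lone [amplitude]; all other errors are in [path_error]. The right side does not depend on
    [u]. *)
Lemma path_bound J : (N * L <= J.+1)%N -> t <= J.+1%:R * mu ->
  `|amplitude * (\sum_(j < J) pos (1 - S j.+1 / t) ^+ n.+2 - t / (n.+3%:R * mu))
    - \sum_(j < N * L) step_kernel j * deviation ((j %/ L) * L)|
  <= amplitude + \sum_(j < J.+1) path_error j.
Proof.
move=> NLJ tJ.
have m0 := mesh_gt0.
(* The sum runs over [S 1, S 2, ...] but the kernels start at [j = 0]; the extra term vanishes. *)
have dev0 : deviation 0 = 0 by rewrite /deviation S00 !mul0r subr0 mulr0 mul0r oppr0.
have -> : \sum_(j < N * L) step_kernel j * deviation ((j %/ L) * L) =
    \sum_(j < J.+1) step_kernel j * block_deviation j.
  rewrite -(big_mkord xpredT (fun j => step_kernel j * deviation ((j %/ L) * L))).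
  rewrite -(big_mkord xpredT (fun j => step_kernel j * block_deviation j)).
  rewrite (big_cat_nat _ NLJ)//= [X in _ + X]big1_seq ?addr0; last first.
    move=> j; rewrite mem_index_iota => /andP[_ /andP[h _]].
    by rewrite /block_deviation ltnNge h mulr0.
  rewrite !big_nat; apply: eq_bigr => j /andP[_ h].
  by rewrite /block_deviation h.
have h0 : 0 < mu / t by rewrite divr_gt0.
have hJ : 1 <= J.+1%:R * (mu / t) by rewrite mulrA ler_pdivlMr// mul1r.
have yE j : j.+1%:R * (mu / t) = mesh * j.+1%:R / k by rewrite meshk mulrA.
have := pos_power_riemann n.+1 h0 hJ.
under eq_bigr => j _ do rewrite yE.
have -> : (n.+3%:R * (mu / t))^-1 = t / (n.+3%:R * mu).
  by field; rewrite !gt_eqF// ltr0n.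
set Y := \sum_(j < J) _ => /andP[Y1 Y2].
have E1 : amplitude * (\sum_(j < J) pos (1 - S j.+1 / t) ^+ n.+2) =
  amplitude * Y + \sum_(j < J.+1) linear_kernel j * deviation j
   + \sum_(j < J) amplitude * rest j.+1.
  rewrite [\sum_(j < J.+1) _]big_ord_recl dev0 mulr0 add0r !mulr_sumr -!big_split/=.
  by apply: eq_bigr => j _; exact: expansion.
rewrite mulrBr E1.
have -> : amplitude * Y + \sum_(j < J.+1) linear_kernel j * deviation j +
   \sum_(j < J) amplitude * rest j.+1 - amplitude * (t / (n.+3%:R * mu))
   - \sum_(j < J.+1) step_kernel j * block_deviation j =
  amplitude * (Y - t / (n.+3%:R * mu)) + (\sum_(j < J) amplitude * rest j.+1
   + \sum_(j < J.+1) (linear_kernel j * deviation j - step_kernel j * block_deviation j)).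
  by rewrite sumrB; ring.
have A0 := amplitude_ge0.
rewrite (le_trans (ler_normD _ _))// lerD//.
  rewrite normrM (ger0_norm A0) ler_piMr// ler_norml; apply/andP; move: Y1 Y2; rewrite lerBlDr => Y1 Y2; split; first by rewrite lerBrDr addrC lerBlDr.
  by rewrite lerBlDr (le_trans Y2)// lerDr ler01.
rewrite (le_trans (ler_normD _ _))//.
have B1 : `|\sum_(j < J) amplitude * rest j.+1| <= \sum_(j < J.+1)
   amplitude * (b ^+ 2 * (sigma ^+ 2 / mu ^+ 2) * weight j * deviation j ^+ 2 + late j).
  rewrite (le_trans (ler_norm_sum _ _ _))//.
  rewrite [leRHS]big_ord_recl -[leLHS]add0r lerD//.
    by rewrite mulr_ge0// (le_trans (normr_ge0 _) (rest_bound 0)).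
  apply: ler_sum => j _; rewrite normrM (ger0_norm A0) ler_wpM2l//.
apply: (le_trans (lerD B1 (ler_norm_sum _ _ _))).
rewrite -big_split/=; apply: ler_sum => j _; rewrite /path_error -addrA lerD2l.
rewrite (_ : _ - _ = (linear_kernel j - step_kernel j) * deviation j
  + step_kernel j * (deviation j - block_deviation j)); last by ring.
have /andP[s0 s1] := step_kernel_bound j.
rewrite (le_trans (ler_normD _ _))// !normrM (ger0_norm s0) lerD//.
  by rewrite ler_wpM2r// kernel_bound.
by rewrite ler_wpM2r.
Qed.

End fixed_path.
End path_bound.

(** * Moments of walks with i.i.d. steps *)

Section iid_walk.
Context d (T : measurableType d) (R : realType) (P : probability T R).
Implicit Types (X : nat -> T -> R).

Lemma iid_comp X (f : R -> R) : measurable_fun setT f -> iid P X ->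
  iid P (fun i w => f (X i w)).
Proof.
move=> mf [mX [iX dX]].
have mfA A : measurable A -> measurable (f @^-1` A).
  by move=> mA; rewrite -[Y in measurable Y]setTI; exact: mf.
split; [|split].
- by move=> i; exact: measurableT_comp.
- by move=> n J A uJ aJ mA; apply: (iX n J (fun i => f @^-1` A i)) => // i; exact: mfA.
- by move=> i A mA; apply: (dX i (f @^-1` A)); exact: mfA.
Qed.

Definition walk X n w : R := \sum_(i < n) X i w.

Lemma walkS X n w : walk X n.+1 w = walk X n w + X n w.
Proof. by rewrite /walk big_ord_recr. Qed.

Variable X : nat -> T -> R.
Hypothesis iidX : iid P X.

Let mX i : measurable_fun setT (X i). Proof. by case: iidX. Qed.

Lemma past_walk n m : (n <= m)%N -> measurable_fun setT (walk X n : past X m -> R).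
Proof.
move=> nm; apply: (@measurable_sum _ (past X m) R setT _ _ (fun (i : 'I_n) w => X i w)) => i.
by apply: past_coordinate; exact: leq_trans (ltn_ord i) nm.
Qed.

Lemma measurable_walk n : measurable_fun setT (walk X n).
Proof. by apply: measurable_sum => i; exact: mX. Qed.

Lemma walk_exp_moment (l : R) n :
  (\int[P]_w (expR (- (l * walk X n w)))%:E =
   (\int[P]_w (expR (- (l * X 0%N w)))%:E) ^+ n)%E.
Proof.
elim: n => [|n IH].
  under eq_integral do rewrite /walk big_ord0 mulr0 oppr0 expR0.
  rewrite expe0 integral_cst// mul1e.
  by exact: (@probability_setT _ _ _ P).
pose phi w y := expR (- (l * (walk X n w + y))).
have mphi y : measurable_fun setT (phi^~ y : past X n -> R).
  apply: measurableT_comp => //; apply: measurableT_comp => //.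
  apply: measurable_funM => //; apply: measurable_funD => //.
  exact: past_walk.
have cphi w : continuous (phi w).
  move=> y; apply: (@continuous_comp _ _ _ (fun y => - (l * (walk X n w + y))) expR);
    last exact: continuous_expR.
  apply: (@continuousN _ R _ (fun y => l * (walk X n w + y))).
  apply: (@continuousM R R (cst l) (fun y => walk X n w + y)); first exact: cst_continuous.
  by apply: (@continuousD _ R _ (cst (walk X n w)) id); [exact: cst_continuous|exact: cvg_id].
have phi0 w y : 0 <= phi w y by exact: expR_ge0.
have mexp i : measurable_fun setT (fun w => (expR (- (l * X i w)))%:E).
  apply/measurable_EFinP; apply: measurableT_comp => //; apply: measurableT_comp => //.
  by apply: measurable_funM => //.
have mexpw : measurable_fun setT (fun w => (expR (- (l * walk X n w)))%:E).
  apply/measurable_EFinP; apply: measurableT_comp => //; apply: measurableT_comp => //.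
  by apply: measurable_funM => //; exact: measurable_walk.
have me : measurable_fun setT (fun y : R => (expR (- (l * y)))%:E).
  under eq_fun do rewrite -mulNr.
  by apply/measurable_EFinP; apply: measurableT_comp => //; exact: mulrl_measurable.
under eq_integral do rewrite walkS -/(phi _ _).
rewrite (decouple iidX mphi cphi phi0).
under eq_integral => w _.
  under eq_integral do rewrite /phi mulrDr opprD expRD EFinM.
  rewrite ge0_integralZl//.
  rewrite (@identically_distributed _ _ _ P X iidX n (fun y => (expR (- (l * y)))%:E))//.
  over.
rewrite ge0_integralZr//; last first.
- by apply: integral_ge0 => y _; rewrite lee_fin expR_ge0.
by rewrite IH expeS muleC.
Qed.

Variable v : R.
Hypotheses (X1 : intble P (X 0%N)) (X2 : intble P (fun w => X 0%N w ^+ 2)).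
Hypotheses (EX : \int[P]_w X 0%N w = 0) (EX2 : \int[P]_w (X 0%N w ^+ 2) = v).

(** Each further step is centred and independent of the past, so the cross term vanishes. The
    extended-real form lets integrability of the square be read off from the value. *)
Lemma walk_increment_second_moment i l :
  (\int[P]_w ((walk X (i + l) w - walk X i w) ^+ 2)%:E = (l%:R * v)%:E)%E.
Proof.
have v0 : 0 <= v by rewrite -EX2 Rintegral_ge0// => w _; exact: sqr_ge0.
elim: l => [|l IH].
  under eq_integral do rewrite addn0 subrr expr0n/=.
  by rewrite integral0 mul0r.
pose phi w y := (walk X (i + l) w - walk X i w + y) ^+ 2.
have mphi y : measurable_fun setT (phi^~ y : past X (i + l) -> R).
  apply: measurable_funX; apply: measurable_funD => //; apply: measurable_funB.
  - exact: past_walk.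
  - by apply: past_walk; rewrite leq_addr.
have cphi w : continuous (phi w).
  move=> y; apply: (@continuous_comp _ _ _ (fun y => walk X (i + l) w - walk X i w + y)
    (fun z : R => z ^+ 2)); last exact: exprn_continuous.
  by apply: (@continuousD _ R _ (cst (walk X (i + l) w - walk X i w)) id);
    [exact: cst_continuous|exact: cvg_id].
have phi0 w y : 0 <= phi w y by exact: sqr_ge0.
under eq_integral do rewrite addnS walkS addrAC -/(phi _ _).
rewrite (decouple iidX mphi cphi phi0).
transitivity (\int[P]_w (((walk X (i + l) w - walk X i w) ^+ 2)%:E + v%:E))%E.
  apply: eq_integral => w _.
  rewrite (@identically_distributed _ _ _ P X iidX (i + l) (fun y => (phi w y)%:E)); first last.
  - by move=> y; rewrite lee_fin.
  - by apply/measurable_EFinP; exact: continuous_measurable_fun (cphi w).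
  set s := walk X (i + l) w - walk X i w.
  have I0 : intble P (fun w' => s ^+ 2 + (2 * s) * X 0%N w').
    by apply: intbleD; [exact: intble_cst|exact: intbleZ].
  have I : intble P (fun w' => s ^+ 2 + (2 * s) * X 0%N w' + X 0%N w' ^+ 2) by exact: intbleD.
  transitivity (\int[P]_w' (s ^+ 2 + (2 * s) * X 0%N w' + X 0%N w' ^+ 2)%:E)%E.
    by apply: eq_integral => w' _; rewrite /phi -/s; congr EFin; ring.
  rewrite intbleE// RintegralD// RintegralD//; last 2 first.
  - exact: intble_cst.
  - exact: intbleZ.
  by rewrite RintegralZl// EX EX2 mulr0 addr0 expectation_cst.
rewrite ge0_integralD//.
- rewrite IH integral_cst//.
  have -> : (P : {measure set T -> \bar R}) setT = 1%E by exact: probability_setT.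
  by rewrite mule1 -EFinD -natr1 mulrDl mul1r.
- by move=> w _; rewrite lee_fin sqr_ge0.
- by apply/measurable_EFinP; apply: measurable_funX; apply: measurable_funB; exact: measurable_walk.
Qed.

Lemma walk_second_moment l : (\int[P]_w (walk X l w ^+ 2)%:E = (l%:R * v)%:E)%E.
Proof.
rewrite -(walk_increment_second_moment 0 l) add0n.
by apply: eq_integral => w _; rewrite {3}/walk big_ord0 subr0.
Qed.

End iid_walk.

(** * Exponential bound for the lower tail of the walk *)

Section lower_tail.
Context d (T : measurableType d) (R : realType) (P : probability T R).
Variables (xi : nat -> T -> R) (mu m2 : R).
Hypothesis iidxi : iid P xi.
Hypothesis xi0 : P [set w | xi 0%N w <= 0] = 0%E.
Hypotheses (mu0 : 0 < mu) (m20 : 0 < m2).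
Hypotheses (I1 : intble P (xi 0%N)) (I2 : intble P (fun w => xi 0%N w ^+ 2)).
Hypotheses (E1 : \int[P]_w xi 0%N w = mu) (E2 : \int[P]_w (xi 0%N w ^+ 2) = m2).

(** The minimiser in [l] of [l ^+ 2 * m2 - l * mu / 2], the exponent per step below; the minimum is
    [- mu ^+ 2 / (16 * m2)]. *)
Definition tail_rate : R := mu / (4 * m2).

(** For positive steps [expR (- x) <= 1 - x + x ^+ 2], so two moments already give an exponential
    bound below the mean; independence raises it to the power [j]. *)
Lemma lower_tail_moment j :
  (\int[P]_w (expR (tail_rate * (j%:R * mu / 2 - walk xi j w)))%:E
   <= (expR (- (mu ^+ 2 / (16 * m2))) ^+ j)%:E)%E.
Proof.
set l := tail_rate.
have l0 : 0 < l by rewrite divr_gt0// mulr_gt0.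
have mxi i : measurable_fun setT (xi i) by case: iidxi.
have mw : measurable_fun setT (walk xi j) := measurable_walk iidxi j.
have H : (\int[P]_w (expR (- (l * xi 0%N w)))%:E <= (expR (- (l * mu) + l ^+ 2 * m2))%:E)%E.
  (* The pointwise bound holds only where the step is positive, hence an almost everywhere
     comparison of nonnegative functions; [pos_quad] then removes the absolute value. *)
  apply: (@le_trans _ _ (\int[P]_w `|1 - l * xi 0%N w + l ^+ 2 * xi 0%N w ^+ 2|%:E)%E).
    apply: ae_ge0_le_integral => //.
    - apply/measurable_EFinP; apply: measurableT_comp => //; apply: measurableT_comp => //.
      exact: measurable_funM.
    - apply/measurable_EFinP; apply: measurableT_comp => //.
      apply: measurable_funD; first by apply: measurable_funB => //; exact: measurable_funM.
      by apply: measurable_funM => //; exact: measurable_funX.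
    exists [set w | xi 0%N w <= 0]; split => //.
      rewrite (_ : [set w | xi 0%N w <= 0] = xi 0%N @^-1` `]-oo, 0]).
        by rewrite -[X in measurable X]setTI; exact: mxi.
      by apply/seteqP; split => w /=; rewrite in_itv.
    move=> w /=; apply: contra_notP => /negP; rewrite -ltNge => xw _.
    have lx : 0 <= l * xi 0%N w by rewrite mulr_ge0 ?(ltW l0) ?(ltW xw).
    rewrite lee_fin (le_trans _ (ler_norm _))//.
    by have := exp_quadratic lx; rewrite exprMn; lra.
  have I : intble P (fun w => 1 - l * xi 0%N w + l ^+ 2 * xi 0%N w ^+ 2).
    apply: intbleD; last exact: intbleZ.
    by apply: intbleB; [exact: intble_cst|exact: intbleZ].
  have pos_quad w : `|1 - l * xi 0%N w + l ^+ 2 * xi 0%N w ^+ 2| =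
     1 - l * xi 0%N w + l ^+ 2 * xi 0%N w ^+ 2.
    rewrite ger0_norm// -exprMn; have := sqr_ge0 (l * xi 0%N w - 1 / 2).
    by set z := l * _; lra.
  under eq_integral do rewrite pos_quad.
  rewrite intbleE// RintegralD//; last 2 first.
  - by apply: intbleB; [exact: intble_cst|exact: intbleZ].
  - exact: intbleZ.
  rewrite RintegralB//; last 2 first.
  - exact: intble_cst.
  - exact: intbleZ.
  rewrite !RintegralZl// E1 E2 expectation_cst lee_fin.
  by have := expR_ge1Dx (- (l * mu) + l ^+ 2 * m2); lra.
have -> : (\int[P]_w (expR (l * (j%:R * mu / 2 - walk xi j w)))%:E =
    (expR (l * mu / 2) ^+ j)%:E * \int[P]_w (expR (- (l * walk xi j w)))%:E)%E.
  rewrite -ge0_integralZl//; last first.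
  - apply/measurable_EFinP; apply: measurableT_comp => //; apply: measurableT_comp => //.
    exact: measurable_funM.
  apply: eq_integral => w _; rewrite -EFinM -expRM_natl -expRD; congr (expR _)%:E.
  by ring.
rewrite walk_exp_moment//.
apply: (@le_trans _ _ ((expR (l * mu / 2) ^+ j)%:E * ((expR (- (l * mu) + l ^+ 2 * m2))%:E ^+ j))%E).
  rewrite lee_wpmul2l//.
  elim: {mw} j => [|j IH]; first by rewrite !expe0.
  rewrite !expeS; apply: lee_pmul => //.
  - by apply: integral_ge0 => w _; rewrite lee_fin expR_ge0.
  - by apply: expe_ge0; apply: integral_ge0 => w _; rewrite lee_fin expR_ge0.
rewrite -EFin_expe -EFinM lee_fin -exprMn -expRD lerXn2r ?nnegrE ?expR_ge0//.
rewrite ler_expR le_eqVlt; apply/orP; left; apply/eqP.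
by rewrite /l /tail_rate; field; rewrite gt_eqF.
Qed.

End lower_tail.

(** * Bounds for series *)

Section series_bounds.
Context {R : realType}.

Lemma geometric_partial_sum (q : R) n : 0 <= q -> q < 1 ->
  \sum_(j < n) q ^+ j <= (1 - q)^-1.
Proof.
move=> q0 q1; have p : 0 < 1 - q by lra.
have -> : \sum_(j < n) q ^+ j = (1 - q ^+ n) / (1 - q).
  apply: (mulIf (lt0r_neq0 p)); rewrite divfK ?gt_eqF//.
  elim: n => [|n IH]; first by rewrite big_ord0 expr0 mul0r subrr.
  by rewrite big_ord_recr/= mulrDl IH exprSr; ring.
by rewrite -[leRHS]mul1r ler_pM2r ?invr_gt0// gerBl exprn_ge0.
Qed.

Lemma nneseries_le_partial (x : nat -> \bar R) (M : \bar R) :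
  (forall j, (0 <= x j)%E) -> (forall n, (\sum_(0 <= j < n) x j <= M)%E) ->
  (\sum_(0 <= j <oo) x j <= M)%E.
Proof.
move=> x0 xM; apply: lime_le; first exact: is_cvg_nneseries.
by apply: nearW.
Qed.

Lemma partial_le_nneseries (x : nat -> \bar R) n :
  (forall j, (0 <= x j)%E) ->
  (\sum_(0 <= j < n) x j <= \sum_(0 <= j <oo) x j)%E.
Proof. by move=> x0; apply: nneseries_lim_ge. Qed.

(** The bound on the partial sums both forces convergence of the nonnegative series and passes to
    its limit, so finiteness of the renewal sum is a by-product of the estimate. *)
Lemma affine_series_bound (x : nat -> R) (A c psi M : R) (J0 : nat) :
  (forall j, 0 <= x j) -> 0 < A ->
  (forall J, (J0 <= J)%N -> `|A * (\sum_(j < J) x j - c) - psi| <= M) ->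
  (\sum_(0 <= j <oo) (x j)%:E < +oo)%E /\
  `|A * (fine (\sum_(0 <= j <oo) (x j)%:E)%E - c) - psi| <= M.
Proof.
move=> x0 A0 H.
pose s n := \sum_(0 <= j < n) x j.
have sE n : s n = \sum_(j < n) x j by rewrite /s big_mkord.
have nds : nondecreasing_seq s.
  move=> m n mn; rewrite /s (big_cat_nat _ mn)//= lerDl.
  by apply: sumr_ge0.
have ub : has_ubound (range s).
  exists ((M + psi) / A + c) => _ [n _ <-].
  apply: (@le_trans _ _ (s (maxn n J0))); first by apply: nds; rewrite leq_maxl.
  have := H (maxn n J0) (leq_maxr _ _); rewrite -sE ler_norml => /andP[_ h].
  rewrite -lerBlDr ler_pdivlMr//; lra.
have cs : s @ \oo --> sup (range s) := nondecreasing_cvgn nds ub.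
set l := sup (range s) in cs.
have El : (\sum_(0 <= j <oo) (x j)%:E = l%:E)%E.
  apply: cvg_lim => //.
  under eq_fun do rewrite sumEFin.
  by apply: cvg_EFin => //; apply: nearW.
rewrite El ltry; split => //=.
apply/ler_addgt0Pr => e e0.
have eA : 0 < e / A by rewrite divr_gt0.
have /cvgrPdist_le/(_ _ eA)[n0 _ hn] := cs.
have := hn (maxn n0 J0) (leq_maxl _ _).
have := H (maxn n0 J0) (leq_maxr _ _); rewrite -sE.
set y := s _ => h1 h2.
have h3 : A * `|l - y| <= e by rewrite mulrC -ler_pdivlMr.
have -> : A * (l - c) - psi = A * (y - c) - psi + A * (l - y) by ring.
rewrite (le_trans (ler_normD _ _))// lerD// normrM gtr0_norm//.
Qed.

End series_bounds.

(** * A random error bound with small expectation *)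

Section random_bound.
Context d (T : measurableType d) (R : realType) (P : probability T R).
Variables (xi : nat -> T -> R) (mu sigma m2 : R).
Hypothesis iidxi : iid P xi.
Hypothesis xi0 : forall i, P [set w | xi i w <= 0] = 0%E.
Hypotheses (mu0 : 0 < mu) (sigma0 : 0 < sigma) (m20 : 0 < m2).
Hypotheses (I1 : intble P (xi 0%N)) (I2 : intble P (fun w => xi 0%N w ^+ 2)).
Hypotheses (E1 : \int[P]_w xi 0%N w = mu) (E2 : \int[P]_w (xi 0%N w ^+ 2) = m2).
Hypothesis var : m2 = sigma ^+ 2 + mu ^+ 2.
Variables (k t a b r s : R) (N L : nat).
Hypotheses (k1 : 1 <= k) (t0 : 0 < t).
Hypotheses (a0 : 0 < a) (ab : a <= b) (ak : 8 <= a * k).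
Hypotheses (r0 : 0 <= r) (r1 : r <= 1) (rk : 1 - k^-1 <= r).
Local Notation kap := (mesh k t mu).
Hypotheses (s0 : 0 < s) (L0 : (0 < L)%N) (Ls : kap * L%:R <= s ^+ 2) (kap1 : kap <= 1).

Local Notation S w := (walk xi ^~ w).
Local Notation A := (amplitude k t mu sigma r).
Local Notation dev j w := (deviation k t mu sigma (S w) j).
Local Notation bdev j w := (block_deviation k t mu sigma N L (S w) j).
Local Notation wt := (weight k t mu a).
Local Notation twt := (tail_weight k t mu a N L).
Local Notation C1 := (b ^+ 2 * (sigma ^+ 2 / mu ^+ 2)).
Local Notation C3 := (kernel_const k t mu a b).
Local Notation tau := (expR (- (a / 2 * (kap * (N * L)%:R)))).
Local Notation rho := (expR (- (mu ^+ 2 / (16 * m2)))).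

Let kap0 : 0 < kap. Proof. by apply: mesh_gt0. Qed.
Let b0 : 0 < b. Proof. exact: lt_le_trans a0 ab. Qed.

Definition scaled_step (x : R) := - (Num.sqrt kap * (x - mu) / sigma).

Lemma measurable_scaled_step : measurable_fun setT scaled_step.
Proof.
apply: measurableT_comp => //; apply: measurable_funM => //.
by apply: measurable_funM => //; apply: measurable_funB.
Qed.

Definition steps i w := scaled_step (xi i w).

Lemma steps_iid : iid P steps.
Proof. exact: iid_comp measurable_scaled_step iidxi. Qed.

Let Ic : intble P (fun w => xi 0%N w - mu).
Proof. by apply: intbleB => //; exact: intble_cst. Qed.

Let stepsE w : steps 0%N w = - (Num.sqrt kap / sigma) * (xi 0%N w - mu).
Proof. by rewrite /steps /scaled_step; ring. Qed.

Lemma steps_intble : intble P (steps 0%N).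
Proof. by rewrite (_ : steps 0%N = (fun w => - (Num.sqrt kap / sigma) * (xi 0%N w - mu))); [exact: intbleZ|exact/funext]. Qed.

Lemma steps_mean : \int[P]_w steps 0%N w = 0.
Proof.
under eq_Rintegral do rewrite stepsE.
by rewrite RintegralZl// RintegralB// ?E1 ?expectation_cst ?subrr ?mulr0//; exact: intble_cst.
Qed.

Let steps2E w : steps 0%N w ^+ 2 = kap / sigma ^+ 2 * (xi 0%N w ^+ 2 - (2 * mu) * xi 0%N w + mu ^+ 2).
Proof.
rewrite stepsE exprMn sqrrN exprMn sqr_sqrtr ?(ltW kap0)// exprVn.
by congr (_ * _); ring.
Qed.

Let I2c : intble P (fun w => xi 0%N w ^+ 2 - (2 * mu) * xi 0%N w + mu ^+ 2).
Proof.
apply: intbleD; last exact: intble_cst.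
by apply: intbleB => //; exact: intbleZ.
Qed.

Lemma steps_sqr_intble : intble P (fun w => steps 0%N w ^+ 2).
Proof. by under eq_fun do rewrite steps2E; exact: intbleZ. Qed.

Lemma steps_variance : \int[P]_w (steps 0%N w ^+ 2) = kap.
Proof.
under eq_Rintegral do rewrite steps2E.
rewrite RintegralZl// RintegralD//; last 2 first.
- by apply: intbleB => //; exact: intbleZ.
- exact: intble_cst.
rewrite RintegralB//; last exact: intbleZ.
rewrite RintegralZl// E1 E2 expectation_cst var.
by field; rewrite gt_eqF.
Qed.

Lemma deviation_walk j w : dev j w = walk steps j w.
Proof.
rewrite /deviation.
have -> : walk xi j w - j%:R * mu = \sum_(i < j) (xi i w - mu).
  by rewrite /walk sumrB sumr_const card_ord mulr_natl.
rewrite mulr_sumr mulr_suml -sumrN; apply: eq_bigr => i _.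
by rewrite /steps /scaled_step.
Qed.

(* Obtained from [path_error] by [`|v| <= 1 + v ^+ 2], [`|v| <= s + s^-1 * v ^+ 2]
   and the exponential Markov inequality for [late]. *)
Definition error_term j w :=
  A * (C1 * wt j * dev j w ^+ 2 + expR (tail_rate mu m2 * (j%:R * mu / 2 - walk xi j w)))
  + C3 * wt j * (1 + dev j w ^+ 2)
  + b * twt j * (s + s^-1 * (dev j w - bdev j w) ^+ 2).

Let C3_ge0 : 0 <= C3.
Proof.
have ki0 : 0 < k^-1 by rewrite invr_gt0 (lt_le_trans ltr01).
apply: mulr_ge0; first by rewrite addr_ge0 ?(ltW ki0) ?(ltW kap0).
by apply: mulr_ge0; [apply: mulr_ge0 => //; exact: sqr_ge0|exact: sqr_ge0].
Qed.

Let wt_gt0 j : 0 < wt j. Proof. by apply: weight_gt0. Qed.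

Let twt_ge0 j : 0 <= twt j.
Proof. by rewrite /tail_weight mulr_ge0 ?(ltW (wt_gt0 j))//; case: ifP => // _; exact: expR_ge0. Qed.

Let A0 : 0 <= A. Proof. by apply: amplitude_ge0. Qed.

Let C1_ge0 : 0 <= C1.
Proof. by rewrite mulr_ge0 ?sqr_ge0// divr_ge0 ?sqr_ge0. Qed.

Lemma path_error_le j w : path_error k t mu sigma a b r N L (S w) j <= error_term j w.
Proof.
rewrite /path_error /error_term; apply: lerD; first apply: lerD.
- rewrite ler_wpM2l// lerD2l /late; case: ltP => h; last by rewrite expR_ge0.
  apply: le_trans (expR_ge1Dx _); rewrite lerDl mulr_ge0 ?subr_ge0 ?(ltW h)//.
  by rewrite divr_ge0 ?(ltW mu0)// mulr_ge0 ?(ltW m20).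
- rewrite ler_wpM2l//; first by rewrite mulr_ge0 ?(ltW (wt_gt0 j)).
  set x := dev j w; have [x1|x1] := leP `|x| 1; first by rewrite (le_trans x1)// lerDl sqr_ge0.
  rewrite -(real_normK (num_real x)) expr2 (@le_trans _ _ (`|x| * `|x|))// ?lerDr//.
  by rewrite ler_peMl// ltW.
- rewrite ler_wpM2l//; first by rewrite mulr_ge0 ?(ltW b0).
  set x := dev j w - bdev j w.
  rewrite -(ler_pM2l s0) mulrDr mulVKf ?gt_eqF// -(real_normK (num_real x)).
  have := sqr_ge0 (s - `|x|); have := normr_ge0 x; have := sqr_ge0 s; have := sqr_ge0 `|x|; have := s0.
  rewrite sqrrB !expr2; nra.
Qed.

Lemma error_term_ge0 j w : 0 <= error_term j w.
Proof.
rewrite /error_term !addr_ge0//.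
- rewrite mulr_ge0// addr_ge0 ?expR_ge0// mulr_ge0 ?sqr_ge0// mulr_ge0 ?(ltW (wt_gt0 j))//.
- by rewrite mulr_ge0 ?addr_ge0 ?sqr_ge0// mulr_ge0 ?(ltW (wt_gt0 j)).
- rewrite mulr_ge0//; first by rewrite mulr_ge0 ?(ltW b0).
  by rewrite addr_ge0 ?(ltW s0)// mulr_ge0 ?sqr_ge0// invr_ge0 ltW.
Qed.

Let mdev j : measurable_fun setT (fun w => dev j w).
Proof.
under eq_fun do rewrite deviation_walk.
exact: measurable_walk steps_iid j.
Qed.

Let mbdev j : measurable_fun setT (fun w => bdev j w).
Proof. by rewrite /block_deviation; case: ltnP => _. Qed.

Let dev2 j : (\int[P]_w (dev j w ^+ 2)%:E = (kap * j%:R)%:E)%E.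
Proof.
under eq_integral do rewrite deviation_walk.
rewrite (walk_second_moment steps_iid steps_intble steps_sqr_intble steps_mean steps_variance).
by rewrite mulrC.
Qed.

Let Idev2 j : intble P (fun w => dev j w ^+ 2).
Proof.
apply: intble_ge0; [exact: measurable_funX|by move=> w; exact: sqr_ge0|].
by rewrite dev2 ltry.
Qed.

Let Etail j : (\int[P]_w (expR (tail_rate mu m2 * (j%:R * mu / 2 - walk xi j w)))%:E <= (rho ^+ j)%:E)%E.
Proof. exact: (lower_tail_moment iidxi (xi0 0) mu0 m20 I1 I2 E1 E2 j). Qed.

Let Itail j : intble P (fun w => expR (tail_rate mu m2 * (j%:R * mu / 2 - walk xi j w))).
Proof.
apply: intble_ge0; [|by move=> w; exact: expR_ge0|exact: le_lt_trans (Etail j) (ltry _)].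
apply: measurableT_comp => //; apply: measurable_funM => //; apply: measurable_funB => //.
exact: (measurable_walk iidxi j).
Qed.

Let block2 j : (\int[P]_w ((dev j w - bdev j w) ^+ 2)%:E <=
  (if (j < N * L)%N then s ^+ 2 else kap * j%:R)%:E)%E.
Proof.
rewrite /block_deviation; case: ltnP => jNL; last first.
  by under eq_integral do rewrite subr0; rewrite dev2.
under eq_integral do rewrite !deviation_walk.
rewrite {1}(divn_eq j L).
rewrite (walk_increment_second_moment steps_iid steps_intble steps_sqr_intble steps_mean steps_variance).
rewrite lee_fin mulrC (le_trans _ Ls)// ler_wpM2l ?(ltW kap0)// ler_nat ltnW// ltn_pmod//.
Qed.

Let Iblock j : intble P (fun w => (dev j w - bdev j w) ^+ 2).
Proof.
apply: intble_ge0; [|by move=> w; exact: sqr_ge0|exact: le_lt_trans (block2 j) (ltry _)].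
by apply: measurable_funX; exact: measurable_funB.
Qed.

(** Freezing costs [2 * s], one [s] from each part of [s + s^-1 * v ^+ 2]. Beyond the cut-off
    nothing is approximated, and only the decay factor [tau] offsets [s^-1]. *)
Definition error_scale := A * C1 + C3 + b * (2 * s + tau * (s + s^-1)).

Lemma error_term_expectation j : (\int[P]_w (error_term j w)%:E <=
  (error_scale * (wt j * (1 + kap * j%:R)) + A * rho ^+ j)%:E)%E.
Proof.
set y := kap * j%:R.
have y0 : 0 <= y by rewrite mulr_ge0 ?(ltW kap0).
pose f1 w := dev j w ^+ 2.
pose f2 w := expR (tail_rate mu m2 * (j%:R * mu / 2 - walk xi j w)).
pose f3 w := (dev j w - bdev j w) ^+ 2.
have If1 : intble P f1 by exact: Idev2.
have If2 : intble P f2 by exact: Itail.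
have If3 : intble P f3 by exact: Iblock.
pose c0 := C3 * wt j + b * twt j * s.
pose c1 := A * (C1 * wt j) + C3 * wt j.
pose c3 := b * twt j * s^-1.
have -> : (fun w => (error_term j w)%:E) = (fun w => (c0 + c1 * f1 w + A * f2 w + c3 * f3 w)%:E).
  by apply/funext => w; congr EFin; rewrite /error_term /c0 /c1 /c3 /f1 /f2 /f3; ring.
have J1 : intble P (fun w => c0 + c1 * f1 w) by apply: intbleD; [exact: intble_cst|exact: intbleZ].
have J2 : intble P (fun w => c0 + c1 * f1 w + A * f2 w) by apply: intbleD => //; exact: intbleZ.
have J3 : intble P (fun w => c0 + c1 * f1 w + A * f2 w + c3 * f3 w) by apply: intbleD => //; exact: intbleZ.
rewrite intbleE// RintegralD//; last exact: intbleZ.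
rewrite RintegralD//; last exact: intbleZ.
rewrite RintegralD//; last 2 first.
- exact: intble_cst.
- exact: intbleZ.
rewrite !RintegralZl// expectation_cst.
have F1 : \int[P]_w f1 w = y by rewrite /Rintegral dev2.
have F2 : \int[P]_w f2 w <= rho ^+ j by rewrite -lee_fin -intbleE//; exact: Etail.
have F3 : \int[P]_w f3 w <= if (j < N * L)%N then s ^+ 2 else y.
  by rewrite -lee_fin -intbleE//; exact: block2.
rewrite lee_fin F1.
have w0 := wt_gt0 j.
have T3 : b * twt j * s + c3 * \int[P]_w f3 w <= b * (2 * s + tau * (s + s^-1)) * (wt j * (1 + y)).
  have -> : b * twt j * s + c3 * \int[P]_w f3 w = b * (twt j * (s + s^-1 * \int[P]_w f3 w)) by rewrite /c3; ring.
  rewrite -mulrA ler_pM2l//.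
  have si0 : 0 < s^-1 by rewrite invr_gt0.
  have t0' : 0 < tau := expR_gt0 _.
  have wy : 0 <= wt j * y by rewrite mulr_ge0 ?(ltW w0).
  have ss : 0 <= s + s^-1 by rewrite addr_ge0 ?(ltW s0) ?(ltW si0).
  have w1 : 0 <= wt j * (1 + y) by rewrite mulr_ge0 ?(ltW w0) ?addr_ge0.
  move: F3; rewrite /tail_weight; case: ltnP => _ F3.
    rewrite mul1r.
    have h : s + s^-1 * \int[P]_w f3 w <= 2 * s.
      have := ler_wpM2l (ltW si0) F3; rewrite expr2 mulKf ?gt_eqF//; lra.
    apply: (@le_trans _ _ (2 * s * wt j)); first by rewrite mulrC ler_wpM2r ?(ltW w0).
    have := mulr_ge0 (mulr_ge0 (ltW t0') ss) w1.
    have : 0 <= s * (wt j * y) by rewrite mulr_ge0 ?(ltW s0).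
    lra.
  have h : s + s^-1 * \int[P]_w f3 w <= (s + s^-1) * (1 + y).
    have := ler_wpM2l (ltW si0) F3.
    have : 0 <= s * y by rewrite mulr_ge0 ?(ltW s0).
    lra.
  have := ler_wpM2l (mulr_ge0 (ltW t0') (ltW w0)) h.
  have := mulr_ge0 (ltW s0) w1.
  lra.
have T1 : A * (C1 * wt j) * y <= A * C1 * (wt j * (1 + y)).
  have : 0 <= A * C1 * wt j by rewrite mulr_ge0 ?(ltW w0)// mulr_ge0.
  lra.
have T2 := ler_wpM2l A0 F2.
by rewrite /c0 /c1 /error_scale; lra.
Qed.

(** One factor [1 + 8 / a] bounds [(1 + y) * expR (- (a / 8 * y))]; the other bounds the geometric
    sum of the remaining [kap * expR (- (a / 8 * kap * j))], where [kap <= 1] is used. *)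
Lemma weight_partial_sum n : \sum_(j < n) wt j * (1 + kap * j%:R) <= (1 + 8 / a) ^+ 2.
Proof.
have q0 : 0 < 1 + 8 / a by rewrite addr_gt0// divr_gt0.
pose z := a / 8 * kap.
have z0 : 0 < z by apply: mulr_gt0 => //; exact: divr_gt0.
pose q := expR (- z).
have q1 : q < 1 by rewrite expR_lt1 oppr_lt0.
have H j : wt j * (1 + kap * j%:R) <= (1 + 8 / a) * kap * q ^+ j.
  rewrite /weight /q -expRM_natl; set y := kap * j%:R.
  have y0 : 0 <= y by rewrite mulr_ge0 ?(ltW kap0).
  have -> : j%:R * - z = - (a / 8 * y) by rewrite /z /y; ring.
  have -> : expR (- (a / 4 * y)) = expR (- (a / 8 * y)) * expR (- (a / 8 * y)).
    by rewrite -expRD; congr expR; field.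
  have e0 := expR_gt0 (- (a / 8 * y)).
  have key : (1 + y) * expR (- (a / 8 * y)) <= 1 + 8 / a.
    rewrite expRN ler_pdivrMr ?expR_gt0//.
    have := ler_wpM2l (ltW q0) (expR_ge1Dx (a / 8 * y)).
    have -> : (1 + 8 / a) * (1 + a / 8 * y) = 1 + 8 / a + a / 8 * y + y by field; rewrite gt_eqF.
    have : 0 <= 8 / a by rewrite divr_ge0// ltW.
    have : 0 <= a / 8 * y by rewrite mulr_ge0// divr_ge0// ltW.
    lra.
  have := ler_wpM2l (mulr_ge0 (ltW kap0) (ltW e0)) key; lra.
apply: (le_trans (ler_sum _ (fun (j : 'I_n) _ => H j))).
rewrite -mulr_sumr expr2 -mulrA ler_pM2l//.
have p1 : 0 < 1 - q by lra.
apply: (@le_trans _ _ (kap * (1 - q)^-1)).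
  by rewrite ler_pM2l// geometric_partial_sum// expR_ge0.
rewrite ler_pdivrMr//.
have h : q <= (1 + z)^-1 by rewrite /q expRN lef_pV2 ?posrE ?expR_gt0 ?addr_gt0// expR_ge1Dx.
have zz : z * (8 / a) = kap by rewrite /z; field; rewrite gt_eqF.
have p2 : 0 < 1 + z by lra.
have h2 : z / (1 + z) <= 1 - q.
  have : z / (1 + z) = 1 - (1 + z)^-1 by field; rewrite gt_eqF.
  lra.
apply: le_trans (ler_wpM2l (ltW q0) h2).
rewrite mulrA ler_pdivlMr// mulrDl mul1r (mulrC (8 / a)) zz.
have : kap * z <= z by rewrite ler_piMl// ltW.
lra.
Qed.

(** Summing over all [j] frees the bound from [u] and from the number of terms kept. It is
    extended-real because finiteness will hold only almost surely. *)
Definition random_bound w : \bar R := (A%:E + \sum_(0 <= j <oo) (error_term j w)%:E)%E.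

Lemma measurable_error_term j : measurable_fun setT (error_term j).
Proof.
apply: measurable_funD; first apply: measurable_funD.
- apply: measurable_funM => //; apply: measurable_funD.
    by apply: measurable_funM => //; exact: measurable_funX.
  exact: intble_measurable (Itail j).
- apply: measurable_funM => //; apply: measurable_funD => //; exact: measurable_funX.
- apply: measurable_funM => //; apply: measurable_funD => //; apply: measurable_funM => //.
  exact: intble_measurable (Iblock j).
Qed.

Lemma random_bound_ge0 w : (0 <= random_bound w)%E.
Proof.
apply: adde_ge0; first by rewrite lee_fin.
by apply: nneseries_ge0 => j _ _; rewrite lee_fin error_term_ge0.
Qed.

Lemma measurable_random_bound : measurable_fun setT random_bound.
Proof.
apply: emeasurable_funD; first exact: measurable_cst.
apply: ge0_emeasurable_sum => [j w _ _|j _]; first by rewrite lee_fin error_term_ge0.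
by apply/measurable_EFinP; exact: measurable_error_term.
Qed.

Lemma random_bound_expectation : (\int[P]_w random_bound w <=
  (A + (error_scale * (1 + 8 / a) ^+ 2 + A * (1 - rho)^-1))%:E)%E.
Proof.
rewrite ge0_integralD//; last 2 first.
- by move=> w _; apply: nneseries_ge0 => j _ _; rewrite lee_fin error_term_ge0.
- apply: ge0_emeasurable_sum => [j w _ _|j _]; first by rewrite lee_fin error_term_ge0.
  by apply/measurable_EFinP; exact: measurable_error_term.
rewrite integral_cst// EFinD; apply: leeD.
  have -> : (P : {measure set T -> \bar R}) setT = 1%E by exact: probability_setT.
  by rewrite mule1.
rewrite integral_nneseries//; last 2 first.
- by move=> j; apply/measurable_EFinP; exact: measurable_error_term.
- by move=> j w _; rewrite lee_fin error_term_ge0.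
apply: nneseries_le_partial => [j|n].
  by apply: integral_ge0 => w _; rewrite lee_fin error_term_ge0.
apply: le_trans (lee_sum _ (fun j _ => error_term_expectation j)) _.
rewrite sumEFin lee_fin big_mkord big_split/= -!mulr_sumr lerD//.
- apply: ler_wpM2l; last exact: weight_partial_sum.
  apply: addr_ge0; first by apply: addr_ge0 => //; exact: mulr_ge0.
  apply: mulr_ge0; first exact: ltW.
  apply: addr_ge0; first by apply: mulr_ge0 => //; exact: ltW.
  apply: mulr_ge0; first exact: expR_ge0.
  by apply: addr_ge0; [exact: ltW|rewrite invr_ge0 ltW].
- rewrite ler_wpM2l// geometric_partial_sum ?expR_ge0//.
  rewrite expR_lt1 oppr_lt0 divr_gt0 ?exprn_gt0// mulr_gt0//.
Qed.

End random_bound.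

(** * The normalised process near its discretisation *)

Section pathwise_bound.
Context d (T : measurableType d) (R : realType).
Variables (k : R -> R) (xi : nat -> T -> R) (mu sigma t : R).
Hypotheses (mu0 : 0 < mu) (sigma0 : 0 < sigma) (t0 : 0 < t) (k1 : 1 <= k t).

Local Notation pos x := (Num.max x 0).

(** The ratio between the normalisation with the integer part of [k t] and the one with [k t]
    itself. *)
Definition floor_ratio := Num.sqrt ((Num.truncn (k t))%:R / k t).

Let k0 : 0 < k t. Proof. exact: lt_le_trans ltr01 k1. Qed.

Lemma floor_ratio_ge0 : 0 <= floor_ratio. Proof. exact: sqrtr_ge0. Qed.

Let fl0 : (Num.truncn (k t))%:R <= k t. Proof. by rewrite truncn_le// ltW. Qed.

Lemma floor_ratio_le1 : floor_ratio <= 1.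
Proof. by rewrite -[leRHS]sqrtr1 ler_wsqrtr// ler_pdivrMr// mul1r. Qed.

Lemma floor_ratio_near1 : 1 - (k t)^-1 <= floor_ratio.
Proof.
have q0 : 0 <= (Num.truncn (k t))%:R / k t by rewrite divr_ge0// ltW.
have q1 : (Num.truncn (k t))%:R / k t <= 1 by rewrite ler_pdivrMr// mul1r.
have h : 1 - (k t)^-1 <= (Num.truncn (k t))%:R / k t.
  rewrite ler_pdivlMr// mulrBl mul1r mulVf ?gt_eqF//.
  by have := truncnS_gt (k t); rewrite -natr1 => /ltW; rewrite lerBlDr.
apply: (le_trans h); rewrite /floor_ratio; set q := _ / _ in q0 q1 *.
rewrite -{1}(sqr_sqrtr q0) expr2 ler_piMr ?sqrtr_ge0//.
exact: floor_ratio_le1.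
Qed.

Lemma floor_ratio_gt0 : 0 < floor_ratio.
Proof.
rewrite sqrtr_gt0 divr_gt0// ltr0n truncn_gt0//.
Qed.

Let SpartE j w : Spart xi j w = walk xi j.+1 w. Proof. by []. Qed.

Let term_eq n j w : (if Spart xi j w <= t then (t - Spart xi j w) ^+ n.+1 else 0) =
  t ^+ n.+1 * pos (1 - walk xi j.+1 w / t) ^+ n.+1.
Proof.
rewrite SpartE -exprMn.
have -> : t * pos (1 - walk xi j.+1 w / t) = pos (t - walk xi j.+1 w).
  rewrite maxr_pMr ?(ltW t0)// mulr0 mulrBr mulr1; congr (Num.max _ _).
  by field; rewrite gt_eqF.
case: ifPn => h; first by rewrite (max_idPl _)// subr_ge0.
by rewrite (max_idPr _) ?expr0n// subr_le0 ltW// ltNge.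
Qed.

(** The factorials and the powers of [t] and [mu] collapse into [amplitude]. Writing [[k(t) u] =
    n.+3] makes the exponent [n.+2], as the second-order Taylor formula wants. *)
Lemma Xproc_series n w u : 0 < u -> Num.truncn (k t * u) = n.+3 ->
  (\sum_(0 <= j <oo) (pos (1 - walk xi j.+1 w / t) ^+ n.+2)%:E < +oo)%E ->
  Xproc k xi mu (sigma ^+ 2) t w u =
  amplitude (k t) t mu sigma floor_ratio *
   (fine (\sum_(0 <= j <oo) (pos (1 - walk xi j.+1 w / t) ^+ n.+2)%:E)%E - t / (n.+3%:R * mu)).
Proof.
move=> u0 mE fin; rewrite /Xproc mE u0/=.
have -> : renewal_sum xi t n.+3 w =
    t ^+ n.+2 * fine (\sum_(0 <= j <oo) (pos (1 - walk xi j.+1 w / t) ^+ n.+2)%:E)%E.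
  rewrite /renewal_sum.
  under eq_eseriesr do rewrite term_eq EFinM.
  rewrite nneseriesZl; last by move=> j _; rewrite lee_fin exprn_ge0// pos_ge0.
  rewrite fineM// ge0_fin_numE//.
  by apply: nneseries_ge0 => j _ _; rewrite lee_fin exprn_ge0// pos_ge0.
set Z := fine _.
have sq : Num.sqrt (sigma ^+ 2 * mu ^- (2 * n.+3).+1 * t ^+ (2 * n.+3).-1) =
    sigma * t ^+ n.+2 / mu ^+ n.+3 * Num.sqrt (t / mu).
  have -> : sigma ^+ 2 * mu ^- (2 * n.+3).+1 * t ^+ (2 * n.+3).-1 =
     (sigma * t ^+ n.+2 / mu ^+ n.+3) ^+ 2 * (t / mu).
    have -> : (2 * n.+3).-1 = (n.+2 * 2).+1 by rewrite mulnC !mulSn.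
    have -> : (2 * n.+3).+1 = (n.+3 * 2).+1 by rewrite mulnC.
    have -> : mu ^+ (n.+3 * 2).+1 = (mu ^+ n.+3) ^+ 2 * mu by rewrite exprSr exprM.
    have -> : t ^+ (n.+2 * 2).+1 = (t ^+ n.+2) ^+ 2 * t by rewrite exprSr exprM.
    have : mu ^+ n.+3 != 0 by rewrite expf_neq0// gt_eqF.
    move: (mu ^+ n.+3) (t ^+ n.+2) => p q p0.
    by field; rewrite p0 gt_eqF.
  rewrite sqrtrM ?sqr_ge0// sqrtr_sqr gtr0_norm//.
  exact: divr_gt0 (mulr_gt0 sigma0 (exprn_gt0 _ t0)) (exprn_gt0 _ mu0).
rewrite sq /amplitude /floor_ratio /mesh.
have tm0 : 0 < t / mu by rewrite divr_gt0.
have st0 : 0 < Num.sqrt (t / mu) by rewrite sqrtr_gt0.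
have sk0 : 0 < Num.sqrt (k t) by rewrite sqrtr_gt0.
have -> : k t * mu / t = k t * (t / mu)^-1 by rewrite invf_div mulrA.
have -> : Num.sqrt (k t * (t / mu)^-1) = Num.sqrt (k t) / Num.sqrt (t / mu).
  by rewrite sqrtrM ?sqrtrV// ltW.
have -> : Num.sqrt ((Num.truncn (k t))%:R / k t) = Num.sqrt (Num.truncn (k t))%:R / Num.sqrt (k t).
  by rewrite sqrtrM ?sqrtrV// ltW.
have f0 : (n.+2)`!%:R != 0 :> R by rewrite pnatr_eq0 -lt0n fact_gt0.
have -> : (n.+3)`!%:R = n.+3%:R * (n.+2)`!%:R :> R by rewrite factS natrM.
have n30 : n.+3%:R != 0 :> R by rewrite pnatr_eq0.
rewrite /= (exprS t n.+2) (exprS mu n.+2).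
have : t ^+ n.+2 != 0 by rewrite expf_neq0// gt_eqF.
have : mu ^+ n.+2 != 0 by rewrite expf_neq0// gt_eqF.
move: (mu ^+ n.+2) (t ^+ n.+2) => p q p0 q0.
move: (n.+2)`!%:R n.+3%:R f0 n30 => F M F0 M0.
move: st0 sk0; move: (Num.sqrt (t / mu)) (Num.sqrt (k t)) (Num.sqrt _) => x y z x0 y0.
by field; rewrite p0 q0 F0 M0 !gt_eqF.
Qed.

Variables (a b m2 s : R) (N L : nat).
Hypotheses (a0 : 0 < a) (ab : a <= b) (ak : 8 <= a * k t).
Hypotheses (m20 : 0 < m2) (s0 : 0 < s) (L0 : (0 < L)%N).

(** For every large number [J] of terms the errors of [path_bound] stay below the full series
    [random_bound], so [affine_series_bound] reaches the infinite sum. *)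
Lemma Xproc_bound w u : (forall i, 0 < xi i w) ->
  (random_bound xi mu sigma m2 (k t) t a b floor_ratio s N L w < +oo)%E ->
  a <= u -> u <= b ->
  `|Xproc k xi mu (sigma ^+ 2) t w u -
    \sum_(j < N * L) step_kernel (k t) t mu u j *
      deviation (k t) t mu sigma (walk xi ^~ w) ((j %/ L) * L)|
  <= fine (random_bound xi mu sigma m2 (k t) t a b floor_ratio s N L w).
Proof.
move=> xi0 fin au ub.
have u0 : 0 < u := lt_le_trans a0 au.
have ku : 8 <= k t * u by rewrite (le_trans ak)// mulrC ler_wpM2l// ltW.
have ku0 : 0 <= k t * u by rewrite (le_trans _ ku).
have t1 := truncnS_gt (k t * u).
have t2 : (Num.truncn (k t * u))%:R <= k t * u by rewrite truncn_le.
have : (3 <= Num.truncn (k t * u))%N.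
  by rewrite -ltnS -(ltr_nat R); apply: le_lt_trans t1; apply: le_trans ku; rewrite ler_nat.
case E : (Num.truncn (k t * u)) => [|[|[|n]]]// _; rewrite E in t1 t2.
have e4 : n.+4%:R = n.+2%:R + 2 :> R by rewrite -(natrD _ n.+2 2) addn2.
have e3 : n.+3%:R = n.+2%:R + 1 :> R by rewrite -(natrD _ n.+2 1) addn1.
have n1 : k t * u - 2 <= n.+2%:R by move: t1; rewrite e4; lra.
have n2 : n.+2%:R <= k t * u by move: t2; rewrite e3; lra.
have S0 j : 0 <= walk xi j w by apply: sumr_ge0 => i _; exact: ltW.
have S00 : walk xi 0 w = 0 by rewrite /walk big_ord0.
set A := amplitude (k t) t mu sigma floor_ratio.
have A0 : 0 < A.
  rewrite /A /amplitude divr_gt0// mulr_gt0// mulr_gt0 ?floor_ratio_gt0//.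
  by rewrite sqrtr_gt0; exact: mesh_gt0.
(* From [J0] on all blocks are covered and [J.+1%:R * mu] exceeds [t], so the Riemann sum sees the
   whole interval. *)
pose J0 := maxn (N * L) (Num.truncn (t / mu)).+1.
pose psi := \sum_(j < N * L) step_kernel (k t) t mu u j *
      deviation (k t) t mu sigma (walk xi ^~ w) ((j %/ L) * L).
have e0 j : 0 <= error_term xi mu sigma m2 (k t) t a b floor_ratio s N L j w.
  exact: (error_term_ge0 xi m2 mu0 sigma0 N L k1 t0 a0 ab floor_ratio_ge0 s0).
have H J : (J0 <= J)%N ->
   `|A * (\sum_(j < J) pos (1 - walk xi j.+1 w / t) ^+ n.+2 - t / (n.+3%:R * mu)) - psi|
    <= fine (random_bound xi mu sigma m2 (k t) t a b floor_ratio s N L w).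
  move=> J0J.
  have NLJ : (N * L <= J.+1)%N by rewrite (leq_trans _ (leqnSn _))// (leq_trans _ J0J)// leq_maxl.
  have tJ : t <= J.+1%:R * mu.
    rewrite -ler_pdivrMr// ltW// (lt_le_trans (truncnS_gt _))// ler_nat.
    by rewrite (leq_trans _ (leqnSn _))// (leq_trans _ J0J)// leq_maxr.
  have := @path_bound R (k t) t mu sigma a b floor_ratio N L k1 t0 mu0 sigma0 a0 ab ak
    floor_ratio_ge0 floor_ratio_le1 floor_ratio_near1 (walk xi ^~ w) S0 S00 u n au ub n1 n2 J NLJ tJ.
  move=> /le_trans; apply.
  rewrite -lee_fin fineK; last first.
    rewrite ge0_fin_numE//.
    exact: (random_bound_ge0 xi m2 mu0 sigma0 N L k1 t0 a0 ab floor_ratio_ge0 s0).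
  rewrite /random_bound EFinD leeD2l//.
  apply: (@le_trans _ _ (\sum_(0 <= j < J.+1) (error_term xi mu sigma m2 (k t) t a b floor_ratio s N L j w)%:E)%E).
    rewrite sumEFin lee_fin big_mkord; apply: ler_sum => j _.
    exact: (path_error_le xi mu0 sigma0 m20 N L k1 t0 a0 ab floor_ratio_ge0 s0).
  by apply: partial_le_nneseries => j; rewrite lee_fin.
have x0 j : 0 <= pos (1 - walk xi j.+1 w / t) ^+ n.+2 by rewrite exprn_ge0// pos_ge0.
have [F1 F2] := affine_series_bound x0 A0 H.
by rewrite (Xproc_series u0 E F1).
Qed.

End pathwise_bound.

(** * Smallness of the Taylor remainders *)

Section taylor_rest_smallness.
Context d (T : measurableType d) (R : realType) (P : probability T R).
Implicit Types (Z eta : T -> R).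

Lemma taylor_rest_intble Z : intble P (fun w => Z w ^+ 2) -> measurable_fun setT Z ->
  intble P (fun w => taylor_rest (Z w)).
Proof.
move=> I2 mZ; apply: (intble_le _ _ I2) => [|w].
  by apply: measurableT_comp => //; exact: measurable_taylor_rest.
by rewrite ger0_norm ?taylor_rest_ge0// taylor_rest_le_sqr.
Qed.

(** Lindeberg's condition for identically distributed steps: divided by [kap], the integrand is at
    most [eta ^+ 2 * min(1, |eta| / n.+1)] once [sqrt kap <= 1 / n.+1], and dominated convergence
    with bound [eta ^+ 2] applies. *)
Lemma taylor_rest_scaled_small eta (e : R) : measurable_fun setT eta ->
  intble P (fun w => eta w ^+ 2) -> 0 < e ->
  exists2 k0 : R, 0 < k0 & forall kap, 0 < kap -> kap <= k0 ->
    \int[P]_w taylor_rest (Num.sqrt kap * eta w) <= kap * e.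
Proof.
move=> meta I2 e0.
pose h n w : R := eta w ^+ 2 * Num.min 1 (`|eta w| / n.+1%:R).
have mh n : measurable_fun setT (h n).
  apply: measurable_funM; first exact: measurable_funX.
  apply: measurable_minr => //; apply: measurable_funM => //.
  exact: measurableT_comp.
have hle n w : `|h n w| <= eta w ^+ 2.
  rewrite ger0_norm ?ler_piMr ?sqr_ge0 ?ge_min ?lexx//.
  by rewrite mulr_ge0 ?sqr_ge0// le_min ler01 divr_ge0.
have Ih n : intble P (h n) := intble_le (mh n) (hle n) I2.
have hcvg : (\int[P]_w (h n w)%:E @[n --> \oo] --> \int[P]_w (cst 0 w))%E.
  have := @dominated_convergence _ _ _ P setT measurableT (fun n => EFin \o h n) (cst 0%E)
     (fun w => (eta w ^+ 2)%:E).
  case.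
  - by move=> n; exact/measurable_EFinP.
  - exact: measurable_cst.
  - apply: aeW => w _; apply: cvg_EFin; first exact: nearW.
    apply/cvgrPdist_le => c c0; near=> n.
    rewrite /= sub0r normrN.
    have p0 : 0 <= eta w ^+ 2 * `|eta w| by rewrite mulr_ge0 ?sqr_ge0.
    apply: (@le_trans _ _ (eta w ^+ 2 * `|eta w| / n.+1%:R)).
      rewrite ger0_norm; last by rewrite mulr_ge0 ?sqr_ge0// le_min ler01 divr_ge0.
      by rewrite -mulrA ler_wpM2l ?sqr_ge0// ge_min lexx orbT.
    rewrite ler_pdivrMr// -ler_pdivrMl//.
    near: n; exists (Num.truncn (c^-1 * (eta w ^+ 2 * `|eta w|))) => // n /= hn.
    by rewrite (le_trans (ltW (truncnS_gt _)))// ler_nat ltnS.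
  - exact: I2.
  - by apply: aeW => w n _ /=; rewrite lee_fin hle.
  move=> _ _; exact.
rewrite integral0 in hcvg.
have /fine_cvgP[_ /cvgrPdist_le/(_ _ e0)[n _ hn]] := hcvg.
have := hn n (leqnn n); rewrite /= sub0r normrN => Hn.
have {Hn}Hn : \int[P]_w h n w <= e by apply: le_trans Hn; exact: ler_norm.
exists (n.+1%:R ^- 2); first by rewrite invr_gt0 exprn_gt0.
move=> kap kap0 kapn.
have sk : Num.sqrt kap <= n.+1%:R^-1.
  rewrite -(@ler_sqr _ _ _) ?nnegrE ?sqrtr_ge0 ?invr_ge0// sqr_sqrtr ?(ltW kap0)//.
  by rewrite exprVn.
apply: (@le_trans _ _ (kap * \int[P]_w h n w)); last by rewrite ler_pM2l.
have -> : kap * \int[P]_w h n w = \int[P]_w (kap * h n w).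
  by rewrite RintegralZl//; exact: Ih.
apply: intble_le_expectation.
- apply: taylor_rest_intble; last exact: measurable_funM.
  by under eq_fun do rewrite exprMn; exact: intbleZ.
- exact: intbleZ.
move=> w; rewrite /taylor_rest exprMn sqr_sqrtr ?(ltW kap0)// -mulrA ler_pM2l//.
rewrite ler_wpM2l ?sqr_ge0// le_min ge_min lexx/= ge_min; apply/orP; right.
rewrite normrM ger0_norm ?sqrtr_ge0// mulrC.
by rewrite ler_wpM2l.
Unshelve. all: by end_near. Qed.

(** [z ^+ 3 <= s * z ^+ 2 + s^-1 * z ^+ 4] for [z = |Z|] reduces to the second and fourth moments,
    and [121 = 1 + 120]. *)
Lemma taylor_rest_gauss Z (s : R) : 0 < s -> measurable_fun setT Z ->
  (forall A : set R, measurable A -> P (Z @^-1` A) = normal_prob 0 s A) ->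
  \int[P]_w taylor_rest (Z w) <= 121 * s ^+ 3.
Proof.
move=> s0 mZ lZ.
have I2 := gauss_pow_intble s0 mZ lZ 1; have I4 := gauss_pow_intble s0 mZ lZ 3.
have V := gauss_variance s0 mZ lZ; have M4 := gauss_fourth_moment s0 mZ lZ.
apply: (@le_trans _ _ (\int[P]_w (s * Z w ^+ 2 + s^-1 * Z w ^+ 4))).
  apply: intble_le_expectation.
  - exact: taylor_rest_intble.
  - by apply: intbleD; exact: intbleZ.
  move=> w; apply: (le_trans (le_taylor_rest_cube _)).
  have -> : Z w ^+ 4 = `|Z w| ^+ 2 * `|Z w| ^+ 2.
    by rewrite -exprD -normrX ger0_norm// exprn_even_ge0.
  rewrite -(real_normK (num_real (Z w))).
  set z := `|Z w|.
  have z0 : 0 <= z := normr_ge0 _.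
  have -> : s * z ^+ 2 + s^-1 * (z ^+ 2 * z ^+ 2) = z ^+ 2 * (s + s^-1 * z ^+ 2) by ring.
  rewrite ler_wpM2l ?sqr_ge0//.
  rewrite -(ler_pM2l s0) mulrDr mulVKf ?gt_eqF//.
  by have := sqr_ge0 (s - z); have := sqr_ge0 s; have := sqr_ge0 z; rewrite sqrrB !expr2; nra.
rewrite RintegralD//; last 2 first.
- exact: intbleZ.
- exact: intbleZ.
rewrite !RintegralZl// V.
have si0 : 0 <= s^-1 by rewrite invr_ge0 ltW.
have := ler_wpM2l si0 M4.
rewrite (_ : s^-1 * (120 * s ^+ 4) = 120 * s ^+ 3); last by field; rewrite gt_eqF.
rewrite (_ : s * s ^+ 2 = s ^+ 3); last by rewrite exprS.
lra.
Qed.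

End taylor_rest_smallness.

(** * Block sums recover the walk at block ends *)

Section block_partial_sums.
Context d (T : measurableType d) (R : realType).
Implicit Types (X : nat -> T -> R).

(** After exchanging the sums, each [r < i * L] is counted in exactly one block below [i], and each
    later [r] in none. *)
Lemma sum_block_sums X (N L i : nat) w : (0 < L)%N -> (i <= N)%N ->
  \sum_(j < i) block_sums X L (N * L) j w = walk X (i * L) w.
Proof.
move=> L0 iN; rewrite /block_sums /walk.
under eq_bigr => j _ do rewrite -(big_mkord (fun r => (r %/ L)%N == j) (fun r => X r w)).
rewrite -(big_mkord xpredT (fun j => \sum_(0 <= r < N * L | (r %/ L)%N == j) X r w)).
rewrite (exchange_big_dep_nat xpredT)//=.
rewrite -(big_mkord xpredT (fun r => X r w)).
have iLN : (i * L <= N * L)%N by rewrite leq_mul2r iN orbT.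
rewrite [LHS](big_cat_nat _ iLN)//= [X in _ + X]big_nat [X in _ + X]big1 ?addr0; last first.
  move=> r /andP[ir _]; rewrite big_nat_cond big1// => j /andP[/andP[_ ji] /eqP rj].
  by move: ji; rewrite -rj ltnNge leq_divRL// ir.
rewrite !big_nat; apply: eq_bigr => r /andP[_ ri].
have rLi : (r %/ L < i)%N by rewrite ltn_divLR.
rewrite (big_rem (r %/ L)%N) ?mem_index_iota//= eqxx big_seq_cond big1 ?addr0// => j.
by rewrite mem_rem_uniq ?iota_uniq// inE => /andP[/andP[h _] /eqP/esym e]; move: h; rewrite e eqxx.
Qed.

End block_partial_sums.

(** * Brownian increments over the mesh *)

Section brownian_increments.
Context d (T : measurableType d) (R : realType) (Q : probability T R).
Variable B : R -> T -> R.
Hypothesis BM : standard_BM Q B.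

Let mB v : measurable_fun setT (B v). Proof. by case: BM. Qed.

Lemma BM_law (y z : R) (A : set R) : 0 <= z -> z < y -> measurable A ->
  Q ((fun w => B y w - B z w) @^-1` A) = normal_prob 0 (Num.sqrt (y - z)) A.
Proof. by move=> z0 zy mA; case: BM => _ [_ [_ [_]]]; apply. Qed.

Lemma BM_second_moment (y z : R) : 0 <= z -> z <= y ->
  (\int[Q]_w ((B y w - B z w) ^+ 2)%:E = (y - z)%:E)%E.
Proof.
move=> z0; rewrite le_eqVlt => /predU1P[->|zy].
  by under eq_integral do rewrite subrr expr0n/=; rewrite integral0 subrr.
have s0 : 0 < Num.sqrt (y - z) by rewrite sqrtr_gt0 subr_gt0.
have mZ : measurable_fun setT (fun w => B y w - B z w) by exact: measurable_funB.
have law A : measurable A -> Q ((fun w => B y w - B z w) @^-1` A) =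
    normal_prob 0 (Num.sqrt (y - z)) A by exact: BM_law.
rewrite intbleE; last exact: (gauss_pow_intble s0 mZ law 1).
by rewrite (gauss_variance s0 mZ law) sqr_sqrtr// subr_ge0 ltW.
Qed.

Variable kap : R.
Hypothesis kap0 : 0 < kap.

Definition BM_steps i w := B (kap * i.+1%:R) w - B (kap * i%:R) w.

Lemma BM_steps_law i (A : set R) : measurable A ->
  Q (BM_steps i @^-1` A) = normal_prob 0 (Num.sqrt kap) A.
Proof.
move=> mA; have E : kap * i.+1%:R - kap * i%:R = kap.
  by rewrite -mulrBr -natr1 addrAC subrr add0r mulr1.
rewrite -[X in Num.sqrt X]E; apply: BM_law mA.
  by apply: mulr_ge0; first exact: ltW.
by rewrite ltr_pM2l// ltr_nat.
Qed.

Lemma measurable_BM_steps i : measurable_fun setT (BM_steps i).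
Proof. exact: measurable_funB. Qed.

Lemma BM_steps_iid : iid Q BM_steps.
Proof.
split; [exact: measurable_BM_steps|split; last first].
  by move=> i A mA; rewrite !BM_steps_law.
move=> n J A uJ aJ mA.
(* [n.+1] grid points carry [n] increments, the range over which independence is asked. *)
pose ts := mkseq (fun i => kap * i%:R) n.+1.
have tsE i : (i <= n)%N -> nth 0 ts i = kap * i%:R by move=> ni; rewrite nth_mkseq.
have h0 : 0 <= head 0 ts by rewrite /= mulr0.
have sts : sorted <%R ts.
  apply: homo_sorted (iota_ltn_sorted 0 n.+1) => i j /= ij.
  by rewrite ltr_pM2l// ltr_nat.
have [_ [_ [_ [/(_ ts h0 sts) ind _]]]] := BM.
rewrite size_mkseq /= in ind.
have E i : i \in J -> (fun w => B (nth 0 ts i.+1) w - B (nth 0 ts i) w) = BM_steps i.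
  by move=> /(allP aJ) iltn; rewrite /BM_steps !tsE ?(ltnW iltn)//.
have := ind J A uJ aJ mA.
under eq_bigcapr => i /= iJ do rewrite (E i iJ).
by move=> ->; apply: eq_big_seq => i iJ; rewrite (E i iJ).
Qed.

Lemma walk_BM_steps n w : walk BM_steps n w = B (kap * n%:R) w.
Proof.
have [_ [B0 _]] := BM.
elim: n => [|n IH]; first by rewrite /walk big_ord0 mulr0 B0.
by rewrite walkS IH /BM_steps addrC subrK.
Qed.

End brownian_increments.

(** * Comparison of the two laws of the block sums *)

Section law_comparison.
Context d (T : measurableType d) d' (T' : measurableType d') (R : realType).
Variables (P : probability T R) (Q : probability T' R).
Variables (xi : nat -> T -> R) (B : R -> T' -> R) (mu sigma m2 : R).
Hypothesis iidxi : iid P xi.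
Hypotheses (sigma0 : 0 < sigma) (mu0 : 0 < mu).
Hypotheses (I1 : intble P (xi 0%N)) (I2 : intble P (fun w => xi 0%N w ^+ 2)).
Hypotheses (E1 : \int[P]_w xi 0%N w = mu) (E2 : \int[P]_w (xi 0%N w ^+ 2) = m2).
Hypothesis var : m2 = sigma ^+ 2 + mu ^+ 2.
Hypothesis BM : standard_BM Q B.

Let mxi i : measurable_fun setT (xi i). Proof. by case: iidxi. Qed.

Let eta w := - (xi 0%N w - mu) / sigma.

Let eta2 : intble P (fun w => eta w ^+ 2).
Proof.
have -> : (fun w => eta w ^+ 2) = (fun w => sigma ^- 2 * (xi 0%N w ^+ 2 - (2 * mu) * xi 0%N w + mu ^+ 2)).
  by apply/funext => w; rewrite /eta exprMn sqrrN exprVn mulrC; congr (_ * _); ring.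
apply: intbleZ; apply: intbleD; last exact: intble_cst.
by apply: intbleB => //; exact: intbleZ.
Qed.

Let meta : measurable_fun setT eta.
Proof.
apply: measurable_funM => //; apply: measurableT_comp => //.
exact: measurable_funB.
Qed.

(** The smoothing width [e1] is fixed first, then the tolerance [e2] per unit of variance, then [k0]
    from Lindeberg's condition. The [L] steps of a block cost a multiple of [kap * L * e2], and
    [kap * L <= delta] makes the result uniform in [t], [L] and [Phi]. *)
Lemma law_comparison (N : nat) (K delta e : R) : 0 < K -> 0 < delta -> 0 < e ->
  exists2 k0 : R, 0 < k0 & forall (k t : R) (L : nat), 1 <= k -> 0 < t ->
    mesh k t mu <= k0 -> (0 < L)%N -> mesh k t mu * L%:R <= delta ->
    forall Phi, lipschitz_in N K Phi ->
    `|\int[P]_w Phi (block_sums (steps xi mu sigma k t) L (N * L) ^~ w)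
      - \int[Q]_w Phi (block_sums (BM_steps B (mesh k t mu)) L (N * L) ^~ w)| <= e.
Proof.
move=> K0 delta0 e0.
pose M1 := N%:R * (4 * K).
have M10 : 0 <= M1 by rewrite mulr_ge0// mulr_ge0// ltW.
pose e1 := Num.min 1 (e / (2 * (M1 + 1))).
have p1 : 0 < M1 + 1 by rewrite ltr_wpDl.
have e10 : 0 < e1 by rewrite lt_min ltr01 divr_gt0// mulr_gt0.
have e11 : e1 <= 1 by rewrite ge_min lexx.
have M1e : M1 * e1 <= e / 2.
  apply: (@le_trans _ _ ((M1 + 1) * (e / (2 * (M1 + 1))))).
    by apply: ler_pM => //; rewrite ?(ltW e10)// ?lerDl// ge_min lexx orbT.
  by rewrite le_eqVlt; apply/orP; left; apply/eqP; field; rewrite gt_eqF.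
pose M2 := M1 / e1 ^+ 2 * delta.
have M20 : 0 <= M2 by rewrite mulr_ge0 ?(ltW delta0)// divr_ge0// exprn_ge0// ltW.
pose e2 := e / (4 * (M2 + 1)).
have p2 : 0 < M2 + 1 by rewrite ltr_wpDl.
have e20 : 0 < e2 by rewrite divr_gt0// mulr_gt0.
have M2e : M2 * (2 * e2) <= e / 2.
  apply: (@le_trans _ _ ((M2 + 1) * (2 * e2))).
    by rewrite ler_wpM2r ?lerDl// mulr_ge0// ltW.
  by rewrite le_eqVlt; apply/orP; left; apply/eqP; rewrite /e2; field; rewrite gt_eqF.
have [k0 k00 Hk0] := taylor_rest_scaled_small meta eta2 e20.
(* The second bound serves the Gaussian steps: [121 * sqrt kap <= e2] in [taylor_rest_gauss]. *)
exists (Num.min k0 ((e2 / 121) ^+ 2)); first by rewrite lt_min k00 exprn_gt0// divr_gt0.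
move=> k t L k1 t0; rewrite le_min => /andP[kk1 kk2] L0 Ld Phi lP.
have kap0 : 0 < mesh k t mu by exact: mesh_gt0.
set kap := mesh k t mu in kk1 kk2 Ld kap0 *.
have iX := steps_iid mu sigma iidxi k t.
have iY := BM_steps_iid BM kap0.
have s0 : 0 < Num.sqrt kap by rewrite sqrtr_gt0.
have mY := measurable_BM_steps BM kap 0.
have lY A : measurable A -> Q (BM_steps B kap 0 @^-1` A) = normal_prob 0 (Num.sqrt kap) A
  by exact: BM_steps_law.
have mX : measurable_fun setT (steps xi mu sigma k t 0) by case: iX.
have X1 := steps_intble mu sigma I1 k t.
have X2 := steps_sqr_intble sigma mu0 I1 I2 k1 t0.
have EX := steps_mean sigma I1 E1 k t.
have EX2 := steps_variance mu0 sigma0 I1 I2 E1 E2 var k1 t0.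
have Y1 := gauss_intble s0 mY lY.
have Y2 := gauss_pow_intble s0 mY lY 1.
have EY := gauss_mean s0 mY lY.
have EY2 := gauss_variance s0 mY lY.
rewrite sqr_sqrtr ?(ltW kap0)// in EY2.
have gX : \int[P]_w taylor_rest (steps xi mu sigma k t 0 w) <= kap * e2.
  have -> : \int[P]_w taylor_rest (steps xi mu sigma k t 0 w) =
      \int[P]_w taylor_rest (Num.sqrt kap * eta w).
    apply: eq_Rintegral => w _; congr taylor_rest.
    by rewrite /steps /scaled_step /eta; ring.
  exact: Hk0.
have gY : \int[Q]_w taylor_rest (BM_steps B kap 0 w) <= kap * e2.
  apply: (le_trans (taylor_rest_gauss s0 mY lY)).
  have sk : Num.sqrt kap <= e2 / 121.
    have e21 : 0 <= e2 / 121 by apply: divr_ge0 => //; exact: ltW.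
    by rewrite -[leRHS](ger0_norm e21) -sqrtr_sqr ler_wsqrtr.
  rewrite exprSr sqr_sqrtr ?(ltW kap0)// mulrCA ler_pM2l//.
  by rewrite mulrC -ler_pdivlMr.
have close h : (forall x, `|h x| <= K) -> (forall x y, `|h x - h y| <= K * `|x - y|) ->
    forall x, `|iter L (average P (steps xi mu sigma k t 0)) h x -
      iter L (average Q (BM_steps B kap 0)) h x| <=
      4 * K * e1 + L%:R * (4 * K / e1 ^+ 2 * (kap * (2 * e2))).
  move=> hK hL x.
  have := lindeberg_lipschitz mX mY X1 X2 Y1 Y2 EX EX2 EY EY2 L e10 e11 (ltW K0) hK hL x.
  move=> /le_trans; apply; rewrite lerD2l ler_wpM2l// ler_wpM2l//.
    by rewrite divr_ge0 ?exprn_ge0 ?(ltW e10)// mulr_ge0// ltW.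
  rewrite /lindeberg_gap; lra.
have := block_comparison iX iY L0 close N lP.
move=> /le_trans; apply.
have q0 : 0 <= M1 / e1 ^+ 2 * (2 * e2).
  by rewrite mulr_ge0 ?divr_ge0 ?exprn_ge0 ?(ltW e10)// mulr_ge0// ltW.
have := ler_wpM2l q0 Ld.
have -> : N%:R * (4 * K * e1 + L%:R * (4 * K / e1 ^+ 2 * (kap * (2 * e2)))) =
  M1 * e1 + M1 / e1 ^+ 2 * (2 * e2) * (kap * L%:R) by rewrite /M1; ring.
have -> : M1 / e1 ^+ 2 * (2 * e2) * delta = M2 * (2 * e2) by rewrite /M2; ring.
lra.
Qed.

End law_comparison.

(** * Discretising Brownian motion under the Laplace transform *)

Section brownian_laplace.
Context d (T : measurableType d) (R : realType) (Q : probability T R).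
Variable B : R -> T -> R.
Hypothesis BM : standard_BM Q B.
Variables (a b s kap : R) (N L : nat).
Hypotheses (a0 : 0 < a) (ab : a <= b) (s0 : 0 < s) (kap0 : 0 < kap).
Hypotheses (L0 : (0 < L)%N) (Ls : kap * L%:R <= s ^+ 2).
Local Notation mu := (@lebesgue_measure R).
Local Notation tau := (expR (- (a / 2 * (kap * (N * L)%:R)))).

Let b0 : 0 < b. Proof. exact: lt_le_trans a0 ab. Qed.

Let mB v : measurable_fun setT (B v). Proof. by case: BM. Qed.

(** Brownian paths are known to be continuous on nonnegative times only; freezing them at time [0]
    yields continuity on the line, as joint measurability requires. *)
Definition BM_extended w y := B (Num.max y 0) w.

Lemma continuous_BM_extended w : continuous (BM_extended w).
Proof.
have [_ [_ [cB _]]] := BM.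
have /subspace_continuousP cw := cB w.
move=> y; rewrite /BM_extended.
have m0 : [set v : R | 0 <= v] (Num.max y 0) by rewrite /= le_max lexx orbT.
apply: (cvg_comp (fun z => Num.max z 0) (B ^~ w) _ (cw _ m0)).
have cm : Num.max z 0 @[z --> y] --> Num.max y 0.
  exact: (@continuous_max R R id (cst 0) y (@cvg_id _ _) (@cst_continuous _ _ _ _)).
move=> A /=; rewrite /within/= => nA.
have H : \forall z \near y, 0 <= Num.max z 0 -> A (Num.max z 0) by exact: (cm _ nA).
suff : \forall z \near y, A (Num.max z 0) by [].
by apply: filterS H => z; apply; rewrite le_max lexx orbT.
Qed.

Lemma measurable_BM_extended : measurable_fun setT (fun p : T * R => BM_extended p.1 p.2).
Proof.
apply: measurable_fun_caratheodory; first by move=> y; exact: mB.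
exact: continuous_BM_extended.
Qed.

Definition block_BM j w := B (kap * ((j %/ L) * L)%:R) w.

(** The sum of indicators serves joint measurability and termwise integration; the pointwise form,
    with its value [0] beyond the cut-off, is [step_BME]. *)
Definition step_BM w y := \sum_(j < N * L)
  \1_(`[kap * j%:R, kap * j.+1%:R[) y * block_BM j w.

Lemma in_mesh_cell j y : 0 <= y ->
  (\1_(`[kap * j%:R, kap * j.+1%:R[) y : R) = (j == Num.truncn (y / kap))%:R.
Proof.
move=> y0; rewrite indicE; congr (_%:R); congr nat_of_bool.
have yk : 0 <= y / kap by rewrite divr_ge0// ltW.
have t1 : (Num.truncn (y / kap))%:R <= y / kap by rewrite truncn_le.
have t2 := truncnS_gt (y / kap).
apply/idP/idP; rewrite ?inE/= in_itv/=.
  move=> /andP[h1 h2].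
  have h1' : j%:R <= y / kap by rewrite ler_pdivlMr// mulrC.
  have h2' : y / kap < j.+1%:R by rewrite ltr_pdivrMr// mulrC.
  have := le_lt_trans h1' t2; have := le_lt_trans t1 h2'.
  rewrite !ltr_nat !ltnS => u v; apply/eqP/anti_leq; by rewrite u v.
move=> /eqP ->.
by rewrite [kap * _]mulrC -ler_pdivlMr// t1 [kap * _]mulrC -ltr_pdivrMr.
Qed.

Lemma step_BME w y : 0 <= y -> step_BM w y =
  if (Num.truncn (y / kap) < N * L)%N then block_BM (Num.truncn (y / kap)) w else 0.
Proof.
move=> y0; rewrite /step_BM.
under eq_bigr => j _ do rewrite in_mesh_cell//.
set m := Num.truncn _.
case: ltnP => mNL.
  rewrite (bigD1 (Ordinal mNL))//= eqxx mul1r big1 ?addr0// => j.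
  by rewrite -val_eqE/= => /negbTE ->; rewrite mul0r.
rewrite big1// => j _; case: eqVneq => [e|_]; last by rewrite mul0r.
by have := ltn_ord j; rewrite e ltnNge mNL.
Qed.

Lemma measurable_step_BM : measurable_fun setT (fun p : T * R => step_BM p.1 p.2).
Proof.
apply: measurable_sum => j; apply: measurable_funM.
  by apply: measurableT_comp => //; exact: measurable_indic.
by apply: measurableT_comp => //; exact: mB.
Qed.

Definition BM_gap w y := `|BM_extended w y - step_BM w y|.

Lemma measurable_BM_gap : measurable_fun setT (fun p : T * R => BM_gap p.1 p.2).
Proof.
apply: measurableT_comp => //; apply: measurable_funB.
- exact: measurable_BM_extended.
- exact: measurable_step_BM.
Qed.

Let first_moment (X : T -> R) (V : R) : measurable_fun setT X -> 0 <= V ->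
  (\int[Q]_w (X w ^+ 2)%:E = V%:E)%E ->
  (\int[Q]_w `|X w|%:E <= (s + s^-1 * V)%:E)%E.
Proof.
move=> mX V0 E2.
have I2 : intble Q (fun w => X w ^+ 2).
  by apply: intble_ge0; [exact: measurable_funX|move=> w; exact: sqr_ge0|rewrite E2 ltry].
have -> : (s + s^-1 * V)%:E = (\int[Q]_w (s + s^-1 * X w ^+ 2)%:E)%E.
  rewrite intbleE; last by apply: intbleD; [exact: intble_cst|exact: intbleZ].
  rewrite RintegralD//; last 2 first.
  - exact: intble_cst.
  - exact: intbleZ.
  by rewrite RintegralZl// expectation_cst /Rintegral E2.
apply: ge0_le_integral => //.
- by apply/measurable_EFinP; exact: measurableT_comp.
- apply/measurable_EFinP; apply: measurable_funD => //; apply: measurable_funM => //.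
  exact: measurable_funX.
move=> w _; rewrite lee_fin -(ler_pM2l s0) mulrDr mulVKf ?gt_eqF// -(real_normK (num_real (X w))).
set x := `|X w|; have := sqr_ge0 (s - x); have := sqr_ge0 s; have := sqr_ge0 x.
by rewrite sqrrB !expr2; nra.
Qed.

Lemma BM_gap_expectation y : 0 <= y -> (\int[Q]_w (BM_gap w y)%:E <=
  (if y < kap * (N * L)%:R then 2 * s else s + s^-1 * y)%:E)%E.
Proof.
move=> y0.
have yk : 0 <= y / kap by rewrite divr_ge0// ltW.
have t1 : (Num.truncn (y / kap))%:R <= y / kap by rewrite truncn_le.
have t2 := truncnS_gt (y / kap).
rewrite /BM_gap /BM_extended (max_idPl y0).
under eq_integral do rewrite step_BME//.
have -> : (y < kap * (N * L)%:R) = (Num.truncn (y / kap) < N * L)%N.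
  rewrite mulrC -ltr_pdivrMr//; apply/idP/idP => h.
    by rewrite -(ltr_nat R) (le_lt_trans t1).
  by rewrite (lt_le_trans t2)// ler_nat.
set m := Num.truncn _ in t1 t2 *.
case: ltnP => mNL; last first.
  under eq_integral do rewrite subr0.
  apply: first_moment => //.
  have [_ [B0 _]] := BM.
  have := BM_second_moment BM (lexx 0) y0; rewrite subr0 => <-.
  by apply: eq_integral => w _; rewrite B0 subr0.
set z := kap * ((m %/ L) * L)%:R.
have ky : kap * m%:R <= y by rewrite mulrC -ler_pdivlMr.
have ky' : y <= kap * m.+1%:R by rewrite mulrC -ler_pdivrMr// ltW.
have z0 : 0 <= z by rewrite mulr_ge0// ltW.
have zy : z <= y by rewrite (le_trans _ ky)// ler_pM2l// ler_nat leq_trunc_div.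
have yz : y - z <= s ^+ 2.
  apply: le_trans Ls; rewrite lerBlDr (le_trans ky')// /z -mulrDr ler_pM2l// -natrD ler_nat.
  by rewrite {1}(divn_eq m L) addnC -addSn leq_add2r ltn_pmod.
apply: (le_trans (first_moment _ _ (BM_second_moment BM z0 zy))).
- exact: measurable_funB.
- by rewrite subr_ge0.
rewrite lee_fin.
have si0 : 0 <= s^-1 by rewrite invr_ge0 ltW.
by have := ler_wpM2l si0 yz; rewrite expr2 mulKf ?gt_eqF//; lra.
Qed.

(** [b] bounds the factor [u] and [a] bounds the decay rate [u], so one density serves all [u] in
    [[a, b]]. *)
Definition gap_density w y := \1_(`[0, +oo[) y * (b * (expR (- (a * y)) * BM_gap w y)).

Lemma gap_density_ge0 w y : 0 <= gap_density w y.
Proof.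
rewrite /gap_density mulr_ge0//.
by apply: mulr_ge0; [exact: ltW|apply: mulr_ge0; [exact: expR_ge0|exact: normr_ge0]].
Qed.

Let measurable_exp_lin (c : R) : measurable_fun setT (fun y : R => expR (- (c * y))).
Proof.
under eq_fun do rewrite -mulNr.
by apply: measurableT_comp => //; exact: mulrl_measurable.
Qed.

Lemma measurable_gap_density : measurable_fun setT (fun p : T * R => gap_density p.1 p.2).
Proof.
apply: measurable_funM; first exact: measurableT_comp.
apply: measurable_funM => //; apply: measurable_funM; last exact: measurable_BM_gap.
by apply: (measurableT_comp (measurable_exp_lin a)).
Qed.

Definition BM_bound w : \bar R := (\int[mu]_y (gap_density w y)%:E)%E.

Lemma BM_bound_ge0 w : (0 <= BM_bound w)%E.
Proof. by apply: integral_ge0 => y _; rewrite lee_fin gap_density_ge0. Qed.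

Let mgd : measurable_fun setT (fun p : T * R => (gap_density p.1 p.2)%:E).
Proof. by apply/measurable_EFinP; exact: measurable_gap_density. Qed.

Lemma measurable_BM_bound : measurable_fun setT BM_bound.
Proof.
apply: (@measurable_fun_fubini_tonelli_F _ _ _ _ _ mu (fun p => (gap_density p.1 p.2)%:E)) => //.
by move=> p; rewrite lee_fin gap_density_ge0.
Qed.

Lemma integral_exp_half_line (c : R) : 0 < c ->
  (\int[mu]_y (\1_(`[0, +oo[) y * expR (- (c * y)))%:E = (c^-1)%:E)%E.
Proof.
move=> c0; have c00 : 0 <= c := ltW c0.
have -> : (c^-1)%:E = (c^-1%:E * \int[mu]_y (exponential_pdf c y)%:E)%E.
  by rewrite integral_exponential_pdf// mule1.
rewrite -ge0_integralZl//; last 3 first.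
- by apply/measurable_EFinP; exact: measurable_exponential_pdf.
- by move=> y _; rewrite lee_fin exponential_pdf_ge0.
- by rewrite lee_fin invr_ge0.
apply: eq_integral => y _; rewrite -EFinM; congr EFin.
rewrite /exponential_pdf patchE indicE; case: ifP => _; last by rewrite mul0r mulr0.
by rewrite mul1r mulNr mulKf ?gt_eqF.
Qed.

Definition gap_scale := b * (2 * s + tau * (s + 4 / a * s^-1)).

(** Tonelli reduces this to a bound for each [y]. Beyond the cut-off, half of the rate [a] gives
    [tau], a quarter absorbs the growth of the gap, and the last quarter is integrated, whence
    [4 / a]. *)
Lemma BM_bound_expectation : (\int[Q]_w BM_bound w <= (gap_scale * (4 / a))%:E)%E.
Proof.
have a40 : 0 < a / 4 by rewrite divr_gt0.
rewrite /BM_bound.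
rewrite (@fubini_tonelli _ _ _ _ _ Q mu (fun p => (gap_density p.1 p.2)%:E))//; last first.
  by move=> p; rewrite lee_fin gap_density_ge0.
have si0 : 0 < s^-1 by rewrite invr_gt0.
have G0 : 0 <= gap_scale.
  apply: mulr_ge0; first exact: ltW.
  apply: addr_ge0; first by apply: mulr_ge0 => //; exact: ltW.
  apply: mulr_ge0; first exact: expR_ge0.
  apply: addr_ge0; first exact: ltW.
  by apply: mulr_ge0; [apply: divr_ge0 => //; exact: ltW|exact: ltW].
have -> : (gap_scale * (4 / a))%:E =
   (\int[mu]_y (gap_scale%:E * (\1_(`[0, +oo[) y * expR (- (a / 4 * y)))%:E))%E.
  rewrite ge0_integralZl//.
  - by rewrite integral_exp_half_line// -EFinM invf_div.
  - by apply/measurable_EFinP; apply: measurable_funM => //; exact: measurable_exp_lin.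
apply: ge0_le_integral => //.
- by move=> y _; apply: integral_ge0 => w _; rewrite lee_fin gap_density_ge0.
- apply: (@measurable_fun_fubini_tonelli_G _ _ _ _ _ Q (fun p => (gap_density p.1 p.2)%:E)) => //.
  by move=> p; rewrite lee_fin gap_density_ge0.
- apply/measurable_EFinP; apply: measurable_funM => //; apply: measurable_funM => //.
  exact: measurable_exp_lin.
move=> y _; rewrite /gap_density.
have [y0|y0] := leP 0 y; last first.
  have -> : \1_(`[0, +oo[) y = 0 :> R.
    by rewrite indicE memNset//= in_itv/= andbT; apply/negP; rewrite -ltNge.
  under eq_integral do rewrite mul0r.
  by rewrite integral0 mul0r mule0.
have -> : \1_(`[0, +oo[) y = 1 :> R.
  by rewrite indicE mem_set//= in_itv/= andbT.
have bE : 0 <= b * expR (- (a * y)) by rewrite mulr_ge0 ?expR_ge0 ?(ltW b0).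
have mg : measurable_fun setT (fun w => (BM_gap w y)%:E).
  apply/measurable_EFinP.
  by have := measurableT_comp measurable_BM_gap (measurable_fun_pair (@measurable_id _ T setT) (measurable_cst y)).
have -> : (\int[Q]_x (1 * (b * (expR (- (a * y)) * BM_gap (x, y).1 (x, y).2)))%:E =
    (b * expR (- (a * y)))%:E * \int[Q]_x (BM_gap x y)%:E)%E.
  rewrite -ge0_integralZl//; last by move=> w _; rewrite lee_fin normr_ge0.
  by apply: eq_integral => w _; rewrite -EFinM mul1r mulrA.
rewrite mul1r -EFinM.
apply: (le_trans (lee_wpmul2l _ (BM_gap_expectation y0))); first by rewrite lee_fin.
rewrite -EFinM lee_fin /gap_scale -(mulrA b) -(mulrA b) ler_pM2l//.
have e4 := expR_gt0 (- (a / 4 * y)).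
have ay0 : 0 <= a * y by rewrite mulr_ge0// ltW.
have t0 := expR_gt0 (- (a / 2 * (kap * (N * L)%:R))).
have sa0 : 0 <= s + 4 / a * s^-1.
  apply: addr_ge0; first exact: ltW.
  by apply: mulr_ge0; [apply: divr_ge0 => //; exact: ltW|exact: ltW].
case: ltP => yNL.
  apply: (@le_trans _ _ (2 * s * expR (- (a / 4 * y)))).
    rewrite mulrC ler_wpM2l//; first by rewrite mulr_ge0 ?(ltW s0).
    by rewrite ler_expR; lra.
  rewrite ler_wpM2r ?(ltW e4)// lerDl mulr_ge0 ?(ltW t0)//.
have key : expR (- (a / 4 * y)) * (s + s^-1 * y) <= s + 4 / a * s^-1.
  rewrite expRN mulrC ler_pdivrMr ?expR_gt0//.
  have h := ler_wpM2l sa0 (expR_ge1Dx (a / 4 * y)).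
  have -> : s + s^-1 * y = s + s^-1 * (4 / a) * (a / 4 * y) by field; rewrite !gt_eqF.
  have : 0 <= s * (a / 4 * y) by rewrite mulr_ge0 ?(ltW s0)// mulr_ge0// ltW.
  have : 0 <= 4 / a * s^-1 by apply: mulr_ge0; [apply: divr_ge0 => //; exact: ltW|exact: ltW].
  lra.
have -> : expR (- (a * y)) = expR (- (a / 2 * y)) * expR (- (a / 4 * y)) * expR (- (a / 4 * y)).
  by rewrite -!expRD; congr expR; field.
have e2 : expR (- (a / 2 * y)) <= tau.
  by rewrite ler_expR lerN2 ler_pM2l// divr_gt0.
have := ler_pM (expR_ge0 _) _ e2 key.
have k0 : 0 <= expR (- (a / 4 * y)) * (s + s^-1 * y).
  by rewrite mulr_ge0 ?expR_ge0// addr_ge0 ?(ltW s0)// mulr_ge0 ?(ltW si0).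
move=> /(_ k0) h.
have := ler_wpM2r (ltW e4) h.
have : 0 <= 2 * s * expR (- (a / 4 * y)) by rewrite !mulr_ge0 ?(ltW s0) ?(ltW e4).
lra.
Qed.

End brownian_laplace.

(** * The limit process near its discretisation *)

Section laplace_transform_bound.
Context d (T : measurableType d) (R : realType) (Q : probability T R).
Variable B : R -> T -> R.
Hypothesis BM : standard_BM Q B.
Variables (a b s kap : R) (N L : nat).
Hypotheses (a0 : 0 < a) (ab : a <= b) (kap0 : 0 < kap).
Local Notation mu := (@lebesgue_measure R).

Let mB v : measurable_fun setT (B v). Proof. by case: BM. Qed.

Let cexp (u : R) : continuous (fun y : R => expR (- (u * y))).
Proof.
move=> y; apply: (@continuous_comp _ _ _ (fun y => - (u * y)) expR); last exact: continuous_expR.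
apply: (@continuousN _ R _ (fun y => u * y)).
by apply: (@continuousM R R (cst u) id); [exact: cst_continuous|exact: cvg_id].
Qed.

Lemma integral_exp_cell (u p q : R) : 0 < u -> p < q ->
  (\int[mu]_(y in `[p, q]) (expR (- (u * y)))%:E =
    (u^-1 * (expR (- (u * p)) - expR (- (u * q))))%:E)%E.
Proof.
move=> u0 pq.
pose F y : R := - u^-1 * expR (- (u * y)).
have dF (y : R) : is_derive y 1 F (expR (- (u * y))).
  have d1 : is_derive y 1 (fun y : R => - (u * y)) (- u).
    have -> : (fun y : R => - (u * y)) = (- u) \*: (id : R -> R).
      by apply/funext => z; rewrite -mulNr.
    by rewrite -[X in is_derive _ _ _ X]mulr1; exact: (is_deriveZ (- u) (@is_derive_id R R y 1)).
  have d2 := @is_derive1_comp R expR (fun y => - (u * y)) y (expR (- (u * y))) (- u) (is_derive_expR _) d1.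
  have := is_deriveZ (- u^-1) d2.
  rewrite /GRing.scale/= mulrN mulrNN mulrCA mulVf ?gt_eqF// mulr1; exact.
have cF : continuous F.
  by move=> y; apply: differentiable_continuous; apply/derivable1_diffP; have [] := dF y.
rewrite (@continuous_FTC2 _ _ F)//.
- by rewrite -EFinB /F; congr EFin; ring.
- by apply: continuous_subspaceT; exact: cexp.
- split.
  + by move=> y _; have [] := dF y.
  + by apply: cvg_at_right_filter; exact: cF.
  + by apply: cvg_at_left_filter; exact: cF.
- by move=> y _; rewrite derive1E; have [_ ->] := dF y.
Qed.

Local Notation H := (`[0, +oo[%classic : set R).

Let mexp (u : R) : measurable_fun setT (fun y : R => expR (- (u * y))).
Proof.
under eq_fun do rewrite -mulNr.
by apply: measurableT_comp => //; exact: mulrl_measurable.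
Qed.

Let cell_expectation (u : R) j : 0 < u ->
  (\int[mu]_y (\1_(`[kap * j%:R, kap * j.+1%:R[) y * expR (- (u * y)))%:E =
  (u^-1 * (expR (- (u * (kap * j%:R))) - expR (- (u * (kap * j.+1%:R)))))%:E)%E.
Proof.
move=> u0; rewrite -integral_exp_cell//; last by rewrite ltr_pM2l// ltr_nat.
rewrite -integral_itv_bndo_bndc; last first.
  by apply/measurable_EFinP; apply: measurable_funTS.
rewrite [RHS]integral_mkcond; apply: eq_integral => y _.
rewrite patchE indicE; case: ifP => _; first by rewrite mul1r.
by rewrite mul0r.
Qed.

Let cell_intble (u : R) j : 0 < u ->
  intble mu (fun y => \1_(`[kap * j%:R, kap * j.+1%:R[) y * expR (- (u * y))).
Proof.
move=> u0; apply: intble_ge0.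
- by apply: measurable_funM => //; exact: mexp.
- by move=> y; rewrite mulr_ge0 ?expR_ge0// indicE ler0n.
- by rewrite cell_expectation// ltry.
Qed.

Let sum_intble (n : nat) (f : nat -> R -> R) (c : nat -> R) :
  (forall j, intble mu (f j)) ->
  intble mu (fun y => \sum_(j < n) f j y * c j) /\
  \int[mu]_y (\sum_(j < n) f j y * c j) = \sum_(j < n) (\int[mu]_y f j y) * c j.
Proof.
move=> If; elim: n => [|n [IH1 IH2]].
  split.
    apply: (@eq_integrable _ _ _ mu setT measurableT (cst 0%E)) => [y _|].
      by rewrite /= big_ord0.
    exact: integrable0.
  rewrite big_ord0; under eq_Rintegral do rewrite big_ord0.
  by rewrite /Rintegral integral0.
have Ifc : intble mu (fun y => f n y * c n).
  by under eq_fun do rewrite mulrC; exact: intbleZ.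
have E : (fun y => \sum_(j < n.+1) f j y * c j) =
    (fun y => \sum_(j < n) f j y * c j + f n y * c n).
  by apply/funext => y; rewrite big_ord_recr.
rewrite E; split; first exact: intbleD.
rewrite big_ord_recr/= -IH2 RintegralD//; congr (_ + _).
by rewrite RintegralZr//; exact: If.
Qed.

(** Over a mesh cell, [u] times the integral of [expR (- (u * y))] is an increment of the
    exponential, so the step path is transformed exactly. Integrability of the true integrand
    follows from that of the step path and the finiteness of [BM_bound]. *)
Lemma Tproc_bound w u : (BM_bound B a b kap N L w < +oo)%E -> a <= u -> u <= b ->
  `|Tproc B w u - \sum_(j < N * L)
    (expR (- (u * (kap * j%:R))) - expR (- (u * (kap * j.+1%:R)))) * block_BM B kap L j w|
  <= fine (BM_bound B a b kap N L w).
Proof.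
move=> fin au ub.
have u0 : 0 < u := lt_le_trans a0 au.
have b0 : 0 < b := lt_le_trans u0 ub.
pose F y := \1_H y * (expR (- (u * y)) * BM_extended B w y).
pose S y := \1_H y * (expR (- (u * y)) * step_BM B kap N L w y).
pose S' y := \sum_(j < N * L) \1_(`[kap * j%:R, kap * j.+1%:R[) y * expR (- (u * y)) * block_BM B kap L j w.
have SS' : S = S'.
  apply/funext => y; rewrite /S /S' /step_BM !mulr_sumr; apply: eq_bigr => j _.
  have [yH|yH] := boolP (y \in H); first by rewrite indicE yH mul1r; ring.
  rewrite [X in X * _ = _]indicE (negbTE yH) mul0r indicE.
  rewrite (_ : _ \in _ = false) ?mul0r//.
  apply/negbTE; apply: contra yH; rewrite !inE/= !in_itv/= andbT => /andP[h _].
  by rewrite (le_trans _ h)// mulr_ge0// ltW.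
have mFS : measurable_fun setT (fun y => F y - S y).
  have p1 := measurableT_comp (measurable_BM_extended BM)
    (measurable_fun_pair (@measurable_cst _ _ R T setT w) (@measurable_id _ R setT)).
  have p2 := measurableT_comp (measurable_step_BM BM kap N L)
    (measurable_fun_pair (@measurable_cst _ _ R T setT w) (@measurable_id _ R setT)).
  apply: measurable_funB; apply: measurable_funM => //;
    by [exact: measurable_indic|apply: measurable_funM => //; exact: mexp].
have Igap : intble mu (fun y => gap_density B a b kap N L w y).
  apply: intble_ge0 => //.
    have := measurableT_comp (measurable_gap_density BM a b kap N L)
      (measurable_fun_pair (@measurable_cst _ _ R T setT w) (@measurable_id _ R setT)).
    exact.
  by move=> y; exact: gap_density_ge0.
have FSle y : `|F y - S y| <= b^-1 * gap_density B a b kap N L w y.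
  rewrite /F /S /gap_density -mulrBr -mulrBr normrM normrM.
  have i0 : 0 <= (\1_H y : R) by rewrite indicE ler0n.
  rewrite (ger0_norm i0) (gtr0_norm (expR_gt0 _)).
  rewrite (_ : b^-1 * _ = \1_H y * (expR (- (a * y)) * BM_gap B kap N L w y)); last first.
    by field; rewrite gt_eqF.
  have [yH|yH] := boolP (y \in H); last by rewrite indicE (negbTE yH) !mul0r.
  rewrite ler_wpM2l// /BM_gap ler_wpM2r// ler_expR lerN2 ler_wpM2r//.
  by move: yH; rewrite inE/= in_itv/= andbT.
have IFS : intble mu (fun y => F y - S y).
  apply: (@intble_le _ _ _ mu _ _ _ FSle); first exact: mFS.
  exact: intbleZ.
have [IS' ES'] := sum_intble (N * L) (fun j => block_BM B kap L j w) (fun j => cell_intble j u0).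
have IS : intble mu S by rewrite SS'; exact: IS'.
have IF : intble mu F.
  have := intbleD IFS IS; by under eq_fun do rewrite subrK.
have TE : Tproc B w u = u * \int[mu]_y F y.
  rewrite /Tproc u0; congr (_ * fine _).
  rewrite [LHS]integral_mkcond; apply: eq_integral => y _.
  rewrite patchE /F indicE.
  have -> : [set y : R | 0 <= y] = H by apply/seteqP; split => z /=; rewrite in_itv/= andbT.
  case: ifPn => yH; last by rewrite mul0r.
  rewrite mul1r /BM_extended; congr (_ * B _ w)%:E.
  by move: yH; rewrite inE/= in_itv/= andbT => /max_idPl ->.
have SE : u * \int[mu]_y S y = \sum_(j < N * L)
    (expR (- (u * (kap * j%:R))) - expR (- (u * (kap * j.+1%:R)))) * block_BM B kap L j w.
  rewrite SS' ES' mulr_sumr; apply: eq_bigr => j _.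
  rewrite /Rintegral cell_expectation//=.
  by rewrite -mulrA (mulVKf (lt0r_neq0 u0)).
rewrite TE -SE -mulrBr -RintegralB// normrM (gtr0_norm u0).
have h := norm_expectation_le IFS (intbleZ b^-1 Igap) FSle.
have g0 : 0 <= \int[mu]_y gap_density B a b kap N L w y.
  by apply: Rintegral_ge0 => y _; exact: gap_density_ge0.
rewrite RintegralZl// in h.
apply: (le_trans (ler_wpM2l (ltW u0) h)).
rewrite mulrA -[leRHS]mul1r ler_wpM2r// ler_pdivrMr// mul1r//.
Qed.

End laplace_transform_bound.

(** * Lipschitz majorants of a test functional *)

Section envelope.
Context {R : realType}.
Implicit Types (F : (R -> R) -> R) (x y z : R -> R).

Definition envelope_set F (lam a b : R) x : set R :=
  [set v | exists z r, [/\ cadlag_pos z, 0 <= r,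
     forall u, a <= u -> u <= b -> `|x u - z u| <= r & v = F z - lam * r]].

(* A [lam]-Lipschitz majorant of [F] for the supremum distance on
   [a, b]; the radius [r] avoids mentioning that distance. *)
Definition envelope F lam a b x := sup (envelope_set F lam a b x).

Variables (F : (R -> R) -> R) (M lam a b : R).
Hypotheses (lam0 : 0 <= lam) (FM : forall x, `|F x| <= M).

Let M0 : 0 <= M. Proof. exact: le_trans (normr_ge0 _) (FM (fun=> 0)). Qed.

Let F_le x : F x <= M. Proof. exact: le_trans (ler_norm _) (FM x). Qed.

Let F_ge x : - M <= F x.
Proof. by have := FM x; rewrite ler_norml => /andP[]. Qed.

Let env_ub x : ubound (envelope_set F lam a b x) M.
Proof.
move=> _ [z [r [_ r0 _ ->]]]; rewrite lerBlDr (le_trans (F_le z))// lerDl.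
exact: mulr_ge0.
Qed.

Lemma envelope_le x : envelope F lam a b x <= M.
Proof.
rewrite /envelope.
(* The supremum of the empty set is [0] by convention, and [0 <= M]. *)
have [-> |ne] := eqVneq (envelope_set F lam a b x) set0; first by rewrite sup0.
by apply: ge_sup; [exact/set0P|exact: env_ub].
Qed.

Lemma le_envelope x z r : cadlag_pos z -> 0 <= r ->
  (forall u, a <= u -> u <= b -> `|x u - z u| <= r) ->
  F z - lam * r <= envelope F lam a b x.
Proof.
move=> cz r0 xz; apply: ub_le_sup; first by exists M; exact: env_ub.
by exists z, r.
Qed.

Lemma envelope_ge x : cadlag_pos x -> - M <= envelope F lam a b x.
Proof.
move=> cx; apply: le_trans (le_envelope cx (lexx 0) _).
  by rewrite mulr0 subr0.
by move=> u _ _; rewrite subrr normr0.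
Qed.

Lemma envelope_norm_le x : cadlag_pos x -> `|envelope F lam a b x| <= M.
Proof. by move=> cx; rewrite ler_norml envelope_ge// envelope_le. Qed.

(** By the triangle inequality a competitor [(z, r)] for [x] yields the competitor [(z, r + c)] for
    [y]. *)
Lemma envelope_lipschitz x y c : cadlag_pos x -> 0 <= c ->
  (forall u, a <= u -> u <= b -> `|x u - y u| <= c) ->
  envelope F lam a b x <= envelope F lam a b y + lam * c.
Proof.
move=> cx c0 xy; apply: ge_sup.
  exists (F x - lam * 0), x, 0; split => // u _ _.
  by rewrite subrr normr0.
move=> _ [z [r [cz r0 xz ->]]].
rewrite -lerBlDr -addrA -opprD -mulrDr.
apply: le_envelope => //; first exact: addr_ge0.
move=> u au ub; rewrite (addrC r).
have -> : y u - z u = - (x u - y u) + (x u - z u) by ring.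
by rewrite (le_trans (ler_normD _ _))// normrN lerD ?xy ?xz.
Qed.

Lemma envelope_witness x v : cadlag_pos x -> v < envelope F lam a b x ->
  exists z r, [/\ cadlag_pos z, 0 <= r,
     forall u, a <= u -> u <= b -> `|x u - z u| <= r & v < F z - lam * r].
Proof.
move=> cx vx.
have ne : envelope_set F lam a b x !=set0.
  exists (F x - lam * 0), x, 0; split => // u _ _.
  by rewrite subrr normr0.
have hs : has_sup (envelope_set F lam a b x) by split => //; exists M; exact: env_ub.
have e0 : 0 < envelope F lam a b x - v by rewrite subr_gt0.
have [_ [z [r [cz r0 xz ->]]] h] := sup_adherent e0 hs.
by exists z, r; split => //; move: h; rewrite subKr.
Qed.

End envelope.

(** * Regularity of the prelimit and discretised paths *)

Section cadlag_paths.
Context {R : realType}.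
Implicit Types (x : R -> R).

Lemma continuous_pos_cadlag x : (forall s : R, 0 < s -> {for s, continuous x}) -> cadlag_pos x.
Proof.
move=> cx s s0; split; first exact: cvg_at_right_filter (cx s s0).
by apply/cvg_ex; exists (x s); exact: cvg_at_left_filter (cx s s0).
Qed.

(** [Xproc] has this form, since it depends on [u > 0] only through the integer part of
    [k t * u]. *)
Lemma step_function_cadlag (f : nat -> R) (c : R) x : 0 < c ->
  (forall u, 0 < u -> x u = f (Num.truncn (c * u))) -> cadlag_pos x.
Proof.
move=> c0 xE s s0.
have cs0 : 0 <= c * s by rewrite mulr_ge0// ltW.
have t1 : (Num.truncn (c * s))%:R <= c * s by rewrite truncn_le.
have t2 := truncnS_gt (c * s).
have trE m u : 0 < u -> m%:R <= c * u -> c * u < m.+1%:R -> x u = f m.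
  move=> u0 h1 h2; rewrite xE//; congr f; apply/eqP.
  have cu0 : 0 <= c * u by rewrite mulr_ge0// ltW.
  have t1' : (Num.truncn (c * u))%:R <= c * u by rewrite truncn_le.
  have t2' := truncnS_gt (c * u).
  have := le_lt_trans h1 t2'; have := le_lt_trans t1' h2.
  by rewrite !ltr_nat !ltnS eqn_leq => -> ->.
set m := Num.truncn (c * s) in t1 t2.
split.
  apply: cvg_near_cst.
  near=> u.
  have su : s < u by near: u; exact: nbhs_right_gt.
  have u0 : 0 < u := lt_trans s0 su.
  rewrite (xE s s0) -/m; apply: trE => //.
    by rewrite (le_trans t1)// ler_pM2l// ltW.
  rewrite mulrC -ltr_pdivlMr//; near: u; apply: nbhs_right_lt.
  by rewrite ltr_pdivlMr// mulrC.
(* The value to the left of [s]: if [c * s] is an integer, it is [f] at the previous integer, hence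
   the strict and weak inequalities. *)
have [m' [h1 h2]] : exists m' : nat, m'%:R < c * s /\ c * s <= m'.+1%:R.
  have [h|h] := ltP m%:R (c * s); first by exists m; split => //; exact: ltW.
  have E : c * s = m%:R by apply/eqP; rewrite eq_le t1 h.
  have cs : 0 < c * s by rewrite mulr_gt0.
  case: m {t1 t2} h E => [|m] h E; first by rewrite E ltxx in cs.
  by exists m; rewrite E ltr_nat lexx.
apply/cvg_ex; exists (f m'); apply: cvg_near_cst.
near=> u.
have us : u < s by near: u; exact: nbhs_left_lt.
have h : m'%:R / c < u by near: u; apply: nbhs_left_gt; rewrite ltr_pdivrMr// mulrC.
have u0 : 0 < u by apply: le_lt_trans h; rewrite divr_ge0// ltW.
apply: trE => //.
  by rewrite ltW// mulrC -ltr_pdivrMr.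
by apply: lt_le_trans h2; rewrite ltr_pM2l.
Unshelve. all: by end_near. Qed.

Lemma Xproc_cadlag (T : Type) (k : R -> R) (xi : nat -> T -> R) (mu sigma2 t : R) w :
  0 < k t -> cadlag_pos (Xproc k xi mu sigma2 t w).
Proof.
move=> k0.
pose f m : R := if (0 < m)%N then
    Num.sqrt ((Num.truncn (k t))%:R) * (m.-1)`!%:R
      / Num.sqrt (sigma2 * mu ^- (2 * m).+1 * t ^+ (2 * m).-1)
    * (renewal_sum xi t m w / ((m.-1)`!%:R * mu ^+ m.-1)
       - t ^+ m / (m`!%:R * mu ^+ m))
  else 0.
apply: (@step_function_cadlag f (k t)) => // u u0.
by rewrite /Xproc u0.
Qed.

Lemma J1_conv_locally_uniform (xs : nat -> R -> R) x :
  (forall a b e : R, 0 < a -> a < b -> 0 < e -> \forall n \near \oo,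
     forall s, a <= s <= b -> `|xs n s - x s| <= e) -> J1_conv xs x.
Proof.
move=> H a b a0 ab _ _; exists (fun _ => id); split; [|split; [|split; [|split]]].
- by move=> n s r _ _.
- by move=> n; apply: continuous_subspaceT => y; exact: cvg_id.
- by move=> n; rewrite image_id.
- by move=> e e0; apply: nearW => n s _; rewrite subrr normr0 ltW.
- by move=> e e0; exact: H.
Qed.

Variables (k t mu : R) (N L : nat).

(* [u] times the Laplace transform at [u] of the step function that jumps by [v i] at the end of
   the block [i] of [L] mesh cells, cut off after [N] blocks. *)
Definition path_of (v : nat -> R) (u : R) : R :=
  \sum_(j < N * L) step_kernel k t mu u j * \sum_(i < j %/ L) v i.

Lemma path_of_continuous v : continuous (path_of v).
Proof.
have cs n (f : nat -> R -> R) : (forall j, continuous (f j)) ->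
    continuous (fun u => \sum_(j < n) f j u).
  move=> cf; elim: n => [|n IH] u.
    by under eq_fun do rewrite big_ord0; exact: cst_continuous.
  under eq_fun do rewrite big_ord_recr/=.
  exact: (continuousD (IH u) (cf n u)).
apply: (cs _ (fun j u => step_kernel k t mu u j * \sum_(i < j %/ L) v i)) => j u.
apply: (@continuousM R R (fun u => step_kernel k t mu u j) (cst (\sum_(i < j %/ L) v i)));
  last exact: cst_continuous.
have ce (c : R) : continuous (fun u : R => expR (- (u * c))).
  move=> z; apply: (@continuous_comp R R R (fun u : R => - (u * c)) expR); last exact: continuous_expR.
  apply: (@continuousN _ R _ (fun u : R => u * c)).
  by apply: (@continuousM R R id (cst c)); [exact: cvg_id|exact: cst_continuous].
exact: (continuousB (ce _ u) (ce _ u)).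
Qed.

Lemma path_of_cadlag v : cadlag_pos (path_of v).
Proof. by apply: continuous_pos_cadlag => s _; exact: path_of_continuous. Qed.

Hypotheses (L0 : (0 < L)%N) (kap0 : 0 < mesh k t mu).

(** The weights [step_kernel] are nonnegative and telescope to at most [1], and they multiply
    partial sums of [v]. The constant [1] is free of [t], [L] and [u], so the Lipschitz class stays
    fixed as the mesh shrinks. *)
Lemma path_of_lipschitz v v' u : 0 <= u ->
  `|path_of v u - path_of v' u| <= \sum_(i < N) `|v i - v' i|.
Proof.
move=> u0.
have sk0 j : 0 <= step_kernel k t mu u j.
  rewrite subr_ge0 ler_expR lerN2 ler_wpM2l// ler_pM2l// ler_nat//.
have tel n : \sum_(j < n) step_kernel k t mu u j = 1 - expR (- (u * (mesh k t mu * n%:R))).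
  elim: n => [|n IH]; first by rewrite big_ord0 !mulr0 oppr0 expR0 subrr.
  by rewrite big_ord_recr/= IH /step_kernel; ring.
set D := \sum_(i < N) _.
have D0 : 0 <= D by apply: sumr_ge0.
rewrite /path_of -sumrB (le_trans (ler_norm_sum _ _ _))//.
apply: (@le_trans _ _ (\sum_(j < N * L) step_kernel k t mu u j * D)).
  apply: ler_sum => j _; rewrite -mulrBr normrM (ger0_norm (sk0 j)) ler_wpM2l//.
  rewrite -sumrB (le_trans (ler_norm_sum _ _ _))//.
  have jN : (j %/ L <= N)%N by rewrite ltnW// ltn_divLR.
  rewrite /D -(big_mkord xpredT (fun i => `|v i - v' i|)).
  rewrite -(big_mkord xpredT (fun i => `|v i - v' i|)) (big_cat_nat _ jN)//= lerDl.
  exact: sumr_ge0.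
rewrite -mulr_suml tel -[leRHS]mul1r ler_wpM2r// gerBl expR_ge0//.
Qed.

End cadlag_paths.

(** * Choice of the parameters *)

Section parameters.
Context {R : realType}.

Lemma exp_tail_small (c A s : R) : 0 < c -> 0 < s ->
  exists N : nat, forall x, c * N%:R <= x -> expR (- x) * A <= s.
Proof.
move=> c0 s0; exists (Num.truncn (`|A| / (s * c))).+1 => x cx.
have h : `|A| / (s * c) < (Num.truncn (`|A| / (s * c))).+1%:R by exact: truncnS_gt.
have h2 : `|A| <= s * (c * (Num.truncn (`|A| / (s * c))).+1%:R).
  by move: h; rewrite ltr_pdivrMr ?mulr_gt0// (mulrC _ (s * c)) -mulrA => /ltW.
apply: (@le_trans _ _ (expR (- x) * `|A|)).
  by rewrite ler_wpM2l ?expR_ge0// ler_norm.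
rewrite expRN mulrC ler_pdivrMr ?expR_gt0// (le_trans h2)// ler_pM2l// (le_trans cx)//.
by rewrite (le_trans _ (expR_ge1Dx _))// lerDr.
Qed.

(** [s] handles the freezing error, then [N] makes [tau] beat [s^-1], then [h] makes [amplitude] and
    [kernel_const] small, with [eps / 3] for each. [N] can precede the mesh because
    [s ^+ 2 / 2 <= mesh * L] keeps the covered time above [N * s ^+ 2 / 2]. *)
Lemma error_parameters (mu sigma a b G eps : R) : 0 < mu -> 0 < sigma -> 0 < a ->
  a <= b -> 0 < G -> 0 < eps -> exists s h : R, exists N : nat,
  [/\ 0 < s, 0 < h, h <= 1, h <= s ^+ 2 / 2 & forall (k t r : R) L, 1 <= k -> 0 < t -> k^-1 <= h ->
    mesh k t mu <= h -> 0 <= r -> r <= 1 -> s ^+ 2 / 2 <= mesh k t mu * L%:R ->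
    amplitude k t mu sigma r + (error_scale mu sigma k t a b r s N L * (1 + 8 / a) ^+ 2 +
      amplitude k t mu sigma r * G) <= eps /\
    gap_scale a b s (mesh k t mu) N L * (4 / a) <= eps].
Proof.
move=> mu0 sigma0 a0 ab G0 eps0.
have b0 : 0 < b := lt_le_trans a0 ab.
have a8 : 0 < 8 / a by rewrite divr_gt0.
set K := 1 + 8 / a.
have K1 : 1 <= K by rewrite lerDl ltW.
have K0 : 0 < K := lt_le_trans ltr01 K1.
have K20 : 0 < K ^+ 2 by rewrite exprn_gt0.
have KK : K <= K ^+ 2 by rewrite expr2 ler_peMr// ltW.
have a4K : 4 / a <= K ^+ 2.
  by apply: le_trans KK; rewrite /K; move: a8; rewrite !(mulrC _ a^-1); lra.
set C := b ^+ 2 * (sigma ^+ 2 / mu ^+ 2).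
have C0 : 0 <= C by rewrite mulr_ge0 ?sqr_ge0// divr_ge0 ?sqr_ge0.
set D := 3 * (1 + b) ^+ 2 * K ^+ 2.
have D0 : 0 < D by rewrite mulr_gt0// mulr_gt0// exprn_gt0// addr_gt0.
pose s := eps / (9 * b * K ^+ 2).
have s0 : 0 < s by rewrite divr_gt0// mulr_gt0// mulr_gt0.
have sE : b * (3 * s) * K ^+ 2 = eps / 3.
  by rewrite /s; field; rewrite !gt_eqF.
have s20 : 0 < s ^+ 2 / 2 by rewrite divr_gt0// exprn_gt0.
have c0 : 0 < a / 2 * (s ^+ 2 / 2) by rewrite mulr_gt0// divr_gt0.
have a40 : 0 < 4 / a by rewrite divr_gt0.
have [N HN] := @exp_tail_small _ (s + (1 + 4 / a) / s) s c0 s0.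
pose al := eps / (3 * (1 + C * K ^+ 2 + G)).
have den0 : 0 < 1 + C * K ^+ 2 + G.
  by rewrite addr_gt0// ltr_pwDl// mulr_ge0// ltW.
have al0 : 0 < al by rewrite divr_gt0// mulr_gt0.
have alE : al * (1 + C * K ^+ 2 + G) = eps / 3.
  by rewrite /al; field; rewrite !gt_eqF.
pose h1 := eps / (6 * D * K ^+ 2).
have h10 : 0 < h1 by rewrite divr_gt0// mulr_gt0// mulr_gt0.
have h1E : 2 * h1 * D * K ^+ 2 = eps / 3.
  by rewrite /h1; field; rewrite !gt_eqF.
(* Chosen so that [mesh <= h2] gives [amplitude <= al], as [amplitude] is at most
   [sqrt mesh * mu / sigma]. *)
pose h2 := (al * sigma / mu) ^+ 2.
have h20 : 0 < h2 by rewrite exprn_gt0// divr_gt0// mulr_gt0.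
exists s, (Num.min (Num.min 1 (s ^+ 2 / 2)) (Num.min h1 h2)), N; split => //.
- by rewrite !lt_min ltr01 s20 h10 h20.
- by rewrite !ge_min lexx.
- by rewrite !ge_min lexx orbT.
move=> k t r L k1 t0; rewrite !le_min => /andP[_ /andP[kh1 _]].
move=> /andP[_ /andP[mh1 mh2]] r0 r1 sL.
have kap0 : 0 < mesh k t mu by exact: mesh_gt0.
set A := amplitude k t mu sigma r.
have A0 : 0 <= A by exact: amplitude_ge0.
have Aal : A <= al.
  rewrite /A /amplitude ler_pdivrMr// -ler_pdivlMr//.
  apply: (@le_trans _ _ (Num.sqrt (mesh k t mu))); first by rewrite ler_piMl// sqrtr_ge0.
  have -> : al * sigma / mu = Num.sqrt h2.
    by rewrite /h2 sqrtr_sqr ger0_norm// ltW// divr_gt0// mulr_gt0.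
  exact: ler_wsqrtr.
set tau := expR (- (a / 2 * (mesh k t mu * (N * L)%:R))).
have tau0 : 0 <= tau by exact: expR_ge0.
have Ht : tau * (s + (1 + 4 / a) / s) <= s.
  apply: HN; rewrite -mulrA ler_pM2l ?divr_gt0// natrM (mulrC N%:R) mulrA.
  by rewrite ler_wpM2r// ler0n.
have si0 : 0 < s^-1 by rewrite invr_gt0.
have Ht1 : tau * (s + s^-1) <= s.
  apply: le_trans Ht; rewrite ler_wpM2l// lerD2l -[leLHS]mul1r ler_wpM2r ?(ltW si0)//.
  by rewrite lerDl ltW.
have Ht2 : tau * (s + 4 / a / s) <= s.
  apply: le_trans Ht; rewrite ler_wpM2l// lerD2l ler_wpM2r ?(ltW si0)//.
  by rewrite lerDr.
have E3 (x : R) : x <= s -> b * (2 * s + x) <= b * (3 * s).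
  by move=> xs; rewrite ler_pM2l//; move: xs; lra.
have b3s : 0 <= b * (3 * s) by rewrite mulr_ge0 ?(ltW b0)// mulr_ge0 ?(ltW s0).
split.
  have e1 : A * (1 + C * K ^+ 2 + G) <= eps / 3.
    by rewrite -alE ler_pM2r.
  have e2 : kernel_const k t mu a b * K ^+ 2 <= eps / 3.
    rewrite -h1E ler_pM2r// /kernel_const -/K -/D ler_pM2r//.
    by move: kh1 mh1; lra.
  have e3 : b * (2 * s + tau * (s + s^-1)) * K ^+ 2 <= eps / 3.
    by rewrite -sE ler_pM2r// E3.
  have -> : A + (error_scale mu sigma k t a b r s N L * K ^+ 2 + A * G) =
     A * (1 + C * K ^+ 2 + G) + kernel_const k t mu a b * K ^+ 2 +
     b * (2 * s + tau * (s + s^-1)) * K ^+ 2.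
    by rewrite /error_scale -/A -/C -/tau; ring.
  by move: e1 e2 e3; lra.
have eps3 : eps / 3 <= eps by move: eps0; lra.
apply: le_trans eps3; rewrite -sE /gap_scale -/tau.
apply: (@le_trans _ _ (b * (3 * s) * (4 / a))).
  by rewrite ler_pM2r// E3.
by rewrite ler_wpM2l.
Qed.

End parameters.

(** * Expectations compared up to a random error *)

Section perturbed_expectation.
Context d (T : measurableType d) (R : realType) (P : probability T R).

Lemma ae_finite (f : T -> \bar R) : measurable_fun setT f ->
  (forall w, 0 <= f w)%E -> (\int[P]_w f w < +oo)%E -> {ae P, forall w, (f w < +oo)%E}.
Proof.
move=> mf f0 fc.
have If : P.-integrable setT f.
  apply/integrableP; split => //; apply: le_lt_trans fc.
  by under eq_integral do rewrite gee0_abs//.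
apply: filterS (integrable_ae measurableT If) => w /(_ Logic.I).
by rewrite fin_numElt => /andP[].
Qed.

(** Adding [M] to both functions makes them nonnegative, so the comparison takes place in extended
    reals, where [r] may be infinite on a null set. *)
Lemma expectation_le_perturbed (f g : T -> R) (M lam c : R) (r : T -> \bar R) :
  measurable_fun setT f -> measurable_fun setT g ->
  (forall w, `|f w| <= M) -> (forall w, `|g w| <= M) ->
  measurable_fun setT r -> (forall w, 0 <= r w)%E -> (\int[P]_w r w <= c%:E)%E -> 0 <= lam ->
  {ae P, forall w, (r w < +oo)%E -> f w <= g w + lam * fine (r w)} ->
  \int[P]_w f w <= \int[P]_w g w + lam * c.
Proof.
move=> mf mg fM gM mr r0 rc lam0 fg.
have If := intble_bounded P mf fM.
have Ig := intble_bounded P mg gM.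
have ge0 (h : T -> R) : (forall w, `|h w| <= M) -> forall w, 0 <= M + h w.
  by move=> hM w; have := hM w; rewrite ler_norml => /andP[+ _]; rewrite -subr_ge0 opprK addrC.
have IM (h : T -> R) : intble P h ->
    (\int[P]_w (M + h w)%:E = (M + \int[P]_w h w)%:E)%E.
  move=> Ih; rewrite intbleE; last exact: intbleD (intble_cst P M) Ih.
  by rewrite RintegralD//; [rewrite expectation_cst|exact: intble_cst].
have rfin : {ae P, forall w, (r w < +oo)%E}.
  by apply: ae_finite => //; exact: le_lt_trans rc (ltry _).
have mh (h : T -> R) : measurable_fun setT h -> measurable_fun setT (fun w => (M + h w)%:E).
  by move=> hm; apply/measurable_EFinP; exact: measurable_funD.
have le : (\int[P]_w (M + f w)%:E <= \int[P]_w ((M + g w)%:E + lam%:E * r w))%E.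
  apply: ae_ge0_le_integral => //.
  - by move=> w _; rewrite lee_fin ge0.
  - exact: mh.
  - by move=> w _; apply: adde_ge0; [rewrite lee_fin ge0|apply: mule_ge0].
  - apply: emeasurable_funD; [exact: mh|exact: emeasurable_funM].
  apply: filterS2 rfin fg => w rw /(_ rw) h _.
  have rE : r w = (fine (r w))%:E by rewrite fineK// ge0_fin_numE.
  by rewrite rE -EFinM -EFinD lee_fin -addrA lerD2l.
have := le; rewrite IM// ge0_integralD//.
- rewrite IM// ge0_integralZl// => h.
  rewrite -(lerD2l M) -lee_fin (le_trans h)// (addrA M) (EFinD (M + _)) EFinM.
  by apply: leeD2l; apply: lee_wpmul2l.
- by move=> w _; rewrite lee_fin ge0.
- exact: mh.
- by move=> w _; apply: mule_ge0.
- exact: emeasurable_funM.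
Qed.

End perturbed_expectation.

(** * From the processes to functions of block sums *)

Section comparison.
Context d (T : measurableType d) d' (T' : measurableType d') (R : realType).
Context (P : probability T R) (Q : probability T' R).
Variables (xi : nat -> T -> R) (B : R -> T' -> R) (mu sigma m2 : R).
Hypothesis iidxi : iid P xi.
Hypothesis xi0 : forall i, P [set w | xi i w <= 0] = 0%E.
Hypotheses (mu0 : 0 < mu) (sigma0 : 0 < sigma) (m20 : 0 < m2).
Hypotheses (I1 : intble P (xi 0%N)) (I2 : intble P (fun w => xi 0%N w ^+ 2)).
Hypothesis E1 : \int[P]_w (xi 0%N w) = mu.
Hypothesis E2 : \int[P]_w (xi 0%N w ^+ 2) = m2.
Hypothesis var : m2 = sigma ^+ 2 + mu ^+ 2.
Hypothesis BM : standard_BM Q B.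
Variable k : R -> R.

Let mxi i : measurable_fun setT (xi i). Proof. by case: iidxi. Qed.

Lemma ae_steps_positive : {ae P, forall w, forall i, 0 < xi i w}.
Proof.
apply: ae_foralln => i.
exists [set w | xi i w <= 0]; split; [|exact: xi0|by move=> w /=; move/negP; rewrite -leNgt].
have -> : [set w | xi i w <= 0] = setT `&` (xi i @^-1` `]-oo, 0]).
  by rewrite setTI; apply/seteqP; split => w /=; rewrite in_itv.
exact: mxi.
Qed.

Section envelope_path.
Variables (t : R) (N L : nat) (F : (R -> R) -> R) (M lam a b : R).
Hypotheses (t0 : 0 < t) (k1 : 1 <= k t) (L0 : (0 < L)%N).
Hypotheses (a0 : 0 < a) (lam0 : 0 <= lam) (FM : forall x, `|F x| <= M).

Let kap0 : 0 < mesh (k t) t mu. Proof. exact: mesh_gt0. Qed.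

(** The distance of two discretised paths on [[a, b]] is at most the sum of the differences of their
    block sums, so [lam] is inherited. The [+ 1] makes the constant positive for
    [law_comparison]. *)
Lemma envelope_path_lipschitz :
  lipschitz_in N (Num.max M lam + 1) (fun v => envelope F lam a b (path_of (k t) t mu N L v)).
Proof.
have m0 : 0 <= Num.max M lam by rewrite le_max lam0 orbT.
have LL v v' : envelope F lam a b (path_of (k t) t mu N L v) -
    envelope F lam a b (path_of (k t) t mu N L v') <=
    (Num.max M lam + 1) * \sum_(i < N) `|v i - v' i|.
  have S0 : 0 <= \sum_(i < N) `|v i - v' i| by apply: sumr_ge0.
  rewrite lerBlDl; apply: (le_trans (envelope_lipschitz lam0 FM (y := path_of (k t) t mu N L v') _ S0 _)).
  - exact: path_of_cadlag.
  - move=> u au ub; apply: path_of_lipschitz => //.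
    exact: le_trans (ltW a0) au.
  rewrite lerD2l ler_wpM2r//.
  by rewrite (@le_trans _ _ (Num.max M lam))// ?le_max ?lexx ?orbT// lerDl.
split; first by rewrite addr_ge0.
- move=> v; rewrite (@le_trans _ _ M)//; first exact/envelope_norm_le/path_of_cadlag.
  by rewrite (@le_trans _ _ (Num.max M lam))// ?le_max ?lexx// lerDl.
move=> v v'; rewrite ler_norml lerNl opprB LL/= andbT.
by under eq_bigr do rewrite distrC; exact: LL.
Qed.

End envelope_path.

Lemma path_of_steps t N L w u : (0 < L)%N ->
  path_of (k t) t mu N L (block_sums (steps xi mu sigma (k t) t) L (N * L) ^~ w) u =
  \sum_(j < N * L) step_kernel (k t) t mu u j *
    deviation (k t) t mu sigma (walk xi ^~ w) ((j %/ L) * L).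
Proof.
move=> L0; apply: eq_bigr => j _; congr (_ * _).
rewrite deviation_walk -(sum_block_sums _ (N := N))//.
by rewrite ltnW// ltn_divLR.
Qed.

Lemma path_of_BM_steps t N L w u : (0 < L)%N ->
  path_of (k t) t mu N L (block_sums (BM_steps B (mesh (k t) t mu)) L (N * L) ^~ w) u =
  \sum_(j < N * L) step_kernel (k t) t mu u j * block_BM B (mesh (k t) t mu) L j w.
Proof.
move=> L0; apply: eq_bigr => j _; congr (_ * _).
rewrite sum_block_sums//; last by rewrite ltnW// ltn_divLR.
by rewrite (walk_BM_steps BM).
Qed.

(** [Xproc] itself competes in the supremum at the discretised path, with the random bound as
    radius. *)
Lemma expectation_le_envelope (t : R) N L (F : (R -> R) -> R) (M lam a b s c : R) : 0 < t -> 1 <= k t ->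
  (0 < L)%N -> 0 < a -> a <= b -> 8 <= a * k t -> 0 < s -> 0 <= lam -> (forall x, `|F x| <= M) ->
  mesh (k t) t mu * L%:R <= s ^+ 2 ->
  (\int[P]_w random_bound xi mu sigma m2 (k t) t a b (floor_ratio k t) s N L w <= c%:E)%E ->
  measurable_fun setT (fun w => F (Xproc k xi mu (sigma ^+ 2) t w)) ->
  \int[P]_w F (Xproc k xi mu (sigma ^+ 2) t w) <=
  \int[P]_w envelope F lam a b
     (path_of (k t) t mu N L (block_sums (steps xi mu sigma (k t) t) L (N * L) ^~ w)) + lam * c.
Proof.
move=> t0 k1 L0 a0 ab ak s0 lam0 FM Ls rc mF.
have r0 := floor_ratio_ge0 k t.
apply: (expectation_le_perturbed (M := M) _ _ _ _ _ _ rc lam0) => //.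
- have lip := envelope_path_lipschitz N b t0 k1 L0 a0 lam0 FM.
  have := @measurable_lipschitz_in _ _ _ _ _ _ (block_sums (steps xi mu sigma (k t) t) L (N * L)) lip.
  apply => j.
  exact: (measurable_block_sums (steps_iid mu sigma iidxi (k t) t)).
- by move=> w; apply/envelope_norm_le => //; exact: path_of_cadlag.
- exact: (measurable_random_bound iidxi xi0 mu0 sigma0 m20 I1 I2 E1 E2 var).
- exact: random_bound_ge0.
apply: filterS ae_steps_positive => w xiw rw.
rewrite -lerBlDr; apply: le_envelope => //.
- by apply: Xproc_cadlag; exact: lt_le_trans ltr01 k1.
- by apply: fine_ge0; exact: random_bound_ge0.
- move=> u au ub; rewrite distrC path_of_steps//.
  exact: (Xproc_bound mu0 sigma0 t0 k1 a0 ab ak m20 s0).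
Qed.

End comparison.

(** * Approximation at large times *)

Section approximation.
Context d (T : measurableType d) d' (T' : measurableType d') (R : realType).
Context (P : probability T R) (Q : probability T' R).
Variables (xi : nat -> T -> R) (B : R -> T' -> R) (mu sigma m2 : R).
Hypothesis iidxi : iid P xi.
Hypothesis xi0 : forall i, P [set w | xi i w <= 0] = 0%E.
Hypotheses (mu0 : 0 < mu) (sigma0 : 0 < sigma) (m20 : 0 < m2).
Hypotheses (I1 : intble P (xi 0%N)) (I2 : intble P (fun w => xi 0%N w ^+ 2)).
Hypothesis E1 : \int[P]_w (xi 0%N w) = mu.
Hypothesis E2 : \int[P]_w (xi 0%N w ^+ 2) = m2.
Hypothesis var : m2 = sigma ^+ 2 + mu ^+ 2.
Hypothesis BM : standard_BM Q B.
Variable k : R -> R.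
Hypothesis kinf : k t @[t --> +oo] --> +oo.
Hypothesis ksmall : k t / t @[t --> +oo] --> 0.

Lemma near_ge (c : R) : \forall t \near +oo, c <= k t.
Proof. by have /cvgryPge := kinf; exact. Qed.

Lemma near_mesh_le (h : R) : 0 < h -> \forall t \near +oo, mesh (k t) t mu <= h.
Proof.
move=> h0; have hm : 0 < h / mu by rewrite divr_gt0.
have /cvgr0Pnorm_le/(_ _ hm) H := ksmall.
apply: filterS H => t /(le_trans (ler_norm _)).
by rewrite ler_pdivlMr// /mesh mulrAC.
Qed.

(** Taking the integer part loses at most one mesh, and one mesh is at most half of [s ^+ 2]. *)
Lemma block_length (s kap : R) : 0 < kap -> 0 < s -> kap <= s ^+ 2 / 2 ->
  exists L, [/\ (0 < L)%N, kap * L%:R <= s ^+ 2 & s ^+ 2 / 2 <= kap * L%:R].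
Proof.
move=> kap0 s0 kaps; have s20 : 0 < s ^+ 2 by rewrite exprn_gt0.
exists (Num.truncn (s ^+ 2 / kap)); set L := Num.truncn _.
have h1 : kap * L%:R <= s ^+ 2.
  by rewrite mulrC -ler_pdivlMr// truncn_le divr_ge0// ltW.
have h2 : s ^+ 2 / 2 <= kap * L%:R.
  have := truncnS_gt (s ^+ 2 / kap); rewrite -/L ltr_pdivrMr// mulrC -natr1 mulrDr mulr1.
  by move: kaps; lra.
split => //; rewrite lt0n; apply/eqP => L0; move: h2; rewrite L0 mulr0; move: s20; lra.
Qed.

(** The two sides are treated differently: on [Q] the approximation is pathwise, since an almost
    sure limit will be taken there, while [P] enters only through expectations. The threshold in [t]
    depends on [F] through [M] alone. *)
Lemma approximation a b lam M eps : 0 < a -> a <= b -> 0 <= lam -> 0 < eps ->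
  \forall t \near +oo, exists (Phi : T' -> R -> R) (r : T' -> \bar R),
  [/\ forall w, continuous (Phi w), measurable_fun setT r, (forall w, 0 <= r w)%E,
      (\int[Q]_w r w <= eps%:E)%E &
      forall w, (r w < +oo)%E -> forall u, a <= u -> u <= b ->
        `|Tproc B w u - Phi w u| <= fine (r w)] /\
  forall F : (R -> R) -> R, (forall x, `|F x| <= M) ->
    measurable_fun setT (fun w => F (Xproc k xi mu (sigma ^+ 2) t w)) ->
    measurable_fun setT (fun w => envelope F lam a b (Phi w)) /\
    \int[P]_w F (Xproc k xi mu (sigma ^+ 2) t w) <=
    \int[Q]_w envelope F lam a b (Phi w) + eps.
Proof.
move=> a0 ab lam0 eps0.
have lam10 : 0 < 2 * (lam + 1) by rewrite mulr_gt0// ltr_wpDl.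
(* The random radius gets multiplied by [lam]; the other half of [eps] pays for the change of
   law. *)
pose eps1 := eps / (2 * (lam + 1)).
have eps10 : 0 < eps1 by rewrite divr_gt0.
have eps1le : eps1 <= eps.
  by rewrite ler_pdivrMr// ler_peMr ?(ltW eps0)//; move: lam0; lra.
have eps1lam : lam * eps1 + eps / 2 <= eps.
  have e2 : 0 < eps / 2 by rewrite divr_gt0.
  rewrite -lerBrDr (_ : eps - eps / 2 = (lam + 1) * eps1).
    by rewrite ler_wpM2r ?(ltW eps10)// lerDl.
  by rewrite /eps1; field; rewrite gt_eqF//; move: lam0; lra.
have G0 : 0 < (1 - expR (- (mu ^+ 2 / (16 * m2))))^-1.
  rewrite invr_gt0 subr_gt0 -[ltRHS]expR0 ltr_expR oppr_lt0.
  by rewrite divr_gt0 ?exprn_gt0// mulr_gt0.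
have [s [h [N [s0 h0 h1 hs HN]]]] :=
  error_parameters mu0 sigma0 a0 ab G0 eps10.
have K0 : 0 < Num.max M lam + 1.
  by rewrite ltr_wpDl// le_max lam0 orbT.
have s20 : 0 < s ^+ 2 by rewrite exprn_gt0.
have e20 : 0 < eps / 2 by rewrite divr_gt0.
have [k0 k00 Hk0] := law_comparison iidxi sigma0 mu0 I1 I2 E1 E2 var BM N K0 s20 e20.
near=> t.
have t0 : 0 < t by near: t; exact: nbhs_pinfty_gt.
have k1 : 1 <= k t by near: t; exact: near_ge.
have kh : h^-1 <= k t by near: t; exact: near_ge.
have ka : 8 <= a * k t.
  by rewrite -ler_pdivrMl// mulrC; near: t; exact: near_ge.
have mh : mesh (k t) t mu <= h by near: t; exact: near_mesh_le.
have mk : mesh (k t) t mu <= k0 by near: t; exact: near_mesh_le.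
have kt0 : 0 < k t := lt_le_trans ltr01 k1.
have kap0 : 0 < mesh (k t) t mu by exact: mesh_gt0.
have khi : (k t)^-1 <= h.
  by rewrite -[h]invrK lef_pV2 ?posrE// invr_gt0.
have [L [L0 Ls Ls2]] := block_length kap0 s0 (le_trans mh hs).
have r0 := floor_ratio_ge0 k t.
have r1 := floor_ratio_le1 k1.
have [A1 A2] := HN _ _ _ _ k1 t0 khi mh r0 r1 Ls2.
pose Phi w := path_of (k t) t mu N L
  (block_sums (BM_steps B (mesh (k t) t mu)) L (N * L) ^~ w).
exists Phi, (BM_bound B a b (mesh (k t) t mu) N L); split.
  split => //.
  - by move=> w; exact: path_of_continuous.
  - exact: (measurable_BM_bound BM _ N L a0 ab).
  - by move=> w; exact: BM_bound_ge0.
  - apply: le_trans (BM_bound_expectation BM N a0 ab s0 kap0 L0 Ls) _.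
    by rewrite lee_fin (le_trans A2).
  - move=> w rw u au ub; rewrite /Phi (path_of_BM_steps mu BM k)//.
    exact: (Tproc_bound BM a0 ab kap0 rw au ub).
move=> F FM mF.
have lip := envelope_path_lipschitz mu0 N b t0 k1 L0 a0 lam0 FM.
split.
  apply: (@measurable_lipschitz_in _ _ _ _ _ _ (block_sums (BM_steps B (mesh (k t) t mu)) L (N * L)) lip) => j.
  exact: (measurable_block_sums (BM_steps_iid BM kap0)).
have rc := random_bound_expectation iidxi xi0 mu0 sigma0 m20 I1 I2 E1 E2 var N k1 t0 a0 ab r0 s0 L0 Ls (le_trans mh h1).
have {}rc := le_trans rc (_ : _ <= eps1%:E)%E.
have := expectation_le_envelope iidxi xi0 mu0 sigma0 m20 I1 I2 E1 E2 var t0 k1 L0 a0 ab ka s0 lam0 FM Ls (rc _) mF.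
move=> /(_ A1) H.
have := Hk0 _ _ _ k1 t0 mk L0 Ls _ lip.
rewrite ler_distl => /andP[_ H2].
apply: (le_trans H); apply: (le_trans (lerD H2 (lexx _))).
rewrite -/(Phi _) -addrA lerD2l//.
by rewrite addrC.
Unshelve. all: by end_near. Qed.

End approximation.

(** * Upper limit of the majorants *)

Section envelope_limit.
Context {R : realType}.
Variables (y : R -> R) (phi : nat -> R -> R) (rho : nat -> R).
Hypothesis cphi : forall l, continuous (phi l).
Hypothesis rho_cvg0 : rho l @[l --> \oo] --> 0.
Hypothesis phi_near : forall l u, l.+1%:R^-1 <= u -> u <= l.+1%:R -> `|y u - phi l u| <= rho l.

Lemma near_window (p q : R) : 0 < p ->
  \forall l \near \oo, l.+1%:R^-1 <= p /\ q <= l.+1%:R.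
Proof.
move=> p0; near=> l; split; last first.
  by rewrite (@le_trans _ _ l%:R) ?ler_nat//; near: l; exact: nbhs_infty_ger.
rewrite -[p]invrK lef_pV2 ?posrE ?invr_gt0//.
by rewrite (@le_trans _ _ l%:R) ?ler_nat//; near: l; exact: nbhs_infty_ger.
Unshelve. all: by end_near. Qed.

Lemma near_rho_le (e : R) : 0 < e -> \forall l \near \oo, rho l <= e.
Proof.
move=> e0; have /cvgr0Pnorm_le/(_ _ e0) H := rho_cvg0.
by apply: filterS H => l; exact: le_trans (ler_norm _).
Qed.

(** Path continuity of the limit process is obtained from its continuous approximations rather than
    from the integral defining it. *)
Lemma locally_uniform_limit_continuous (s : R) : 0 < s -> {for s, continuous y}.
Proof.
move=> s0; apply/cvgrPdist_le => e e0.
have e30 : 0 < e / 3 by rewrite divr_gt0.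
have s20 : 0 < s / 2 by rewrite divr_gt0.
have [l [[h1 h2] h3]] : exists l, (l.+1%:R^-1 <= s / 2 /\ s + 1 <= l.+1%:R) /\ rho l <= e / 3.
  by near \oo => l; exists l; split; near: l; [exact: near_window|exact: near_rho_le].
have hs : `|y s - phi l s| <= rho l.
  by apply: phi_near; [apply: (le_trans h1); move: s0; lra|apply: le_trans h2; lra].
have /cvgrPdist_le/(_ _ e30) H := @cphi l s.
near=> x.
have hx : `|y x - phi l x| <= rho l.
  apply: phi_near.
    apply: (@le_trans _ _ (s / 2)) => //; near: x; apply: lt_le_nbhsr; move: s0; lra.
  apply: (@le_trans _ _ (s + 1)) => //; near: x; apply: lt_le_nbhsl; lra.
have hp : `|phi l s - phi l x| <= e / 3 by near: x.
have -> : y s - y x = (y s - phi l s) + (phi l s - phi l x) - (y x - phi l x) by ring.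
rewrite (le_trans (ler_normB _ _))//.
have := ler_normD (y s - phi l s) (phi l s - phi l x).
have := h3; have := hs; have := hx; have := hp; lra.
Unshelve. all: by end_near. Qed.

Variables (F : (R -> R) -> R) (M : R).
Hypothesis FM : forall x, `|F x| <= M.
Hypothesis cF : forall (xs : nat -> R -> R) (x : R -> R),
  (forall n, cadlag_pos (xs n)) -> cadlag_pos x -> J1_conv xs x ->
  F (xs n) @[n --> \oo] --> F x.

(** A near-optimal competitor has radius at most [(2 * M + 1) / l.+1], as a larger one would push
    the value below [- M]. Such competitors converge to [y] locally uniformly, hence in J1, and
    sequential continuity of [F] applies to them. *)
Lemma envelope_limsup (e : R) : 0 < e ->
  \forall l \near \oo, envelope F l.+1%:R l.+1%:R^-1 l.+1%:R (phi l) <= F y + e.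
Proof.
move=> e0.
have cy : cadlag_pos y.
  by apply: continuous_pos_cadlag; exact: locally_uniform_limit_continuous.
pose g l := envelope F l.+1%:R l.+1%:R^-1 l.+1%:R (phi l).
have cp l : cadlag_pos (phi l).
  by apply: continuous_pos_cadlag => s _; exact: cphi.
have wit l : exists zr : (R -> R) * R, [/\ cadlag_pos zr.1, 0 <= zr.2,
     forall u, l.+1%:R^-1 <= u -> u <= l.+1%:R -> `|phi l u - zr.1 u| <= zr.2 &
     g l - l.+1%:R^-1 < F zr.1 - l.+1%:R * zr.2].
  have hv : g l - l.+1%:R^-1 < g l by rewrite gtrBl invr_gt0.
  have [z [r [h1 h2 h3 h4]]] := envelope_witness (ler0n R l.+1) FM (cp l) hv.
  by exists (z, r).
have /choice [zr Hzr] := wit.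
have M0 : 0 <= M by exact: le_trans (normr_ge0 _) (FM (fun=> 0)).
have rle l : (zr l).2 <= (2 * M + 1) * l.+1%:R^-1.
  have [_ _ _ h4] := Hzr l.
  have g1 : - M <= g l by apply: envelope_ge => //; exact: cp.
  have g2 : F (zr l).1 <= M := le_trans (ler_norm _) (FM _).
  have l1 : l.+1%:R^-1 <= 1 :> R by rewrite invf_le1// ler1n.
  rewrite ler_pdivlMr// mulrC.
  by move: h4 g1 g2 l1; move: (l.+1%:R^-1) (_ * _) (F _) (g l) => p q f v; lra.
have conv : J1_conv (fun l => (zr l).1) y.
  apply: J1_conv_locally_uniform => p q c p0 pq c0.
  have c20 : 0 < c / 2 by rewrite divr_gt0.
  have c40 : 0 < c / 2 / (2 * M + 1) by rewrite divr_gt0// ltr_wpDl// mulr_ge0.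
  near=> l => u /andP[pu uq].
  have [w1 w2] : l.+1%:R^-1 <= p /\ q <= l.+1%:R by near: l; exact: near_window.
  have [v1 _] : l.+1%:R^-1 <= c / 2 / (2 * M + 1) /\ (0 : R) <= l.+1%:R by near: l; exact: near_window.
  have h : rho l <= c / 2 by near: l; exact: near_rho_le.
  have [_ _ h3 _] := Hzr l.
  have lu := le_trans w1 pu; have ul := le_trans uq w2.
  have b1 := h3 u lu ul; have b2 := phi_near lu ul.
  have b3 : (zr l).2 <= c / 2.
    by rewrite (le_trans (rle l))// mulrC -ler_pdivlMr// ltr_wpDl// mulr_ge0.
  have -> : (zr l).1 u - y u = - (phi l u - (zr l).1 u) - (y u - phi l u) by ring.
  rewrite (le_trans (ler_normB _ _))// normrN.
  move: b1 b2 b3 h; lra.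
have e20 : 0 < e / 2 by rewrite divr_gt0.
have /cvgrPdist_le/(_ _ e20) HF := cF (fun l => let: And4 h _ _ _ := Hzr l in h) cy conv.
near=> l.
have h1 : `|F y - F (zr l).1| <= e / 2 by near: l.
have [h2 _] : l.+1%:R^-1 <= e / 2 /\ (0 : R) <= l.+1%:R by near: l; exact: near_window.
have [_ r0 _ h4] := Hzr l.
have lr0 : 0 <= l.+1%:R * (zr l).2 by rewrite mulr_ge0.
rewrite -/(g l); move: h1; rewrite ler_distl => /andP[h1 _].
by move: h1 h2 h4 lr0; move: (l.+1%:R^-1) (l.+1%:R * _) (F (zr l).1) (g l) => p q f v; lra.
Unshelve. all: by end_near. Qed.

End envelope_limit.

(** * Weak convergence from the approximation *)

Section weak_limit.
Context d (T : measurableType d) d' (T' : measurableType d') (R : realType).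
Context (P : probability T R) (Q : probability T' R).

(** The sum of the [r l] has finite expectation, so it is almost surely finite and its terms tend to
    [0]. *)
Lemma ae_summable_cvg0 (r : nat -> T' -> \bar R) :
  (forall l, measurable_fun setT (r l)) -> (forall l w, 0 <= r l w)%E ->
  (forall l, \int[Q]_w r l w <= ((2^-1 : R) ^+ l)%:E)%E ->
  {ae Q, forall w, (forall l, r l w < +oo)%E /\ fine (r l w) @[l --> \oo] --> 0}.
Proof.
move=> mr r0 hr.
have mS : measurable_fun setT (fun w => \sum_(0 <= l <oo) r l w)%E.
  by apply: ge0_emeasurable_sum => // l w _ _; exact: r0.
have S0 w : (0 <= \sum_(0 <= l <oo) r l w)%E by exact: nneseries_ge0.
have Sfin : (\int[Q]_w (\sum_(0 <= l <oo) r l w) < +oo)%E.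
  rewrite integral_nneseries//; apply: (@le_lt_trans _ _ ((1 - 2^-1)^-1)%:E); last exact: ltry.
  apply: nneseries_le_partial => [l|n]; first by apply: integral_ge0 => w _; exact: r0.
  apply: le_trans (lee_sum _ (fun l _ => hr l)) _.
  by rewrite sumEFin lee_fin big_mkord geometric_partial_sum ?invr_ge0// invf_lt1 ?ltr1n.
apply: filterS (ae_finite mS S0 Sfin) => w Sw.
have part n : (\sum_(0 <= l < n) r l w <= \sum_(0 <= l <oo) r l w)%E.
  exact: partial_le_nneseries.
have rfin l : (r l w < +oo)%E.
  apply: le_lt_trans Sw; apply: le_trans (part l.+1).
  by rewrite big_nat_recr//= leeDr// sume_ge0.
split=> //; apply: cvg_series_cvg_0; apply: nondecreasing_is_cvgn.
  by apply/nondecreasing_seqP => n; rewrite /series/= big_nat_recr//= lerDl fine_ge0.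
exists (fine (\sum_(0 <= l <oo) r l w)%E) => _ [n _ <-].
rewrite /series/= -lee_fin fineK ?ge0_fin_numE// -sumEFin.
rewrite (eq_bigr (fun l => r l w)) ?part// => l _.
by rewrite fineK// ge0_fin_numE.
Qed.

Variables (X : R -> T -> R -> R) (Y : T' -> R -> R).
Hypothesis approx : forall a b lam M eps, 0 < a -> a <= b -> 0 <= lam -> 0 < eps ->
  \forall t \near +oo, exists (Phi : T' -> R -> R) (r : T' -> \bar R),
  [/\ forall w, continuous (Phi w), measurable_fun setT r, (forall w, 0 <= r w)%E,
      (\int[Q]_w r w <= eps%:E)%E &
      forall w, (r w < +oo)%E -> forall u, a <= u -> u <= b ->
        `|Y w u - Phi w u| <= fine (r w)] /\
  forall F : (R -> R) -> R, (forall x, `|F x| <= M) ->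
    measurable_fun setT (fun w => F (X t w)) ->
    measurable_fun setT (fun w => envelope F lam a b (Phi w)) /\
    \int[P]_w F (X t w) <= \int[Q]_w envelope F lam a b (Phi w) + eps.

Section test_functional.
Variables (F : (R -> R) -> R) (M : R).
Hypothesis FM : forall x, `|F x| <= M.
Hypothesis cF : forall (xs : nat -> R -> R) (x : R -> R),
  (forall n, cadlag_pos (xs n)) -> cadlag_pos x -> J1_conv xs x ->
  F (xs n) @[n --> \oo] --> F x.
Hypothesis mX : forall t, measurable_fun setT (fun w => F (X t w)).
Hypothesis mY : measurable_fun setT (fun w => F (Y w)).

(* Along times [t_l] violating the claim the approximation errors can be chosen at
   most [2 ^- l], hence almost surely summable. *)
Lemma expectation_limsup eps : 0 < eps ->
  \forall t \near +oo, \int[P]_w F (X t w) <= \int[Q]_w F (Y w) + eps.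
Proof.
move=> eps0; apply: contrapT => nF.
have half l : 0 < (2^-1 : R) ^+ l by rewrite exprn_gt0// invr_gt0.
have pick l : exists Pr : (T' -> R -> R) * (T' -> \bar R),
  [/\ forall w, continuous (Pr.1 w), measurable_fun setT Pr.2, (forall w, 0 <= Pr.2 w)%E,
      (\int[Q]_w Pr.2 w <= ((2^-1 : R) ^+ l)%:E)%E &
      forall w, (Pr.2 w < +oo)%E -> forall u, l.+1%:R^-1 <= u -> u <= l.+1%:R ->
        `|Y w u - Pr.1 w u| <= fine (Pr.2 w)] /\
    (measurable_fun setT (fun w => envelope F l.+1%:R l.+1%:R^-1 l.+1%:R (Pr.1 w)) /\
    \int[Q]_w F (Y w) + eps <=
      \int[Q]_w envelope F l.+1%:R l.+1%:R^-1 l.+1%:R (Pr.1 w) + (2^-1 : R) ^+ l).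
  apply: contrapT => nl; apply: nF.
  have l0 : 0 < l.+1%:R^-1 :> R by rewrite invr_gt0.
  have ll : l.+1%:R^-1 <= l.+1%:R :> R.
    by rewrite (@le_trans _ _ 1)// ?ler1n// invf_le1// ler1n.
  have := approx M l0 ll (ler0n R l.+1) (half l).
  apply: filterS => t [Phi [r [H1 H2]]].
  have [H3 H4] := H2 F FM (mX t).
  rewrite leNgt; apply/negP => /ltW H5; apply: nl.
  by exists (Phi, r); split => //; split => //; exact: le_trans H5 H4.
have /choice [Pr HPr] := pick.
pose Phi l := (Pr l).1; pose r l := (Pr l).2.
pose g l w := envelope F l.+1%:R l.+1%:R^-1 l.+1%:R (Phi l w).
have cPhi w l : continuous (Phi l w) by have [[+ _ _ _ _] _] := HPr l; exact.
have mr l : measurable_fun setT (r l) by have [[_ + _ _ _] _] := HPr l.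
have r0 l w : (0 <= r l w)%E by have [[_ _ + _ _] _] := HPr l; exact.
have hr l : (\int[Q]_w r l w <= ((2^-1 : R) ^+ l)%:E)%E by have [[_ _ _ + _] _] := HPr l.
have near_r l w : (r l w < +oo)%E -> forall u, l.+1%:R^-1 <= u -> u <= l.+1%:R ->
    `|Y w u - Phi l w u| <= fine (r l w).
  by have [[_ _ _ _ +] _] := HPr l; exact.
have mg l : measurable_fun setT (g l) by have [_ [+ _]] := HPr l.
have gE l : \int[Q]_w F (Y w) + eps <= \int[Q]_w g l w + (2^-1 : R) ^+ l.
  by have [_ [_ +]] := HPr l.
have gM l w : `|g l w| <= M.
  by apply: envelope_norm_le => //; apply: continuous_pos_cadlag => s _; exact: cPhi.
(* Only the upper limit of [g l] is controlled; the maximum with [F (Y w)] turns this into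
   convergence, and the bound [M] allows dominated convergence. *)
pose h l w := Num.max (g l w) (F (Y w)).
have mh l : measurable_fun setT (h l) by exact: measurable_maxr.
have hM l w : `|h l w| <= M by rewrite /h; case: (leP (g l w)) => _; [exact: FM|exact: gM].
have hcvg : {ae Q, forall w, h l w @[l --> \oo] --> F (Y w)}.
  apply: filterS (ae_summable_cvg0 mr r0 hr) => w [rw rw0].
  apply/cvgrPdist_le => e e0.
  have := @envelope_limsup R (Y w) (Phi ^~ w) (fun l => fine (r l w)) (cPhi w) rw0
    (fun l => @near_r l w (rw l)) F M FM cF e e0.
  apply: filterS => l gl; rewrite distrC ger0_norm ?subr_ge0 ?le_max ?lexx ?orbT//.
  by rewrite lerBlDl ge_max gl lerDl ltW.
have Ih l : intble Q (h l) := intble_bounded Q (mh l) (hM l).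
have Ig l : intble Q (g l) := intble_bounded Q (mg l) (gM l).
have IY : intble Q (fun w => F (Y w)) := intble_bounded Q mY (fun w => FM _).
have ihcvg : (\int[Q]_w (h l w)%:E @[l --> \oo] --> \int[Q]_w (F (Y w))%:E)%E.
  have := @dominated_convergence _ _ _ Q setT measurableT (fun l => EFin \o h l)
     (fun w => (F (Y w))%:E) (cst M%:E).
  case => //.
  - by move=> l; exact/measurable_EFinP.
  - exact/measurable_EFinP.
  - apply: filterS hcvg => w hw _; apply: cvg_EFin; first exact: nearW.
    exact: hw.
  - exact: intble_cst.
  - by apply: aeW => w l _ /=; rewrite lee_fin.
have rcvg : \int[Q]_w h l w @[l --> \oo] --> \int[Q]_w F (Y w).
  by move: ihcvg; rewrite intbleE// => /fine_cvg.
have e30 : 0 < eps / 3 by rewrite divr_gt0.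
have /cvgrPdist_le/(_ _ e30) H1 := rcvg.
have : (fun l => (2^-1 : R) ^+ l) @ \oo --> 0.
  by apply: cvg_expr; rewrite ger0_norm ?invr_ge0// invf_lt1 ?ltr1n.
move=> /cvgr0Pnorm_le/(_ _ e30) H2.
near \oo => l.
have h1 : `|\int[Q]_w F (Y w) - \int[Q]_w h l w| <= eps / 3 by near: l.
have h2 : `|(2^-1 : R) ^+ l| <= eps / 3 by near: l.
have h3 := gE l.
have h4 : \int[Q]_w g l w <= \int[Q]_w h l w.
  by apply: intble_le_expectation => // w; rewrite le_max lexx.
move: h1 h2; rewrite ler_distl => /andP[h1 _]; rewrite ger0_norm ?(ltW (half l))// => h2.
have := h1; have := h2; have := h3; have := h4; have := eps0; lra.
Unshelve. all: by end_near. Qed.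

End test_functional.

Lemma weak_conv_of_approximation : weak_conv_J1 P Q X Y.
Proof.
move=> F [M FM] cF mX mY.
have IX t : intble P (fun w => F (X t w)) := intble_bounded P (mX t) (fun w => FM _).
have IY : intble Q (fun w => F (Y w)) := intble_bounded Q mY (fun w => FM _).
rewrite intbleE//; apply: cvg_EFin; first by apply: nearW => t; rewrite intbleE.
apply/cvgrPdist_le => e e0.
have H1 := expectation_limsup FM cF mX mY e0.
have NM x : `|- F x| <= M by rewrite normrN.
have H2 : \forall t \near +oo,
    \int[P]_w (- F (X t w)) <= \int[Q]_w (- F (Y w)) + e := @expectation_limsup (fun x => - F x) M NM
  (fun xs x h1 h2 h3 => cvgN (cF xs x h1 h2 h3))
  (fun t => measurable_funN (mX t)) (measurable_funN mY) e e0.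
have RN d0 (T0 : measurableType d0) (m : probability T0 R) (f : T0 -> R) : intble m f ->
    \int[m]_w (- f w) = - \int[m]_w f w.
  move=> If; under eq_Rintegral do rewrite -mulN1r.
  by rewrite RintegralZl// mulN1r.
near=> t.
have h1 : \int[P]_w F (X t w) <= \int[Q]_w F (Y w) + e by near: t.
have h2 : \int[P]_w (- F (X t w)) <= \int[Q]_w (- F (Y w)) + e by near: t; exact: H2.
move: h2; rewrite (RN _ _ _ _ (IX t)) (RN _ _ _ _ IY) => h2.
change (`|\int[Q]_w F (Y w) - \int[P]_w F (X t w)| <= e).
have := h1; have := h2; rewrite ler_distl.
by move: (\int[P]_w F (X t w)) (\int[Q]_w F (Y w)) => p q ? ?; apply/andP; split; lra.
Unshelve. all: by end_near. Qed.

End weak_limit.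

(** * Moments of the steps from the hypotheses *)

Section moments.
Context d (T : measurableType d) (R : realType) (P : probability T R).
Variables (eta : T -> R) (mu sigma2 : R).
Hypothesis meta : measurable_fun setT eta.
Hypothesis mean : (\int[P]_w (eta w)%:E = mu%:E)%E.
Hypothesis variance : (\int[P]_w ((eta w - mu) ^+ 2)%:E = sigma2%:E)%E.

(** A nonnegative function with finite integral is integrable; integrability of [eta] and of its
    square then follows by domination, whereas the value of the mean alone would not show it. *)
Lemma intble_centered_square : intble P (fun w => (eta w - mu) ^+ 2).
Proof.
apply/integrableP; split.
  by apply/measurable_EFinP; apply: measurable_funX; exact: measurable_funB.
rewrite (eq_integral (fun w => ((eta w - mu) ^+ 2)%:E)); first by rewrite variance ltry.
by move=> w _ /=; rewrite ger0_norm ?sqr_ge0.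
Qed.

Lemma intble_square : intble P (fun w => eta w ^+ 2).
Proof.
apply: (intble_le (g := fun w => 2 * (eta w - mu) ^+ 2 + 2 * mu ^+ 2)).
- exact: measurable_funX.
- move=> w; rewrite ger0_norm ?sqr_ge0// -subr_ge0.
  have -> : 2 * (eta w - mu) ^+ 2 + 2 * mu ^+ 2 - eta w ^+ 2 = (eta w - 2 * mu) ^+ 2 by ring.
  exact: sqr_ge0.
- by apply: intbleD; [exact/intbleZ/intble_centered_square|exact: intble_cst].
Qed.

Lemma intble_of_square : intble P eta.
Proof.
apply: (intble_le (g := fun w => 1 + eta w ^+ 2)) => //.
- move=> w; have := sqr_ge0 (eta w - 1); have := sqr_ge0 (eta w + 1).
  by rewrite ler_norml !sqrrD; move: (eta w ^+ 2) (sqr_ge0 (eta w)) => s s0 h1 h2; apply/andP; split; lra.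
- by apply: intbleD; [exact: intble_cst|exact: intble_square].
Qed.

Lemma second_moment : \int[P]_w (eta w ^+ 2) = sigma2 + mu ^+ 2.
Proof.
have E1 : \int[P]_w (eta w) = mu by rewrite /Rintegral mean.
have Ev : \int[P]_w ((eta w - mu) ^+ 2) = sigma2 by rewrite /Rintegral variance.
have -> : \int[P]_w (eta w ^+ 2) =
    \int[P]_w ((eta w - mu) ^+ 2 + (2 * mu * eta w + - mu ^+ 2)).
  by apply: eq_Rintegral => w _; ring.
have I1 := intble_of_square.
have I3 : intble P (fun w => 2 * mu * eta w) := intbleZ (2 * mu) I1.
have I4 := intble_cst P (- mu ^+ 2).
rewrite RintegralD//; [|exact: intble_centered_square|exact: intbleD].
rewrite RintegralD// RintegralZl// E1 Ev expectation_cst.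
by ring.
Qed.

(** An almost surely positive variable of mean zero would vanish almost everywhere, which is
    impossible because a probability is not the zero measure. *)
Lemma positive_mean : P [set w | eta w <= 0] = 0%E -> 0 < mu.
Proof.
move=> eta0.
have aepos : {ae P, forall w, 0 < eta w}.
  exists [set w | eta w <= 0]; split => //; last by move=> w /= /negP; rewrite -leNgt.
  have -> : [set w | eta w <= 0] = setT `&` (eta @^-1` `]-oo, 0]).
    by rewrite setTI; apply/seteqP; split => w /=; rewrite in_itv.
  exact: meta.
have mE : measurable_fun setT (EFin \o eta) by exact/measurable_EFinP.
have absE : (\int[P]_w `|(eta w)%:E| = mu%:E)%E.
  rewrite -mean; apply: ae_eq_integral => //.
    exact: measurableT_comp.
  by apply: filterS aepos => w w0 _ /=; rewrite ger0_norm// ltW.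
rewrite lt_neqAle; apply/andP; split; last first.
  by rewrite -lee_fin -absE integral_ge0.
apply/eqP => mu0.
have /(ae_eq_integral_abs _ measurableT mE) ae0 : (\int[P]_w `|(eta w)%:E| = 0)%E.
  by rewrite absE -mu0.
have PT : (0 < P setT)%E.
  have -> : (P : {measure set T -> \bar R}) setT = 1%E by exact: probability_setT.
  exact: lte01.
have pf := ae_properfilter_algebraOfSetsType PT.
have [w [w1 w2]] := filter_ex (filterI aepos ae0).
by move: w1; have /= [->] := w2 Logic.I; rewrite ltxx.
Qed.

End moments.

Unset Implicit Arguments.

Theorem theorem2p2 (R : realType)
  (d : measure_display) (Omega : measurableType d) (P : probability Omega R)
  (d' : measure_display) (Omega' : measurableType d') (Q : probability Omega' R)
  (k : R -> R) (xi : nat -> Omega -> R) (mu sigma2 : R) (B : R -> Omega' -> R) :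
  (forall t, 0 < k t) ->
  k t @[t --> +oo] --> +oo ->
  k t / t @[t --> +oo] --> 0 ->
  iid P xi ->
  (forall i, P [set w | xi i w <= 0] = 0%E) ->
  (\int[P]_w (xi 0%N w)%:E)%E = mu%:E ->
  (\int[P]_w ((xi 0%N w - mu) ^+ 2)%:E)%E = sigma2%:E ->
  0 < sigma2 ->
  standard_BM Q B ->
  weak_conv_J1 P Q (Xproc k xi mu sigma2) (Tproc B).
Proof.
move=> k0 kinf ksmall iidxi xi0 mean variance sigma20 BM.
have mxi : measurable_fun setT (xi 0%N) by case: iidxi.
have mu0 := positive_mean mxi mean (xi0 0%N).
have sigma0 : 0 < Num.sqrt sigma2 by rewrite sqrtr_gt0.
have sE : Num.sqrt sigma2 ^+ 2 = sigma2 by rewrite sqr_sqrtr// ltW.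
have m20 : 0 < sigma2 + mu ^+ 2 by rewrite addr_gt0// exprn_gt0.
have E1 : \int[P]_w (xi 0%N w) = mu by rewrite /Rintegral mean.
rewrite -sE; apply: weak_conv_of_approximation => a b lam M eps a0 ab lam0 eps0.
apply: (@approximation _ _ _ _ _ P Q xi B mu _ (sigma2 + mu ^+ 2)) => //.
- exact: intble_of_square mxi variance.
- exact: intble_square mxi variance.
- exact: second_moment mxi mean variance.
- by rewrite sE.
Qed.
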